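(* Let $h>0$, $\tau>0$, $x_0\in\mathbb{R}^d$, and let $(u_n)$ be a real sequence such that $n\,\mu(B_n)\to\tau$, where $B_n:=B(x_0,e^{-u_n})$. Then for every integer $k\ge0$, $$\lim_{n\to\infty}\mathbb{P}\otimes\mu\left(\sum_{i=0}^{\lfloor \tau/\mu(B_n)\rfloor}1_{B_n}\big(X^x_{ih}\big)=k\right)=\frac{e^{-\tau}\tau^k}{k!}.$$
   Context: Consider on $\mathbb{R}^d$ the stochastic differential equation $dX_t=b(X_t)\,dt+dW_t$, $X_0=x$, where $W$ is a standard $d$-dimensional Brownian motion on a probability space $(\Omega,\mathcal{F},\mathbb{P})$ and $b:\mathbb{R}^d\to\mathbb{R}^d$ satisfies: (H) there is $K$ with $|b(x)-b(y)|\le K|x-y|$ for all $x,y$; (AD) there are constants $R_1\in\mathbb{R}$, $R_2>0$ with $\langle b(x),x\rangle\le R_1-R_2\|x\|^2$ for all $x$. $X^x_t$ denotes the solution started at $x$. Under these assumptions the process has a unique invariant probability measure $\mu$, absolutely continuous with respect to Lebesgue measure. $\mathbb{P}\otimes\mu$ is the product measure on $\Omega\times\mathbb{R}^d$ (initial condition $x$ distributed by $\mu$, independent of the noise). $B(x_0,r)$ is the open Euclidean ball and $1_{B}$ the indicator function. *)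

(* Defs.v *)
From HB Require Import structures.
From mathcomp Require Import all_boot all_order all_algebra.
From mathcomp Require Import all_classical all_reals all_analysis.
Set Implicit Arguments. Unset Strict Implicit. Unset Printing Implicit Defensive.
Import Order.TTheory GRing.Theory Num.Theory.
Import numFieldNormedType.Exports.
Local Open Scope classical_set_scope.
Local Open Scope ring_scope.

Definition Rd (R : realType) (d : nat) : Type :=
  g_sigma_algebraType (@open 'rV[R]_d).

Definition dotRd {R : realType} {d : nat} (x y : 'rV[R]_d) : R :=
  \sum_(j < d) x ord0 j * y ord0 j.
Definition enorm {R : realType} {d : nat} (x : 'rV[R]_d) : R :=
  Num.sqrt (dotRd x x).
Definition eball {R : realType} {d : nat} (x0 : 'rV[R]_d) (r : R) : set (Rd R d) :=
  [set x | enorm (x - x0) < r].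

Definition lipschitz_drift {R : realType} {d : nat} (b : 'rV[R]_d -> 'rV[R]_d) :=
  exists K : R, forall x y, enorm (b x - b y) <= K * enorm (x - y).

Definition dissipative_drift {R : realType} {d : nat} (b : 'rV[R]_d -> 'rV[R]_d) :=
  exists R1 R2 : R, 0 < R2 /\ forall x, dotRd (b x) x <= R1 - R2 * enorm x ^+ 2.

Definition mutually_independent {dO : measure_display} {Omega : measurableType dO}
  {R : realType} (P : probability Omega R) (I : finType) (Y : I -> Omega -> R) :=
  forall A : I -> set R, (forall i, measurable (A i)) ->
    P (\bigcap_(i in [set: I]) (Y i @^-1` A i)) = (\prod_(i : I) P (Y i @^-1` A i))%E.

Definition std_brownian {dO : measure_display} {Omega : measurableType dO}
  {R : realType} {d : nat} (P : probability Omega R) (W : R -> Omega -> 'rV[R]_d) :=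
  [/\ (forall w, W 0 w = 0),
      (forall w, continuous (fun t => W t w)),
      (forall t (j : 'I_d), measurable_fun setT (fun w => W t w ord0 j)) &
      (forall (n : nat) (tt : nat -> R), 0 <= tt 0%N ->
         (forall i, (i < n)%N -> tt i < tt i.+1) ->
         let incr := fun (ij : 'I_n * 'I_d) (w : Omega) =>
           W (tt ij.1.+1) w ord0 ij.2 - W (tt ij.1) w ord0 ij.2 in
         mutually_independent P incr /\
         forall (ij : 'I_n * 'I_d) (A : set R), measurable A ->
           P (incr ij @^-1` A) =
           normal_prob 0 (Num.sqrt (tt ij.1.+1 - tt ij.1)) A)].

Definition sde_solution {dO : measure_display} {Omega : measurableType dO}
  {R : realType} {d : nat} (b : 'rV[R]_d -> 'rV[R]_d) (W : R -> Omega -> 'rV[R]_d)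
  (X : 'rV[R]_d -> R -> Omega -> 'rV[R]_d) :=
  forall x w,
    {within `[0, +oo[, continuous (fun t => X x t w)} /\
    forall t, 0 <= t ->
      X x t w = x + \row_(j < d)
        (Rintegral lebesgue_measure `[0, t] (fun s => b (X x s w) ord0 j))
        + W t w.

Definition invariant_measure {dO : measure_display} {Omega : measurableType dO}
  {R : realType} {d : nat} (P : probability Omega R)
  (X : 'rV[R]_d -> R -> Omega -> 'rV[R]_d) (mu : probability (Rd R d) R) :=
  forall (t : R) (A : set (Rd R d)), 0 <= t -> measurable A ->
    (P \x mu)%E [set p : Omega * Rd R d | X p.2 t p.1 \in A] = mu A.

(* Main.v *)
(* Sampled at the times [i h] and started from [mu], the solution is a stationary
   Markov chain with transition operator [Q].  Write [phi] for a continuous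
   approximation of the indicator of [B = B(x0, r)], with support in [B].

   Shifting the noise of the Euler scheme by [a] and applying the Cameron-Martin
   formula to its Gaussian increments shows, for [h] small, that [Q phi] is at
   most a constant times [r ^ d], and that [Q 1_B(z, r) x] is at least a constant
   times [r ^ d] for [x], [z] in a compact set.  The upper bound extends to every
   [h], and integrating the lower one against [mu] gives [Q phi <= C mu(B)].  The
   lower bound also makes the transition laws from different points of a compact
   set overlap, which forces the variance of [Q^N g] under [mu] to tend to 0
   uniformly over [0 <= g <= 1].

   Let [a m] be the expectation of the product of [1 - theta phi(X_ih)] over
   [i < m].  Waiting [p] steps before the visit at time [m] gives
   [a (m + 1) = a m (1 - theta mu(phi)) + O(p (C mu(B))^2 + e C mu(B))], where [e]
   is the mixing error, hence the generating function of the number of visits in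
   [tau / mu(B)] steps tends to [exp (- tau (1 - s))].  The pointwise convergence
   of the generating functions on [[0, 1]] gives that of the probabilities. *)

Require Import Defs.
From HB Require Import structures.
From mathcomp Require Import all_boot all_order all_algebra.
From mathcomp Require Import all_classical all_reals all_analysis.
From mathcomp Require Import measurable_realfun ring lra.
Set Implicit Arguments. Unset Strict Implicit. Unset Printing Implicit Defensive.
Import Order.TTheory GRing.Theory Num.Theory.
Import numFieldNormedType.Exports.
Local Open Scope classical_set_scope.
Local Open Scope ring_scope.

(** * Expectation of bounded measurable functions *)

(** The bounds on transition probabilities come from counting: the shift runs over a finite grid,
    and on each path the number of shifted endpoints in the ball is compared with the size of the
    grid. For this the endpoint must equal the shift up to a map of Lipschitz constant 1/2,
    uniformly in the mesh, hence the condition [K h exp (K h) <= 1/2]; a longer step is cut into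
    short ones.

    Both bounds are of the same order [r ^ d], and this is what the limit requires: over
    [tau / mu(B)] times, the error of each step has to be small relative to [mu(B)]. Two visits
    within [p] steps cost [p (C mu(B))^2]. Mixing has an error proportional to the size of the
    function, so it is applied to [Q phi <= C mu(B)] and not to [phi]. The lag [p] depends on the
    accuracy only and is fixed before [n] tends to infinity.

    Test functions are continuous because the solution is reached as a pathwise limit of Euler
    schemes, for which the Markov property is plain independence of increments. The estimates are
    uniform in the test function, so bounded convergence restores the indicator of the ball at the
    end. *)

Definition bmf {d} {T : measurableType d} {R : realType} (f : T -> R) :=
  measurable_fun setT f /\ exists c, forall x, `|f x| <= c.

Notation Ex P f := (Rintegral P setT f).

Lemma natSinv_lt {R : realType} (e : R) : 0 < e -> exists k : nat, k.+1%:R^-1 < e.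
Proof.
move=> e0; have [k _ /(_ k (leqnn k)) ke] := near_infty_natSinv_lt (PosNum e0).
by exists k.
Qed.

Section bmf_lemmas.
Context d (T : measurableType d) (R : realType).
Implicit Types f g : T -> R.

Lemma bmf_cst (c : R) : bmf (fun=> c : R) (T := T).
Proof. by split; [exact: measurable_cst|exists `|c|]. Qed.

Lemma bmfD f g : bmf f -> bmf g -> bmf (fun x => f x + g x).
Proof.
move=> [mf [a fa]] [mg [b gb]]; split; first exact: measurable_funD.
by exists (a + b) => x; rewrite (le_trans (ler_normD _ _))// lerD.
Qed.

Lemma bmfN f : bmf f -> bmf (fun x => - f x).
Proof.
move=> [mf [a fa]]; split; last by exists a => x; rewrite normrN.
exact: measurableT_comp.
Qed.

Lemma bmfB f g : bmf f -> bmf g -> bmf (fun x => f x - g x).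
Proof. by move=> hf hg; apply: bmfD => //; exact: bmfN. Qed.

Lemma bmfM f g : bmf f -> bmf g -> bmf (fun x => f x * g x).
Proof.
move=> [mf [a fa]] [mg [b gb]]; split; first exact: measurable_funM.
by exists (a * b) => x; rewrite normrM ler_pM.
Qed.

Lemma bmfX f n : bmf f -> bmf (fun x => f x ^+ n).
Proof.
move=> hf; elim: n => [|n IH]; first exact: bmf_cst.
rewrite [X in bmf X](_ : _ = fun x => f x * f x ^+ n); first exact: bmfM.
by apply/funext => x; rewrite exprS.
Qed.

Lemma bmf_norm f : bmf f -> bmf (fun x => `|f x|).
Proof.
move=> [mf [a fa]]; split; last by exists a => x; rewrite normr_id.
exact: measurableT_comp.
Qed.

Lemma bmf_prod (I : Type) (s : seq I) (F : I -> T -> R) :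
  (forall i, bmf (F i)) -> bmf (fun x => \prod_(i <- s) F i x).
Proof.
move=> hF; elim: s => [|i s IH].
  rewrite [X in bmf X](_ : _ = fun=> 1); first exact: bmf_cst.
  by apply/funext => x; rewrite big_nil.
rewrite [X in bmf X](_ : _ = fun x => F i x * \prod_(i <- s) F i x).
  exact: bmfM.
by apply/funext => x; rewrite big_cons.
Qed.

Lemma bmf_sum (I : Type) (s : seq I) (F : I -> T -> R) :
  (forall i, bmf (F i)) -> bmf (fun x => \sum_(i <- s) F i x).
Proof.
move=> hF; elim: s => [|i s IH].
  rewrite [X in bmf X](_ : _ = fun=> 0); first exact: bmf_cst.
  by apply/funext => x; rewrite big_nil.
rewrite [X in bmf X](_ : _ = fun x => F i x + \sum_(i <- s) F i x).
  exact: bmfD.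
by apply/funext => x; rewrite big_cons.
Qed.

Lemma bmf_indic (A : set T) : measurable A -> bmf (\1_A : T -> R).
Proof.
move=> mA; split; first exact: measurable_indic.
by exists 1 => x; rewrite indicE; case: (_ \in _) => /=; rewrite ?normr1// normr0.
Qed.

Lemma bmf_comp d' (T' : measurableType d') (g : T' -> T) f :
  measurable_fun setT g -> bmf f -> bmf (f \o g).
Proof.
move=> mg [mf [a fa]]; split; last by exists a => x /=.
exact: measurableT_comp.
Qed.

Variable P : probability T R.

Lemma bmf_integrable f : bmf f -> P.-integrable setT (EFin \o f).
Proof.
move=> [mf [a fa]]; apply: measurable_bounded_integrable => //.
  by rewrite (@le_lt_trans _ _ 1%E) ?probability_le1// ltry.
by exists a; split; [exact: num_real|move=> x ax y _ /=; apply: (le_trans (fa y)); exact: ltW].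
Qed.

Lemma ExD f g : bmf f -> bmf g -> Ex P (fun x => f x + g x) = Ex P f + Ex P g.
Proof. by move=> hf hg; apply: RintegralD => //; exact: bmf_integrable. Qed.

Lemma ExB f g : bmf f -> bmf g -> Ex P (fun x => f x - g x) = Ex P f - Ex P g.
Proof. by move=> hf hg; apply: RintegralB => //; exact: bmf_integrable. Qed.

Lemma ExZ f r : bmf f -> Ex P (fun x => r * f x) = r * Ex P f.
Proof. by move=> hf; apply: RintegralZl => //; exact: bmf_integrable. Qed.

Lemma Ex_cst r : Ex P (fun=> r) = r.
Proof. by rewrite Rintegral_cst//; have := @probability_setT _ _ _ P => /= ->; rewrite mulr1. Qed.

Lemma Ex_le f g : bmf f -> bmf g -> (forall x, f x <= g x) -> Ex P f <= Ex P g.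
Proof. by move=> hf hg fg; apply: le_Rintegral => //; exact: bmf_integrable. Qed.

Lemma Ex_ge0 f : (forall x, 0 <= f x) -> 0 <= Ex P f.
Proof. by move=> f0; exact: Rintegral_ge0. Qed.

Lemma Ex_le_cst f r : bmf f -> (forall x, f x <= r) -> Ex P f <= r.
Proof.
by move=> hf fr; rewrite -[leRHS]Ex_cst; apply: Ex_le => //; exact: bmf_cst.
Qed.

Lemma Ex_norm_le f : bmf f -> `|Ex P f| <= Ex P (fun x => `|f x|).
Proof. by move=> hf; apply: le_normr_Rintegral => //; exact: bmf_integrable. Qed.

Lemma Ex_sum (I : Type) (s : seq I) (F : I -> T -> R) : (forall i, bmf (F i)) ->
  Ex P (fun x => \sum_(i <- s) F i x) = \sum_(i <- s) Ex P (F i).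
Proof.
move=> hF; elim: s => [|i s IH].
  rewrite big_nil -[RHS]Ex_cst; congr Rintegral.
  by apply/funext => x; rewrite big_nil.
rewrite big_cons -IH -ExD//; last exact: bmf_sum.
by congr Rintegral; apply/funext => x; rewrite big_cons.
Qed.

Lemma Ex_indic (A : set T) : measurable A -> Ex P (\1_A) = fine (P A).
Proof.
move=> mA; rewrite /Rintegral; congr fine.
by rewrite integral_indic// setIT.
Qed.

Lemma EFin_Ex f : bmf f -> (Ex P f)%:E = (\int[P]_x (f x)%:E)%E.
Proof.
move=> hf; rewrite fineK//; apply: integrable_fin_num => //.
exact: bmf_integrable.
Qed.

(** The difference of the two sides is the variance of [f]. *)
Lemma Ex_sqr_le f : bmf f -> (Ex P f) ^+ 2 <= Ex P (fun x => f x ^+ 2).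
Proof.
move=> hf; set m := Ex P f.
have : 0 <= Ex P (fun x => (f x - m) ^+ 2) by apply: Ex_ge0 => x; exact: sqr_ge0.
rewrite [X in Rintegral _ _ X](_ : _ = fun x => f x ^+ 2 - (2 * m * f x - m ^+ 2)); last first.
  by apply/funext => x; ring.
have h1 : bmf (fun x => 2 * m * f x) by apply: bmfM => //; exact: bmf_cst.
rewrite ExB; [|exact: bmfX|by apply: bmfB => //; exact: bmf_cst].
rewrite ExB//; last exact: bmf_cst.
rewrite ExZ// Ex_cst -/m; lra.
Qed.

(** Bounded convergence. [bmf f] is part of the conclusion because [f] is often known only as a
    limit. *)
Lemma Ex_dct (F : nat -> T -> R) f (c : R) :
  (forall n, measurable_fun setT (F n)) -> (forall n x, `|F n x| <= c) ->
  (forall x, F ^~ x @ \oo --> f x) ->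
  bmf f /\ (fun n => Ex P (F n)) @ \oo --> Ex P f.
Proof.
move=> mF Fc Ff.
have mf : measurable_fun setT f.
  by apply: (measurable_fun_cvg (h := F)) => // x _; exact: Ff.
have fc x : `|f x| <= c.
  have h : (fun n => `|F n x|) @ \oo --> `|f x| by apply: cvg_norm; exact: Ff.
  rewrite -(cvg_lim _ h)//; apply: limr_le; first by apply/cvg_ex; exists `|f x|.
  by apply: nearW => n; exact: Fc.
have hf : bmf f by split=> //; exists c.
have hF n : bmf (F n) by split=> //; exists c; exact: Fc.
split => //.
have [|||||_ _] := @dominated_convergence _ _ _ P setT measurableT
  (fun n => EFin \o F n) (EFin \o f) (cst c%:E).
- by move=> n; exact/measurable_EFinP.
- exact/measurable_EFinP.
- by apply: aeW => x _; apply/cvg_EFin; [exact: nearW|exact: Ff].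
- exact: (bmf_integrable (bmf_cst c)).
- by apply: aeW => x n _ /=; rewrite lee_fin; exact: Fc.
move=> h.
have {}h : (fun n => (Ex P (F n))%:E) @ \oo --> (Ex P f)%:E.
  rewrite EFin_Ex//; apply: cvg_trans h.
  by under eq_fun do rewrite EFin_Ex//; exact: cvg_id.
by move/fine_cvg: h.
Qed.

End bmf_lemmas.

Section pushforward_Ex.
Context d d' (T : measurableType d) (T' : measurableType d') (R : realType).

Lemma Ex_pushforward (P : probability T R) (g : T -> T') (f : T' -> R)
    (m : {measure set T' -> \bar R}) :
  measurable_fun setT g -> measurable_fun setT f ->
  (forall A, measurable A -> m A = P (g @^-1` A)) -> bmf f ->
  Ex m f = Ex P (f \o g).
Proof.
move=> mg mf mE hf; rewrite /Rintegral; congr fine.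
rewrite (eq_measure_integral (pushforward P g)); last by move=> A mA _; rewrite mE.
rewrite integral_pushforward//; first exact/measurable_EFinP.
by apply: (bmf_integrable P); exact: bmf_comp.
Qed.

End pushforward_Ex.

Section fubini_Ex.
Context d1 d2 (T1 : measurableType d1) (T2 : measurableType d2) (R : realType).
Variables (P1 : probability T1 R) (P2 : probability T2 R).

Lemma bmf_section1 (f : T1 * T2 -> R) x : bmf f -> bmf (fun y => f (x, y)).
Proof.
by move=> hf; apply: (bmf_comp (g := pair x)) hf; exact: measurable_pair1.
Qed.

Lemma bmf_section2 (f : T1 * T2 -> R) y : bmf f -> bmf (fun x => f (x, y)).
Proof.
by move=> hf; apply: (bmf_comp (g := fun x => (x, y))) hf; exact: measurable_pair2.
Qed.

Lemma Ex_fubini1 (f : T1 * T2 -> R) : bmf f ->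
  Ex (P1 \x P2)%E f = Ex P1 (fun x => Ex P2 (fun y => f (x, y))).
Proof.
move=> hf; rewrite [RHS]/Rintegral.
rewrite [X in fine X](_ : _ = \int[P1 \x P2]_z (f z)%:E)%E//.
rewrite -integral12_prod_meas1; last exact: bmf_integrable.
by apply: eq_integral => x _; rewrite EFin_Ex//; exact: bmf_section1.
Qed.

Lemma Ex_fubini2 (f : T1 * T2 -> R) : bmf f ->
  Ex (P1 \x P2)%E f = Ex P2 (fun y => Ex P1 (fun x => f (x, y))).
Proof.
move=> hf; rewrite [RHS]/Rintegral.
rewrite [X in fine X](_ : _ = \int[P1 \x P2]_z (f z)%:E)%E//.
rewrite -integral21_prod_meas1; last exact: bmf_integrable.
by apply: eq_integral => x _; rewrite EFin_Ex//; exact: bmf_section2.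
Qed.

End fubini_Ex.

(** * The Borel sigma-algebra of matrices *)

(** For [n = 1] this is [Rd R d] by conversion, so the same lemmas serve for states and for matrices
    of noise increments. *)
Definition Mx (R : realType) (n d : nat) : Type :=
  g_sigma_algebraType (@open 'M[R]_(n, d)).

Section mx_norm.
Context {R : realType} {m n : nat}.
Implicit Types x : 'M[R]_(m, n).

Lemma mx_norm_le x c : 0 <= c -> (forall i j, `|x i j| <= c) -> `|x| <= c.
Proof. by move=> c0 xc; rewrite [`|x|]mx_normrE; apply/bigmax_leP; split. Qed.

Lemma coord_le_norm x i j : `|x i j| <= `|x|.
Proof.
by rewrite [`|x|]mx_normrE (le_trans _ (le_bigmax _ _ (i, j))).
Qed.

End mx_norm.

Section borel_mx.
Context {R : realType} {n d : nat}.

Lemma open_measurable_mx (U : set 'M[R]_(n, d)) : open U -> measurable (U : set (Mx R n d)).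
Proof. by move=> oU; apply: sub_sigma_algebra. Qed.

Lemma continuous_measurable_mx (f : 'M[R]_(n, d) -> R) :
  continuous f -> measurable_fun setT (f : Mx R n d -> R).
Proof.
move=> cf; apply: (measurability _ (RGenOInfty.measurableE R)) => //.
move=> /= _ [_ [x ->] <-]; rewrite setTI; apply: open_measurable_mx.
by apply: open_comp; [move=> ? _; exact: cf|exact: interval_open].
Qed.

Let box (q : 'M[rat]_(n, d)) (k : nat) : set 'M[R]_(n, d) :=
  [set M | forall i j, `|M i j - ratr (q i j)| < k.+1%:R^-1].

(** Rational boxes are countably many, so this union is countable; this is why a map with measurable
    coordinates is Borel measurable. *)
Let open_box_cover (U : set 'M[R]_(n, d)) : open U ->
  U = \bigcup_q \bigcup_(k in [set k | box q k `<=` U]) box q k.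
Proof.
move=> oU; apply/seteqP; split=> [M UM|M [q _ [k /= + ?]]]; last exact.
have /nbhs_ballP[e /= e0 eU] : nbhs M U by exact: open_nbhs_nbhs.
(* Two points of one box are within [2 / (k + 1) < e] of each other. *)
have [k ke] := natSinv_lt (divr_gt0 e0 (@ltr0Sn R 1)).
have k0 : 0 < k.+1%:R^-1 :> R by rewrite invr_gt0.
have /choice[q0 hq] (ij : 'I_n * 'I_d) : exists q : rat, `|M ij.1 ij.2 - ratr q| < k.+1%:R^-1.
  have [|q] := @rat_in_itvoo R (M ij.1 ij.2 - k.+1%:R^-1) (M ij.1 ij.2 + k.+1%:R^-1).
    by rewrite ltrBlDr -addrA ltrDl addr_gt0.
  by rewrite in_itv /= => /andP[h1 h2]; exists q; rewrite ltr_distlC h1.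
exists (\matrix_(i, j) q0 (i, j)) => //; exists k; last first.
  by move=> i j; rewrite mxE; exact: (hq (i, j)).
move=> N hN; apply: eU; split => // i j.
have := hN i j; have := hq (i, j); rewrite mxE /= => h1 h2.
rewrite /ball /= (le_lt_trans (ler_distD (ratr (q0 (i, j))) _ _))//.
rewrite [ltRHS](splitr e) ltrD//; first exact: lt_trans h1 _.
by rewrite distrC; exact: lt_trans h2 _.
Qed.

Lemma measurable_mx d' (T : measurableType d') (f : T -> Mx R n d) :
  (forall i j, measurable_fun setT (fun t => (f t : 'M[R]_(n, d)) i j)) ->
  measurable_fun setT f.
Proof.
move=> mf; apply: (@measurability _ _ T (Mx R n d) _ _ open) => //.
move=> _ [U oU <-]; rewrite setTI (open_box_cover oU) preimage_bigcup.
apply: countable_bigcupT_measurable => [|q]; [exact: countableP|]; rewrite preimage_bigcup.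
apply: bigcup_measurable => k _.
rewrite (_ : _ @^-1` _ = \bigcap_(ij in [set: 'I_n * 'I_d])
   [set t | `|(f t : 'M[R]_(n, d)) ij.1 ij.2 - ratr (q ij.1 ij.2)| < k.+1%:R^-1]); last first.
  apply/seteqP; split => [t h [i j] _ /=|t h i j]; first exact: h.
  exact: (h (i, j)).
apply: fin_bigcap_measurable => // -[i j] _ /=.
rewrite -[X in measurable X]setTI.
apply: (measurable_fun_ltr (f := fun t => `|f t i j - ratr (q i j)|)) => //.
apply: measurableT_comp => //; apply: measurable_funB => //.
Qed.

Lemma measurable_coord i j :
  measurable_fun setT (fun M : Mx R n d => (M : 'M[R]_(n, d)) i j).
Proof. by apply: continuous_measurable_mx; exact: coord_continuous. Qed.

Lemma measurable_mxP d' (T : measurableType d') (f : T -> Mx R n d) :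
  measurable_fun setT f <->
  (forall i j, measurable_fun setT (fun t => (f t : 'M[R]_(n, d)) i j)).
Proof.
split; last exact: measurable_mx.
by move=> mf i j; apply: (measurableT_comp (measurable_coord i j)).
Qed.

Definition mxbox (A : 'I_n -> 'I_d -> set R) : set (Mx R n d) :=
  [set M | forall i j, A i j ((M : 'M[R]_(n, d)) i j)].

Lemma measurable_mxbox A : (forall i j, measurable (A i j)) -> measurable (mxbox A).
Proof.
move=> mA; rewrite (_ : mxbox A = \bigcap_(ij in [set: 'I_n * 'I_d])
  ((fun M : Mx R n d => (M : 'M[R]_(n, d)) ij.1 ij.2) @^-1` A ij.1 ij.2)).
  apply: fin_bigcap_measurable => // -[i j] _ /=; rewrite -[X in measurable X]setTI.
  exact: measurable_coord.
apply/seteqP; split => [t h [i j] _ /=|t h i j]; first exact: h.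
exact: (h (i, j)).
Qed.

(** Boxes are stable under intersection and generate the Borel sets. *)
Lemma mx_measure_unique (m1 m2 : {measure set (Mx R n d) -> \bar R}) :
  (m1 setT < +oo)%E ->
  (forall A, (forall i j, measurable (A i j)) -> m1 (mxbox A) = m2 (mxbox A)) ->
  forall A, measurable A -> m1 A = m2 A.
Proof.
move=> m1oo m12.
pose G : set (set (Mx R n d)) := [set mxbox A | A in [set A | forall i j, measurable (A i j)]].
have GT : G setT by exists (fun _ _ => setT) => //; apply/seteqP; split.
apply: (measure_unique G (fun=> setT)) => //.
- apply/seteqP; split; last first.
    apply: smallest_sub; first exact: sigma_algebra_measurable.
    by move=> _ [A mA <-]; exact: measurable_mxbox.
  (* The Borel sets lie in the sigma-algebra generated by the boxes: the identity is measurable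
     because each of its coordinates is. *)
  have mid : @measurable_fun _ _ (g_sigma_algebraType G) (Mx R n d) setT id.
    apply: measurable_mx => i j _ B mB; apply: sub_sigma_algebra.
    exists (fun i' j' => if (i' == i) && (j' == j) then B else setT).
      by move=> i' j' /=; case: ifP.
    rewrite setTI; apply/seteqP; split=> [M|M BM i' j'] /=.
      by move=> /(_ i j); rewrite !eqxx.
    by case: ifP => // /andP[/eqP -> /eqP ->].
  by move=> A mA; have := mid measurableT A mA; rewrite setTI.
- move=> _ _ [A mA <-] [B mB <-]; exists (fun i j => A i j `&` B i j).
    by move=> i j; exact: measurableI.
  apply/seteqP; split=> [M h|M [h1 h2]]; last by move=> i j; split.
  by split=> i j; have [] := h i j.
- by rewrite bigcup_const.
- by move=> _ [A mA <-]; exact: m12.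
Qed.

End borel_mx.

(** * The Cameron-Martin formula for Gaussian matrices *)

Section density.
Local Open Scope ereal_scope.
Context d (T : measurableType d) (R : realType).
Variables (mu nu : {measure set T -> \bar R}) (p : T -> R).
Hypotheses (mp : measurable_fun setT p) (p0 : forall x, (0 <= p x)%R).
Hypothesis nuE : forall A, measurable A -> nu A = \int[mu]_(x in A) (p x)%:E.

Import HBNNSimple.

Let integral_density_nnsfun (g : {nnsfun T >-> R}) :
  \int[nu]_x (g x)%:E = \int[mu]_x ((g x)%:E * (p x)%:E).
Proof.
under [LHS]eq_integral do rewrite fimfunE -fsumEFin//.
rewrite [LHS]ge0_integral_fsum//; last 2 first.
  - by move=> r; exact/measurable_EFinP/measurableT_comp.
  - by move=> n x _; rewrite EFinM nnfun_muleindic_ge0.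
under [RHS]eq_integral.
  move=> x xD; rewrite fimfunE -fsumEFin// ge0_mule_fsuml; last first.
    by move=> r; rewrite EFinM nnfun_muleindic_ge0.
  over.
rewrite [RHS]ge0_integral_fsum//; last 2 first.
  - move=> r; apply: emeasurable_funM; last exact/measurable_EFinP.
    by apply/measurable_EFinP; apply: measurable_funM => //.
  - by move=> n x _; apply: mule_ge0; [rewrite EFinM nnfun_muleindic_ge0|rewrite lee_fin].
apply: eq_fsbigr => r _.
rewrite integralZl_indic_nnsfun//= integral_indic// setIT nuE//.
have [r0|r0] := ltP r 0%R.
  rewrite preimage_nnfun0// integral_set0 mule0 integral0_eq// => x _.
  by rewrite indicE in_set0 mulr0 mul0e.
under [RHS]eq_integral do rewrite EFinM -muleA.
rewrite ge0_integralZl//.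
- congr (_ * _); rewrite integral_mkcond; apply: eq_integral => x _.
  by rewrite patchE indicE; case: ifPn => _; rewrite ?mul1e ?mul0e.
- by apply: emeasurable_funM; apply/measurable_EFinP.
- by move=> x _; rewrite mule_ge0 ?lee_fin.
Qed.

(** The measure [nu] is abstract, so that the lemma covers the normal law, a restricted measure and
    [mdens]. Simple functions are followed by monotone convergence. *)
Lemma ge0_integral_density (f : T -> \bar R) :
  measurable_fun setT f -> (forall x, 0 <= f x) ->
  \int[nu]_x f x = \int[mu]_x (f x * (p x)%:E).
Proof.
move=> mf f0; pose f_ := nnsfun_approx measurableT mf.
have f_f x : (f_ n x)%:E @[n --> \oo] --> f x by apply: cvg_nnsfun_approx.
have ndf m n x : (m <= n)%N -> (f_ m x <= f_ n x)%R.
  by move=> mn; exact/lefP/nd_nnsfun_approx.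
transitivity (lim (\int[nu]_x (f_ n x)%:E @[n --> \oo])).
  rewrite -monotone_convergence//=.
  - by apply: eq_integral => x _; apply/esym/cvg_lim => //=; exact: f_f.
  - by move=> n; exact/measurable_EFinP/measurable_funTS.
  - by move=> n ? _; rewrite lee_fin.
  - by move=> ? _ ? ? mn; rewrite lee_fin; exact: ndf.
under eq_fun do rewrite integral_density_nnsfun.
rewrite -monotone_convergence//=.
- apply: eq_integral => x _; apply/cvg_lim => //=.
  by apply: cvgeZr => //; exact: f_f.
- move=> n; apply: emeasurable_funM; last exact/measurable_EFinP.
  exact/measurable_EFinP/measurable_funTS.
- by move=> n x _; rewrite mule_ge0 ?lee_fin.
- by move=> x _ m n mn; rewrite lee_wpmul2r ?lee_fin//; exact: ndf.
Qed.

End density.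

(** By uniqueness of the measure that gives each interval []a, b]] its length. *)
Lemma lebesgue_measure_shift {R : realType} (s : R) (A : set R) : measurable A ->
  lebesgue_measure ((fun x : R => x + s) @^-1` A) = lebesgue_measure A.
Proof.
move=> mA; pose f : measurableTypeR R -> measurableTypeR R := fun x => x + s.
have mf : measurable_fun setT f by apply: measurable_funD => //; exact: measurable_id.
have <- : pushforward lebesgue_measure f A = lebesgue_measure ((fun x : R => x + s) @^-1` A) by [].
pose mfP := isMeasurableFun.Build _ _ _ _ f mf.
pose F : {mfun _ >-> _} := HB.pack f mfP.
apply/esym.
apply: (@lebesgue_measure_unique _ (pushforward lebesgue_measure F)) => //= _ [[a b]] _ <-.
rewrite /pushforward/= (_ : _ @^-1` _ = `](a - s)%R, (b - s)%R]%classic).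
  rewrite !lebesgue_measure_itv/= !lte_fin ltrD2r; case: ifP => // _.
  by rewrite -!EFinD; congr EFin; ring.
by apply/seteqP; split => x /=; rewrite !in_itv /= ltrBlDr lerBrDr.
Qed.

Section mdens.
Local Open Scope ereal_scope.
Context d (T : measurableType d) (R : realType).
Variables (mu : {measure set T -> \bar R}) (p : T -> R).
Hypotheses (mp : measurable_fun setT p) (p0 : forall x, (0 <= p x)%R).

(** The proofs about [p] are arguments, so that the measure structure can be attached to the term
    itself. *)
Definition mdens & measurable_fun setT p & (forall x, (0 <= p x)%R) :=
  fun A : set T => \int[mu]_(x in A) (p x)%:E.

Let m := mdens mp p0.

Let mdens0 : m set0 = 0. Proof. exact: integral_set0. Qed.

Let mdens_ge0 A : 0 <= m A.
Proof. by apply: integral_ge0 => x _; rewrite lee_fin. Qed.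

Let mdens_sigma_additive : semi_sigma_additive m.
Proof.
move=> F mF tF mUF; rewrite /m /mdens ge0_integral_bigcup//.
- by apply: is_cvg_ereal_nneg_natsum_cond => n _ _; exact: mdens_ge0.
- by apply/measurable_EFinP; exact: measurable_funTS.
- by move=> x _; rewrite lee_fin.
Qed.

HB.instance Definition _ := isMeasure.Build _ _ _ m mdens0 mdens_ge0 mdens_sigma_additive.

End mdens.

Section gauss_tilt.
Context {R : realType} (sigma : R).

(** Density of the normal law of mean [s] and variance [sigma ^ 2] with respect to the centered
    one. *)
Definition gtilt (s y : R) : R := expR (s * y / sigma ^+ 2 - s ^+ 2 / (2 * sigma ^+ 2)).

Lemma gtilt_ge0 s y : 0 <= gtilt s y. Proof. exact: expR_ge0. Qed.

Lemma measurable_gtilt s : measurable_fun setT (gtilt s).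
Proof.
apply: measurableT_comp => //; apply: measurable_funB => //.
by do 2 apply: measurable_funM => //.
Qed.

Hypothesis sigma0 : sigma != 0.

Lemma normal_pdf_shift s y :
  normal_pdf 0 sigma (y - s) = normal_pdf 0 sigma y * gtilt s y.
Proof.
rewrite !normal_pdfE// -mulrA; congr (_ * _).
rewrite /normal_fun /gtilt -expRD; congr expR.
by field; rewrite sigma0.
Qed.

(** One-dimensional Cameron-Martin formula: the translation moves from the set to the density. *)
Lemma normal_prob_shift s (A : set R) : measurable A ->
  normal_prob 0 sigma ((fun y => y + s) @^-1` A) =
  (\int[normal_prob 0 sigma]_(y in A) (gtilt s y)%:E)%E.
Proof.
move=> mA; have mpdf := @measurable_normal_pdf R 0 sigma.
have mtilt := measurable_gtilt s.
pose f : measurableTypeR R -> measurableTypeR R := fun x => x + s.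
have mf : measurable_fun setT f by apply: measurable_funD => //; exact: measurable_id.
transitivity (\int[lebesgue_measure]_(y in A) (normal_pdf 0 sigma (y - s))%:E)%E.
  rewrite (eq_measure_integral (pushforward lebesgue_measure f)); last first.
    by move=> B mB _; apply/esym; exact: lebesgue_measure_shift.
  rewrite (ge0_integral_pushforward mf lebesgue_measure mA).
  - by rewrite /normal_prob; apply: eq_integral => y _ /=; rewrite /f addrK.
  - apply: measurable_funTS; apply/measurable_EFinP.
    by apply: (measurableT_comp mpdf); apply: measurable_funB.
  - by move=> y _; rewrite lee_fin normal_pdf_ge0.
rewrite [RHS]integral_mkcond.
rewrite (ge0_integral_density (mu := lebesgue_measure) (p := normal_pdf 0 sigma))//.
- rewrite [LHS]integral_mkcond; apply: eq_integral => y _; rewrite !patchE.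
  case: ifPn => yA; last by rewrite mul0e.
  by rewrite normal_pdf_shift -EFinM mulrC.
- exact: normal_pdf_ge0.
- apply/(measurable_restrictT _ mA).
  by apply: measurable_funTS; exact/measurable_EFinP.
- by move=> y; rewrite patchE; case: ifPn => // _; rewrite lee_fin gtilt_ge0.
Qed.

End gauss_tilt.

Section indep_integral.
Local Open Scope ereal_scope.
Context d (T : measurableType d) (R : realType) (P : probability T R).

(** The event [E] is independent of [V], so under [P] restricted to [E] the law of [V] is [P E]
    times its law under [P]. *)
Lemma integral_indep_event (V : T -> R) (E : set T) (h : R -> \bar R) :
  measurable E -> measurable_fun setT V -> measurable_fun setT h ->
  (forall y, 0 <= h y) ->
  (forall B, measurable B -> P (E `&` V @^-1` B) = P E * P (V @^-1` B)) ->
  \int[P]_(w in E) h (V w) = P E * \int[P]_w h (V w).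
Proof.
move=> mE mV mh h0 PEV.
have PE0 : (0 <= fine (P E))%R by rewrite fine_ge0.
have PEE : P E = (NngNum PE0)%:num%:E by rewrite /= fineK// fin_num_measure.
have mhV : measurable_fun setT (h \o V) by exact: measurableT_comp.
transitivity (\int[mrestr P mE]_w (h \o V) w).
  rewrite (ge0_integral_density (mu := P) (p := \1_E))//.
  - rewrite [LHS]integral_mkcond; apply: eq_integral => w _.
    by rewrite patchE indicE; case: ifPn => _; rewrite ?mule1 ?mule0.
  - by move=> A mA; rewrite integral_indic//= /mrestr setIC.
  - by move=> w; exact: h0.
rewrite -[LHS](ge0_integral_pushforward mV _ measurableT mh (fun y _ => h0 y)).
rewrite (eq_measure_integral (mscale (NngNum PE0) (pushforward P V))); last first.
  by move=> B mB _; rewrite /= /mscale /pushforward /mrestr setIC PEV//; congr (_ * _)%E; exact: PEE.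
rewrite ge0_integral_mscale//= ge0_integral_pushforward//.
by rewrite fineK// fin_num_measure.
Qed.

End indep_integral.

Section cameron_martin.
Context d0 (T : measurableType d0) (R : realType) (P : probability T R).
Context (n d : nat) (sigma : R) (D : T -> Mx R n d).
Hypothesis sigma0 : sigma != 0.
Hypothesis mD : measurable_fun setT D.
Hypothesis Dlaw : forall A : 'I_n -> 'I_d -> set R, (forall i j, measurable (A i j)) ->
  P (D @^-1` mxbox A) = (\prod_(ij : 'I_n * 'I_d) normal_prob 0 sigma (A ij.1 ij.2))%E.

Let Dmx (w : T) : 'M[R]_(n, d) := D w.

Let mDij i j : measurable_fun setT (fun w => Dmx w i j).
Proof. by move/measurable_mxP : mD => h; exact: h. Qed.

Let updbox (A : 'I_n -> 'I_d -> set R) i0 j0 B :=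
  fun i j => if (i, j) == (i0, j0) then B else A i j.

Let updboxE A i0 j0 B : measurable B -> (forall i j, measurable (A i j)) ->
  P (D @^-1` mxbox (updbox A i0 j0 B)) =
  (normal_prob 0 sigma B *
   \prod_(ij : 'I_n * 'I_d | ij != (i0, j0)) normal_prob 0 sigma (A ij.1 ij.2))%E.
Proof.
move=> mB mA; rewrite Dlaw; last by move=> i j; rewrite /updbox; case: ifP.
rewrite (bigD1 (i0, j0))//= /updbox eqxx; congr (_ * _)%E.
by apply: eq_bigr => -[i j] /negbTE /= ->.
Qed.

Lemma law_coord i0 j0 (B : set R) : measurable B ->
  P ((fun w => (D w : 'M[R]_(n, d)) i0 j0) @^-1` B) = normal_prob 0 sigma B.
Proof.
move=> mB; have := @updboxE (fun _ _ => setT) i0 j0 B mB (fun _ _ => measurableT).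
rewrite big1 ?mule1; last by move=> ij _; exact: (@probability_setT _ _ _ (normal_prob 0 sigma)).
move=> <-; congr (P _); apply/seteqP; split=> w /=.
  by move=> h i j; rewrite /updbox; case: eqP => // -[-> ->].
by move=> /(_ i0 j0); rewrite /updbox eqxx.
Qed.

(** Both sides integrate [F] against a measure on matrices, and these measures are compared on
    boxes. There the constraint on the entry [(i0, j0)] is independent of the others, and the
    one-dimensional formula applies to it. *)
Let cm1 i0 j0 s (F : Mx R n d -> \bar R) :
  measurable_fun setT F -> (forall M, 0 <= F M)%E ->
  (\int[P]_w F (Dmx w + s *: delta_mx i0 j0)%R =
   \int[P]_w (F (D w) * (gtilt sigma s (Dmx w i0 j0))%:E))%E.
Proof.
move=> mF F0; pose q w := gtilt sigma s (Dmx w i0 j0).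
have mq : measurable_fun setT q by apply: (measurableT_comp (measurable_gtilt sigma s)).
have q0 w : 0 <= q w by exact: gtilt_ge0.
have mDs : measurable_fun setT (fun w => (Dmx w + s *: delta_mx i0 j0 : Mx R n d)).
  apply: measurable_mx => i j.
  rewrite [X in measurable_fun _ X](_ : _ = fun w => Dmx w i j + s * (delta_mx i0 j0 : 'M[R]_(n, d)) i j).
    by apply: measurable_funD.
  by apply/funext => w; rewrite 3!mxE.
rewrite -(ge0_integral_density (nu := mdens P mq q0))//; last exact: measurableT_comp.
rewrite -[LHS](ge0_integral_pushforward mDs _ measurableT mF (fun y _ => F0 y)).
rewrite -[RHS](ge0_integral_pushforward mD _ measurableT mF (fun y _ => F0 y)).
apply: eq_measure_integral => A mA _; apply: mx_measure_unique => //.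
  by apply: (@le_lt_trans _ _ (P setT)); [exact: lexx|rewrite probability_setT ltry].
move=> {mA}{}A mA; rewrite /pushforward /= /mdens.
set S := ((fun y => y + s) @^-1` A i0 j0).
have mS : measurable S.
  rewrite -[X in measurable X]setTI; apply: (measurable_funD _ _) => //; exact: measurable_id.
transitivity (P (D @^-1` mxbox (updbox A i0 j0 S))).
  congr (P _); apply/seteqP; split=> w /= h i j; have := h i j;
    rewrite /updbox !mxE -xpair_eqE;
    by case: eqP => [[-> ->]|_]; rewrite ?mulr1 ?mulr0 ?addr0.
rewrite updboxE// /S normal_prob_shift//.
(* The constraints on all the other entries. *)
set E := D @^-1` mxbox (updbox A i0 j0 setT).
have mE : measurable E.
  rewrite /E -[X in measurable X]setTI; apply: mD => //.
  by apply: measurable_mxbox => i j; rewrite /updbox; case: ifP.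
have EA B : E `&` (fun w => Dmx w i0 j0) @^-1` B = D @^-1` mxbox (updbox A i0 j0 B).
  apply/seteqP; split=> w /=.
    by move=> [h hB] i j; rewrite /updbox; case: eqP => [[-> ->]//|/eqP/negbTE hij]; have := h i j; rewrite /updbox hij.
  move=> h; split; last by have := h i0 j0; rewrite /updbox eqxx.
  by move=> i j; have := h i j; rewrite /updbox; case: eqP.
have updA : updbox A i0 j0 (A i0 j0) = A.
  by apply/funext => i; apply/funext => j; rewrite /updbox; case: eqP => // -[-> ->].
rewrite [RHS]/pushforward.
have -> : D @^-1` mxbox A = E `&` (fun w => Dmx w i0 j0) @^-1` A i0 j0 by rewrite EA updA.
pose hh y := ((gtilt sigma s y)%:E * (\1_(A i0 j0) y)%:E)%E.
have mhh : measurable_fun setT hh.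
  apply: emeasurable_funM; apply/measurable_EFinP; first exact: measurable_gtilt.
  exact: measurable_indic.
have hh0 y : (0 <= hh y)%E by rewrite mule_ge0// lee_fin ?gtilt_ge0.
rewrite [RHS](_ : _ = (\int[P]_(w in E) hh (Dmx w i0 j0))%E); last first.
  rewrite integral_mkcondr; apply: eq_integral => w _; rewrite patchE /hh indicE.
  rewrite (_ : (w \in _) = (Dmx w i0 j0 \in A i0 j0))//.
  by case: ifPn => _; rewrite ?mule1 ?mule0.
rewrite integral_indep_event//; last first.
  move=> B mB; rewrite EA law_coord// updboxE// /E updboxE//.
  by rewrite (@probability_setT _ _ _ (normal_prob 0 sigma)) mul1e muleC.
rewrite /E updboxE// (@probability_setT _ _ _ (normal_prob 0 sigma)) mul1e muleC.
congr (_ * _)%E.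
pose V : T -> measurableTypeR R := fun w => Dmx w i0 j0.
have mV : measurable_fun setT V := mDij i0 j0.
rewrite -[RHS](@ge0_integral_pushforward _ _ _ _ _ V mV P setT hh measurableT mhh (fun y _ => hh0 y)).
transitivity (\int[normal_prob 0 sigma]_y hh y)%E; last first.
  by apply: eq_measure_integral => B mB _; apply/esym; exact: law_coord.
rewrite [LHS]integral_mkcond; apply: eq_integral => y _; rewrite patchE /hh indicE.
by case: ifPn => _; rewrite ?mule1 ?mule0.
Qed.

(** One entry is shifted at a time. As [L] has no repetition, the other shifts leave the entry [l]
    unchanged, so its weight is evaluated at the original noise. *)
Let cmL (S : 'M[R]_(n, d)) (L : seq ('I_n * 'I_d)) (F : Mx R n d -> \bar R) : uniq L ->
  measurable_fun setT F -> (forall M, 0 <= F M)%E ->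
  (\int[P]_w F (Dmx w + \sum_(l <- L) S l.1 l.2 *: delta_mx l.1 l.2)%R =
   \int[P]_w (F (D w) * (\prod_(l <- L) gtilt sigma (S l.1 l.2) (Dmx w l.1 l.2))%:E))%E.
Proof.
elim: L F => [|l L IH] F /=.
  move=> _ mF F0; apply: eq_integral => w _.
  by rewrite !big_nil addr0 mule1.
move=> /andP[lL uL] mF F0.
set SL := \sum_(l <- L) S l.1 l.2 *: (delta_mx l.1 l.2 : 'M[R]_(n, d)).
pose F1 (M : Mx R n d) := F ((M : 'M[R]_(n, d)) + SL).
have mshift : measurable_fun setT (fun M : Mx R n d => ((M : 'M[R]_(n, d)) + SL : Mx R n d)).
  apply: measurable_mx => i j.
  rewrite [X in measurable_fun _ X](_ : _ = fun M : Mx R n d => (M : 'M[R]_(n, d)) i j + SL i j).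
    by apply: measurable_funD => //; exact: measurable_coord.
  by apply/funext => M; rewrite mxE.
have mF1 : measurable_fun setT F1 by apply: (measurableT_comp mF).
pose F2 (M : Mx R n d) := (F M * (gtilt sigma (S l.1 l.2) ((M : 'M[R]_(n, d)) l.1 l.2))%:E)%E.
have mF2 : measurable_fun setT F2.
  apply: emeasurable_funM => //; apply/measurable_EFinP.
  by apply: (measurableT_comp (measurable_gtilt _ _)); exact: measurable_coord.
have F20 M : (0 <= F2 M)%E by rewrite mule_ge0// lee_fin gtilt_ge0.
transitivity (\int[P]_w F1 (Dmx w + S l.1 l.2 *: delta_mx l.1 l.2)%R)%E.
  by apply: eq_integral => w _; rewrite big_cons addrA.
rewrite cm1//; last by move=> M; exact: F0.
transitivity (\int[P]_w F2 (Dmx w + SL)%R)%E.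
  apply: eq_integral => w _; rewrite /F1 /F2 [in RHS]mxE.
  rewrite (_ : SL l.1 l.2 = 0) ?addr0// /SL summxE big_seq big1// => k kL.
  rewrite !mxE; case: eqP => /= [e1|]; last by rewrite mulr0.
  case: eqP => /= [e2|]; last by rewrite mulr0.
  by move: lL; rewrite (surjective_pairing l) e1 e2 -surjective_pairing kL.
rewrite IH//; apply: eq_integral => w _.
by rewrite /F2 big_cons EFinM muleA.
Qed.

Lemma cameron_martin (S : 'M[R]_(n, d)) (F : Mx R n d -> \bar R) :
  measurable_fun setT F -> (forall M, 0 <= F M)%E ->
  (\int[P]_w F ((D w : 'M[R]_(n, d)) + S)%R =
   \int[P]_w (F (D w) *
     (\prod_(l : 'I_n * 'I_d) gtilt sigma (S l.1 l.2) ((D w : 'M[R]_(n, d)) l.1 l.2))%:E))%E.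
Proof.
move=> mF F0; rewrite -(cmL _ (index_enum_uniq _))//.
by apply: eq_integral => w _; rewrite {1}(matrix_sum_delta S) pair_bigA.
Qed.

End cameron_martin.

Section law_Ex.
Context d1 d2 (T1 : measurableType d1) (T2 : measurableType d2) (R : realType).
Variables (P1 : probability T1 R) (P2 : probability T2 R) (n d : nat).
Variables (g1 : T1 -> Mx R n d) (g2 : T2 -> Mx R n d).

Lemma Ex_eq_law (F : Mx R n d -> R) :
  measurable_fun setT g1 -> measurable_fun setT g2 ->
  (forall A, (forall i j, measurable (A i j)) ->
    P1 (g1 @^-1` mxbox A) = P2 (g2 @^-1` mxbox A)) ->
  bmf F -> Ex P1 (F \o g1) = Ex P2 (F \o g2).
Proof.
move=> mg1 mg2 h bF; have mF : measurable_fun setT F by case: bF.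
rewrite -(@Ex_pushforward _ _ _ _ _ P1 g1 F (pushforward P1 g1))//.
rewrite -(@Ex_pushforward _ _ _ _ _ P2 g2 F (pushforward P1 g1))//.
move=> A mA; apply: (@mx_measure_unique _ _ _ (pushforward P1 g1) (pushforward P2 g2)) => //.
by apply: (@le_lt_trans _ _ (P1 setT)); [exact: lexx|rewrite probability_setT ltry].
Qed.

End law_Ex.

(** * Increments of Brownian motion on a regular time grid *)

Section increments.
Context {dO : measure_display} {Omega : measurableType dO} {R : realType} {d : nat}.
Variables (P : probability Omega R) (W : R -> Omega -> 'rV[R]_d).
Hypothesis BW : std_brownian P W.

Definition bminc (delta : R) (n : nat) (w : Omega) : Mx R n d :=
  \matrix_(i < n, j < d) (W (i.+1%:R * delta) w ord0 j - W (i%:R * delta) w ord0 j).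

Lemma measurable_bminc delta n : measurable_fun setT (bminc delta n).
Proof.
have [_ _ mW _] := BW; apply: measurable_mx => i j.
rewrite [X in measurable_fun _ X](_ : _ = fun w =>
  W (i.+1%:R * delta) w ord0 j - W (i%:R * delta) w ord0 j).
  exact: measurable_funB.
by apply/funext => w; rewrite mxE.
Qed.

Lemma bminc_law delta n (A : 'I_n -> 'I_d -> set R) : 0 < delta ->
  (forall i j, measurable (A i j)) ->
  P (bminc delta n @^-1` mxbox A) =
  (\prod_(ij : 'I_n * 'I_d) normal_prob 0 (Num.sqrt delta) (A ij.1 ij.2))%E.
Proof.
move=> delta0 mA; have [_ _ _] := BW.
move=> /(_ n (fun i => i%:R * delta)); rewrite mul0r lexx => /(_ isT) [].
  by move=> i _; rewrite ltr_pM2r// ltr_nat.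
move=> /(_ (fun ij => A ij.1 ij.2)) => h1 h2.
rewrite [LHS](_ : _ = P (\bigcap_(ij in [set: 'I_n * 'I_d])
   ((fun w => W (ij.1.+1%:R * delta) w ord0 ij.2 - W (ij.1%:R * delta) w ord0 ij.2)
       @^-1` A ij.1 ij.2))); last first.
  congr (P _); apply/seteqP; split=> w h.
    by move=> [i j] _ /=; have := h i j; rewrite mxE.
  by move=> i j; have := h (i, j) Logic.I; rewrite mxE.
have {}h1 := h1 (fun ij => mA ij.1 ij.2).
etransitivity; first exact: h1.
apply: eq_bigr => ij _.
have {}h2 := h2 ij _ (mA ij.1 ij.2).
etransitivity; first exact: h2.
have step_size : (nat_of_ord ij.1).+1%:R * delta - (nat_of_ord ij.1)%:R * delta = delta.
  by rewrite -mulrBl -natrB// subSnn mul1r.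
by apply: (congr1 (fun z => normal_prob 0 (Num.sqrt z) (A ij.1 ij.2))).
Qed.

(** Increments over disjoint periods are independent and stationary, so those of the last [n2] steps
    can be read on an independent copy of the noise, restarted at time 0. This is the source of the
    Markov property. *)
Lemma Ex_freeze delta n1 n2 (F : Mx R (n1 + n2) d -> R) : 0 < delta -> bmf F ->
  Ex P (F \o bminc delta (n1 + n2)) =
  Ex (P \x P)%E (fun p : Omega * Omega =>
    F (col_mx (bminc delta n1 p.1 : 'M[R]_(n1, d)) (bminc delta n2 p.2 : 'M[R]_(n2, d)))).
Proof.
move=> delta0 bF.
pose g2 (p : Omega * Omega) : Mx R (n1 + n2) d :=
  col_mx (bminc delta n1 p.1 : 'M[R]_(n1, d)) (bminc delta n2 p.2 : 'M[R]_(n2, d)).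
rewrite (@Ex_eq_law _ _ _ _ _ P (P \x P)%E _ _ _ g2)//.
- exact: measurable_bminc.
- apply: measurable_mx => i j; case: (split_ordP i) => k ->.
    rewrite [X in measurable_fun _ X](_ : _ = fun p => (bminc delta n1 p.1 : 'M[R]_(n1, d)) k j).
      have /measurable_mxP/(_ k j) h := @measurable_bminc delta n1.
      by apply: measurableT_comp h _; exact: measurable_fst.
    by apply/funext => p; rewrite /g2 col_mxEu.
  rewrite [X in measurable_fun _ X](_ : _ = fun p => (bminc delta n2 p.2 : 'M[R]_(n2, d)) k j).
    have /measurable_mxP/(_ k j) h := @measurable_bminc delta n2.
    by apply: measurableT_comp h _; exact: measurable_snd.
  by apply/funext => p; rewrite /g2 col_mxEd.
move=> A mA; rewrite bminc_law//.
pose A1 (i : 'I_n1) j := A (lshift n2 i) j.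
pose A2 (i : 'I_n2) j := A (rshift n1 i) j.
rewrite [RHS](_ : _ = (P \x P)%E
    ((bminc delta n1 @^-1` mxbox A1) `*` (bminc delta n2 @^-1` mxbox A2))); last first.
  congr ((P \x P)%E _); apply/seteqP; split=> [[w1 w2] /= h|[w1 w2] /= [h1 h2]] /=.
    split=> i j; [have := h (lshift n2 i) j|have := h (rshift n1 i) j].
      by rewrite /g2 /= col_mxEu.
    by rewrite /g2 /= col_mxEd.
  move=> i j; rewrite /g2 /=; case: (split_ordP i) => k ->.
    by rewrite col_mxEu; exact: h1.
  by rewrite col_mxEd; exact: h2.
have mpre m (B : 'I_m -> 'I_d -> set R) : (forall i j, measurable (B i j)) ->
    measurable (bminc delta m @^-1` mxbox B).
  move=> mB; rewrite -[X in measurable X]setTI.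
  by apply: measurable_bminc => //; exact: measurable_mxbox.
rewrite product_measure1E; [|by apply: mpre => *; exact: mA..].
have e1 := @bminc_law delta n1 A1 delta0 (fun i j => mA _ _).
have e2 := @bminc_law delta n2 A2 delta0 (fun i j => mA _ _).
transitivity ((\prod_(ij : 'I_n1 * 'I_d) normal_prob 0 (Num.sqrt delta) (A1 ij.1 ij.2)) *
  \prod_(ij : 'I_n2 * 'I_d) normal_prob 0 (Num.sqrt delta) (A2 ij.1 ij.2))%E; last first.
  by congr (_ * _)%E; apply/esym; [exact: e1|exact: e2].
rewrite -(pair_bigA _ (fun i j => normal_prob 0 (Num.sqrt delta) (A i j))).
rewrite -(pair_bigA _ (fun i j => normal_prob 0 (Num.sqrt delta) (A1 i j))).
rewrite -(pair_bigA _ (fun i j => normal_prob 0 (Num.sqrt delta) (A2 i j))).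
by rewrite big_split_ord.
Qed.

End increments.

(** * The Euler scheme *)

Lemma heine_cantor {R : realType} {T : pseudoMetricType R} {V : normedModType R}
    (A : set T) (f : T -> V) (e : R) :
  compact A -> {within A, continuous f} -> 0 < e ->
  exists2 r : R, 0 < r & forall x y, A x -> A y -> ball x r y -> `|f x - f y| < e.
Proof.
move=> cA cf e0.
pose P (r : R) x := A x -> forall y, A y -> ball x r y -> `|f x - f y| < e.
have : \forall r \near (0 : R)^'+, A `<=` P r.
  move/compact_near_coveringP : cA; apply => x Ax.
  have /subspace_continuousP/(_ x Ax)/cvgrPdist_lt/(_ (e / 2)) := cf.
  rewrite divr_gt0// => /(_ isT) /nbhs_ballP[r /= r0 hr].
  (* Half the radius, so that [x'] near [x] and [y] near [x'] are both within [r] of [x]. *)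
  have r20 : 0 < r / 2 by rewrite divr_gt0.
  exists (ball x (r / 2), [set s : R | s < r / 2]) => /=.
    split; first exact: nbhsx_ballx.
    by apply: nbhs_right_lt.
  move=> [x' s] /= [xx' sr] Ax' y Ay x'y.
  rewrite -(subrK (f x) (f x')) -addrA (le_lt_trans (ler_normD _ _))// [ltRHS]splitr ltrD//.
    rewrite distrC; apply: hr => //; apply: le_ball xx'.
    by rewrite ler_pdivrMr// ler_pMr// ler1n.
  apply: hr => //; rewrite [r]splitr; apply: ball_triangle xx' _.
  by apply: le_ball x'y; exact: ltW.
move=> /nbhs_right0P.
move=> /nbhs_ballP[s /= s0 hs]; exists (s / 2); first by rewrite divr_gt0.
move=> x y Ax Ay xy; apply: (hs (s / 2)) => //=.
- rewrite /ball /= sub0r normrN gtr0_norm ?divr_gt0//.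
  by rewrite ltr_pdivrMr// ltr_pMr// ltr1n.
- by rewrite divr_gt0.
- by rewrite add0r.
Qed.

(** Each step uses [1 + k <= exp k], and the new term is multiplied by an exponential that is at
    least 1. *)
Lemma discrete_gronwall {R : realType} (a c : nat -> R) (k : R) (n : nat) :
  0 <= k -> 0 <= a 0%N -> (forall i, 0 <= c i) ->
  (forall i, (i < n)%N -> a i.+1 <= (1 + k) * a i + c i) ->
  a n <= expR (n%:R * k) * (a 0%N + \sum_(i < n) c i).
Proof.
move=> k0 a0 c0; elim: n => [|n IH] h.
  by rewrite mul0r expR0 mul1r big_ord0 addr0.
have {}IH := IH (fun i hi => h i (ltnW hi)).
rewrite (le_trans (h n (ltnSn n)))// big_ord_recr /=.
have sc0 : 0 <= \sum_(i < n) c i by apply: sumr_ge0.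
set S := a 0%N + _ in IH *; have S0 : 0 <= S by rewrite addr_ge0.
have -> : n.+1%:R * k = k + n%:R * k by rewrite -natr1; ring.
rewrite addrA -/S expRD mulrDr lerD//.
  rewrite -mulrA; apply: (@le_trans _ _ ((1 + k) * (expR (n%:R * k) * S))).
    by rewrite ler_wpM2l// addr_ge0.
  by rewrite ler_wpM2r ?expR_ge1Dx// mulr_ge0// expR_ge0.
by rewrite ler_peMl// -expRD -[leLHS]expR0 ler_expR addr_ge0// mulr_ge0.
Qed.

Section euler.
Context {R : realType} {d : nat}.
Variables (b : 'rV[R]_d -> 'rV[R]_d) (delta : R).

(** The noise is an arbitrary sequence, so the same recursion runs on Brownian increments, on
    shifted ones and on the rows of a matrix. *)
Fixpoint euler (n : nat) (f : nat -> 'rV[R]_d) (x : 'rV[R]_d) : 'rV[R]_d :=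
  if n is m.+1 then euler m f x + delta *: b (euler m f x) + f m else x.

Lemma eq_euler n f g x : (forall i, (i < n)%N -> f i = g i) ->
  euler n f x = euler n g x.
Proof.
elim: n => //= n IH fg; rewrite fg// IH// => i hi.
by apply: fg; exact: ltnW.
Qed.

Lemma eulerD m n f x :
  euler (m + n) f x = euler n (fun i => f (m + i)%N) (euler m f x).
Proof. by elim: n => [|n IH]; rewrite ?addn0// addnS /= IH. Qed.

Variable K : R.
Hypotheses (K0 : 0 <= K) (delta0 : 0 <= delta).
Hypothesis bK : forall x y, `|b x - b y| <= K * `|x - y|.

Lemma lipschitz_continuous_drift : continuous b.
Proof.
move=> x; apply/(@cvgrPdist_lt _ _ _ (nbhs x) (nbhs_filter x)) => e e0.
have K1 : 0 < K + 1 by rewrite ltr_wpDl.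
apply/(nbhs_ballP x); exists (e / (K + 1)) => /=; first by rewrite divr_gt0.
move=> y; rewrite -ball_normE /= ltr_pdivlMr// => xy.
by rewrite (le_lt_trans (bK x y))// (le_lt_trans _ xy)// mulrC ler_wpM2l// lerDl.
Qed.

Lemma euler_lip_noise n f g x y :
  `|euler n f x - euler n g y| <=
    expR (n%:R * (K * delta)) * (`|x - y| + \sum_(i < n) `|f i - g i|).
Proof.
apply: (@discrete_gronwall _ (fun n => `|euler n f x - euler n g y|)
  (fun i => `|f i - g i|)) => //=; first exact: mulr_ge0.
move=> i _.
rewrite (_ : _ - _ = (euler i f x - euler i g y)
   + delta *: (b (euler i f x) - b (euler i g y)) + (f i - g i)); last first.
  by rewrite scalerBr; apply/rowP => j; rewrite !mxE; ring.
rewrite (le_trans (ler_normD _ _))// lerD// (le_trans (ler_normD _ _))//.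
rewrite mulrDl mul1r lerD2l normrZ ger0_norm//.
by rewrite mulrC mulrAC; exact: ler_wpM2r.
Qed.

Lemma euler_lip n f x y :
  `|euler n f x - euler n f y| <= expR (n%:R * (K * delta)) * `|x - y|.
Proof.
have := euler_lip_noise n f f x y; rewrite big1 ?addr0// => i _.
by rewrite subrr normr0.
Qed.

(** The defect [r] of each step is propagated by the Lipschitz recursion; Gronwall adds up the
    contributions. *)
Lemma euler_consistent n f (Y : nat -> 'rV[R]_d) (r : R) : 0 <= r ->
  (forall i, (i < n)%N -> `|Y i.+1 - (Y i + delta *: b (Y i) + f i)| <= r) ->
  `|Y n - euler n f (Y 0%N)| <= expR (n%:R * (K * delta)) * (n%:R * r).
Proof.
move=> r0 h.
have := @discrete_gronwall _ (fun n => `|Y n - euler n f (Y 0%N)|)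
  (fun=> r) (K * delta) n (mulr_ge0 K0 delta0) (normr_ge0 _) (fun=> r0).
rewrite sumr_const card_ord /= [in leRHS]subrr normr0 add0r -[r *+ n]mulr_natl; apply.
move=> i hi.
rewrite (_ : _ - _ = (Y i - euler i f (Y 0%N))
   + delta *: (b (Y i) - b (euler i f (Y 0%N)))
   + (Y i.+1 - (Y i + delta *: b (Y i) + f i))); last first.
  by rewrite scalerBr; apply/rowP => j; rewrite !mxE; ring.
rewrite (le_trans (ler_normD _ _))// lerD//; last exact: h.
rewrite (le_trans (ler_normD _ _))//.
rewrite mulrDl mul1r lerD2l normrZ ger0_norm//.
by rewrite mulrC mulrAC; exact: ler_wpM2r.
Qed.

(* If [K T exp (K T) <= 1/2] the endpoint is thus a near-isometric function of
   a shift [a] spread evenly over the noise. *)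
Lemma euler_shift N f x (a a' : 'rV[R]_d) :
  `|euler N.+1 (fun i => f i + N.+1%:R^-1 *: a) x
    - euler N.+1 (fun i => f i + N.+1%:R^-1 *: a') x - (a - a')| <=
  K * (N.+1%:R * delta) * expR (K * (N.+1%:R * delta)) * `|a - a'|.
Proof.
set T := N.+1%:R * delta.
pose E n a := euler n (fun i => f i + N.+1%:R^-1 *: a) x.
have N0 : 0 < N.+1%:R :> R by [].
have T0 : 0 <= T by rewrite mulr_ge0.
(* A crude Lipschitz bound in the shift, to be fed into the drift terms of the sharper estimate
   [main]. *)
have Elip n : (n <= N.+1)%N -> `|E n a - E n a'| <= expR (K * T) * `|a - a'|.
  move=> nN; rewrite (le_trans (euler_lip_noise _ _ _ _ _))//.
  rewrite subrr normr0 add0r.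
  under eq_bigr do rewrite opprD addrACA subrr add0r -scalerBr normrZ.
  rewrite sumr_const card_ord gtr0_norm ?invr_gt0//.
  apply: ler_pM; rewrite ?expR_ge0//.
  - by rewrite ler_expR mulrCA ler_wpM2l// ler_wpM2r// ler_nat.
  - by rewrite -mulrnAl ler_piMl// -[_ *+ n]mulr_natl ler_pdivrMr// mul1r ler_nat.
(* After [n] steps the fraction [n / (N + 1)] of [a - a'] has been received; the rest of the
   difference comes from the drift, and [Elip] bounds its growth in each step. *)
have main : forall n, (n <= N.+1)%N ->
    `|E n a - E n a' - (n%:R / N.+1%:R) *: (a - a')| <=
      n%:R * (K * delta * (expR (K * T) * `|a - a'|)).
  elim=> [|m IH] mN; first by rewrite /E /= !mul0r scale0r subr0 subrr normr0.
  rewrite (_ : _ - _ = (E m a - E m a' - (m%:R / N.+1%:R) *: (a - a')) +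
      delta *: (b (E m a) - b (E m a'))); last first.
    rewrite -[m.+1%:R]natr1 mulrDl mul1r !(scalerDl, scalerBr).
    by rewrite /E /=; apply/rowP => j; rewrite !mxE; ring.
  rewrite (le_trans (ler_normD _ _))// -[m.+1%:R]natr1 mulrDl mul1r lerD//; first exact/IH/ltnW.
  rewrite normrZ ger0_norm//.
  rewrite [leRHS](_ : _ = delta * (K * (expR (K * T) * `|a - a'|))); last by ring.
  apply: ler_wpM2l => //; apply: (le_trans (bK _ _)); apply: ler_wpM2l => //.
  exact/Elip/ltnW.
have := main N.+1 (leqnn _); rewrite divff ?gt_eqF// scale1r => h.
by apply: (le_trans h); rewrite le_eqVlt; apply/orP; left; apply/eqP; rewrite /T; ring.
Qed.

Lemma measurable_euler d' (T : measurableType d') n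
    (f : nat -> T -> 'rV[R]_d) (x : T -> 'rV[R]_d) :
  (forall i, measurable_fun setT (f i : T -> Rd R d)) ->
  measurable_fun setT (x : T -> Rd R d) ->
  measurable_fun setT ((fun t => euler n (fun i => f i t) (x t)) : T -> Rd R d).
Proof.
move=> mf mx; elim: n => //= n IH.
apply: (@measurable_mx R 1 d) => i j; rewrite (ord1 i).
have mb : measurable_fun setT (fun y : Rd R d => b y ord0 j).
  apply: (@continuous_measurable_mx R 1 d) => y.
  apply: (@continuous_comp _ _ _ b (fun z : 'rV[R]_d => z ord0 j)).
    exact: lipschitz_continuous_drift.
  exact: coord_continuous.
have mc (y : T -> 'rV[R]_d) : measurable_fun setT (y : T -> Rd R d) ->
    measurable_fun setT (fun t => y t ord0 j).
  by move=> my; apply: (measurableT_comp (@measurable_coord R 1 d ord0 j) my).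
rewrite [X in measurable_fun _ X](_ : _ = fun t =>
   (euler n (fun i => f i t) (x t)) ord0 j +
   delta * b (euler n (fun i => f i t) (x t)) ord0 j + f n t ord0 j); last first.
  by apply/funext => t; rewrite !mxE.
apply: measurable_funD; last exact: mc.
apply: measurable_funD; first exact: mc.
by apply: measurable_funM => //; exact: (measurableT_comp mb IH).
Qed.

End euler.

(** * Comparison of the Euclidean norm with the sup norm *)

Section enorm.
Context {R : realType} {d : nat}.
Implicit Types x : 'rV[R]_d.

Lemma norm_le_enorm x : `|x| <= enorm x.
Proof.
apply: mx_norm_le; first exact: sqrtr_ge0.
move=> i j; rewrite (ord1 i) -sqrtr_sqr; apply: ler_wsqrtr.
by rewrite /dotRd (bigD1 j)//= -expr2 lerDl sumr_ge0// => k _; rewrite -expr2 sqr_ge0.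
Qed.

Lemma enorm_le_norm x : enorm x <= Num.sqrt d%:R * `|x|.
Proof.
have -> : Num.sqrt d%:R * `|x| = Num.sqrt (d%:R * `|x| ^+ 2).
  by rewrite sqrtrM// sqrtr_sqr normr_id.
apply: ler_wsqrtr.
rewrite mulr_natl -[X in _ *+ X]card_ord -sumr_const; apply: ler_sum => j _.
by rewrite -expr2 -[X in X <= _]real_normK ?num_real// lerXn2r ?nnegrE//; exact: coord_le_norm.
Qed.

(** The matrix norm is the sup norm, in which the later estimates are written. The absolute value of
    [K] makes the constant nonnegative. *)
Lemma lipschitz_drift_norm (b : 'rV[R]_d -> 'rV[R]_d) : lipschitz_drift b ->
  exists2 K, 0 <= K & forall x y, `|b x - b y| <= K * `|x - y|.
Proof.
move=> [K bK]; exists (`|K| * Num.sqrt d%:R); first by rewrite mulr_ge0// sqrtr_ge0.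
move=> x y; rewrite (le_trans (norm_le_enorm _))// (le_trans (bK x y))//.
rewrite (@le_trans _ _ (`|K| * enorm (x - y)))//.
  by rewrite ler_wpM2r// ?sqrtr_ge0// ler_norm.
by rewrite -mulrA ler_wpM2l//; exact: enorm_le_norm.
Qed.

End enorm.

(** * Pathwise convergence of the Euler scheme to the solution *)

Section sde_euler.
Context {dO : measure_display} {Omega : measurableType dO} {R : realType} {d : nat}.
Variables (b : 'rV[R]_d -> 'rV[R]_d) (W : R -> Omega -> 'rV[R]_d).
Variable X : 'rV[R]_d -> R -> Omega -> 'rV[R]_d.
Hypothesis solX : sde_solution b W X.
Variable K : R.
Hypotheses (K0 : 0 <= K) (bK : forall x y, `|b x - b y| <= K * `|x - y|).
Hypothesis W0 : forall w, W 0 w = 0.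

Lemma sde_solution0 x w : X x 0 w = x.
Proof.
have [_ /(_ 0 (lexx 0)) ->] := solX x w.
rewrite W0 addr0 [X in _ + X](_ : _ = 0) ?addr0//; apply/rowP => j; rewrite !mxE.
by rewrite set_itv1 Rintegral_set1.
Qed.

Let g x w j s := b (X x s w) ord0 j.

Let g_int x w j t : 0 <= t -> lebesgue_measure.-integrable `[0, t] (EFin \o g x w j).
Proof.
move=> t0; apply: continuous_compact_integrable; first exact: segment_compact.
have [cX _] := solX x w.
have {}cX : {within `[0, t], continuous (fun t => X x t w)}.
  apply: continuous_subspaceW cX => s /=; rewrite !in_itv /= andbT.
  by move=> /andP[].
move=> s; apply: (@continuous_comp (subspace `[0, t]) 'rV[R]_d R^o (fun t => X x t w)
   (fun y : 'rV[R]_d => b y ord0 j)); first exact: cX.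
apply: (@continuous_comp _ _ _ b (fun z : 'rV[R]_d => z ord0 j)).
  exact: (lipschitz_continuous_drift K0 bK).
exact: coord_continuous.
Qed.

(** The defect of one Euler step is the integral of [b (X x s w) - b (X x t w)] over []t, t']]. *)
Let residual x w t t' e : 0 <= t -> t <= t' -> 0 <= e ->
  (forall s, t < s -> s <= t' -> `|X x s w - X x t w| <= e) ->
  `|X x t' w - (X x t w + (t' - t) *: b (X x t w) + (W t' w - W t w))| <=
    (t' - t) * (K * e).
Proof.
move=> t0 tt' e0 hX; have t'0 := le_trans t0 tt'.
apply: mx_norm_le => [|i j]; first by rewrite mulr_ge0 ?subr_ge0// mulr_ge0.
rewrite (ord1 i) => {i}.
have [_ hint] := solX x w.
have e1 := congr1 (fun y : 'rV[R]_d => y ord0 j) (hint _ t0).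
have e2 := congr1 (fun y : 'rV[R]_d => y ord0 j) (hint _ t'0).
rewrite /= !mxE in e1 e2; rewrite !mxE.
have gi := g_int x w j t'0.
have eI : Rintegral lebesgue_measure `[0, t'] (g x w j) -
    Rintegral lebesgue_measure `[0, t] (g x w j) =
    Rintegral lebesgue_measure `]t, t'] (g x w j).
  by apply: Rintegral_itvB => //; rewrite bnd_simp.
have giS : lebesgue_measure.-integrable `]t, t'] (EFin \o g x w j).
  apply: integrableS gi => //; move=> s /=; rewrite !in_itv /= => /andP[h1 ->].
  by rewrite (le_trans t0)// ltW.
have ci c : lebesgue_measure.-integrable `]t, t'] (EFin \o cst (c : R)).
  apply: measurable_bounded_integrable => //.
    by rewrite /= lebesgue_measure_itv /= lte_fin; case: ifP => // _; rewrite ltry.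
  by exists `|c|; split; [exact: num_real|move=> y cy s _ /=; exact: ltW].
have mu_tt' : fine (lebesgue_measure `]t, t'] ) = t' - t.
  rewrite lebesgue_measure_itv /= lte_fin.
  by case: ltgtP tt' => //= -> _; rewrite subrr.
rewrite (_ : _ - _ = Rintegral lebesgue_measure `]t, t'] (fun s => g x w j s - g x w j t)).
  have giB : lebesgue_measure.-integrable `]t, t'] (EFin \o (fun s => g x w j s - g x w j t)).
    by apply: integrableB giS (ci _).
  rewrite (le_trans (le_normr_Rintegral _ giB))//.
  rewrite (@le_trans _ _ (Rintegral lebesgue_measure `]t, t'] (cst (K * e))))//.
    apply: le_Rintegral => //; [exact: integrable_norm|exact: ci|].
    move=> s /=; rewrite in_itv /= => /andP[ts st'].
    have := coord_le_norm (b (X x s w) - b (X x t w)) ord0 j.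
    rewrite !mxE => h; rewrite (le_trans h)// (le_trans (bK _ _))//.
    by rewrite ler_wpM2l// hX.
  by rewrite Rintegral_cst// mu_tt' mulrC.
rewrite RintegralB//; last exact: ci.
rewrite -eI Rintegral_cst// mu_tt' {1}e2 {1}e1 /g; ring.
Qed.

Definition bmnoise (delta : R) (w : Omega) (i : nat) : 'rV[R]_d :=
  W (i.+1%:R * delta) w - W (i%:R * delta) w.

(** For a fixed path, uniform continuity on [[0, T]] controls the defects of all steps at once. *)
Lemma euler_cvg_sde x w h m : 0 < h ->
  (fun N => euler b (h / N.+1%:R) (m * N.+1) (bmnoise (h / N.+1%:R) w) x) @ \oo
    --> X x (m%:R * h) w.
Proof.
move=> h0; set T := m%:R * h; have T0 : 0 <= T by rewrite mulr_ge0// ltW.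
apply/(@cvgrPdist_le _ _ _ (nbhs \oo)) => e e0.
(* Amplification of the defects by Gronwall; the added 1 keeps [C] positive. *)
pose C := expR (K * T) * (T * K) + 1.
have C0 : 0 < C by rewrite ltr_wpDl// mulr_ge0 ?expR_ge0// mulr_ge0.
have [cX _] := solX x w.
have {}cX : {within `[0, T], continuous (fun t => X x t w)}.
  apply: continuous_subspaceW cX => s /=; rewrite !in_itv /= andbT.
  by move=> /andP[].
have [|r r0 hr] := heine_cantor (@segment_compact R 0 T) cX (e := e / C).
  by rewrite divr_gt0.
have [k hk] := natSinv_lt (divr_gt0 r0 h0).
exists k => // N /= kN.
set dl := h / N.+1%:R.
have dl0 : 0 < dl by rewrite divr_gt0.
have dlr : dl < r.
  rewrite /dl mulrC -ltr_pdivlMr//; apply: le_lt_trans hk.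
  by rewrite lef_pV2 ?posrE// ler_nat ltnS.
have nT : (m * N.+1)%:R * dl = T.
  by rewrite /dl /T natrM; field; rewrite gt_eqF.
have := @euler_consistent _ _ b dl K K0 (ltW dl0) bK (m * N.+1) (bmnoise dl w)
  (fun i => X x (i%:R * dl) w) (dl * (K * (e / C))).
rewrite mul0r sde_solution0 nT => h1; rewrite (le_trans (h1 _ _))//.
- by rewrite mulr_ge0 ?(ltW dl0)// mulr_ge0// divr_ge0 ?(ltW e0) ?(ltW C0).
- move=> i hi.
  have idl : i.+1%:R * dl - i%:R * dl = dl by rewrite -natr1; ring.
  have iT : i.+1%:R * dl <= T by rewrite -nT ler_wpM2r ?(ltW dl0)// ler_nat.
  have := @residual x w (i%:R * dl) (i.+1%:R * dl) (e / C).
  rewrite idl; apply.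
  + by rewrite mulr_ge0 ?(ltW dl0).
  + by rewrite ler_wpM2r ?(ltW dl0)// ler_nat.
  + by rewrite divr_ge0 ?(ltW e0) ?(ltW C0).
  + move=> s h2 h3; apply/ltW/hr.
    * by rewrite /= in_itv /= (le_trans h3)// andbT ltW// (le_lt_trans _ h2)// mulr_ge0 ?(ltW dl0).
    * rewrite /= in_itv /= mulr_ge0 ?(ltW dl0)//= (le_trans _ iT)//.
      by rewrite ler_wpM2r ?(ltW dl0)// ler_nat.
    * rewrite /ball /= gtr0_norm ?subr_gt0// (le_lt_trans _ dlr)//.
      by rewrite -[leRHS]idl lerD2r.
have -> : (m * N.+1)%:R * (K * dl) = K * T by rewrite -nT; ring.
have -> : (m * N.+1)%:R * (dl * (K * (e / C))) = T * K / C * e by rewrite -nT; ring.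
rewrite mulrA ler_piMl ?(ltW e0)// mulrA ler_pdivrMr// mul1r /C lerDl//.
Qed.

End sde_euler.

Lemma cvg_le_cst {R : realType} (u : nat -> R) (l c : R) :
  u @ \oo --> l -> (forall n, u n <= c) -> l <= c.
Proof.
move=> ul uc; rewrite -(cvg_lim _ ul)//; apply: limr_le.
  by apply/cvg_ex; exists l.
exact: nearW.
Qed.

Lemma cvg_ge_cst {R : realType} (u : nat -> R) (l c : R) :
  u @ \oo --> l -> (forall n, c <= u n) -> c <= l.
Proof.
move=> ul uc; rewrite -(cvg_lim _ ul)//; apply: limr_ge.
  by apply/cvg_ex; exists l.
exact: nearW.
Qed.

(** By contradiction, with points at distance less than [1 / (n + 1)]. The continuity of [Qt t g] is
    proved through this lemma, since bounded convergence is about sequences. *)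
Lemma seq_continuous {R : realType} {V : normedModType R} (f : V -> R) (x : V) :
  (forall y : nat -> V, y @ \oo --> x -> (f \o y) @ \oo --> f x) ->
  f @ x --> f x.
Proof.
move=> h; apply/cvgrPdist_lt => e e0; apply/not_notP => nf.
have /choice[y hy] (n : nat) : exists z, `|x - z| < n.+1%:R^-1 /\ e <= `|f x - f z|.
  apply/not_existsP => hz; apply: nf; apply/(nbhs_ballP x); exists n.+1%:R^-1 => /=.
    by rewrite invr_gt0.
  move=> z; rewrite -ball_normE /= => xz; rewrite ltNge; apply/negP => ez.
  exact: (hz z).
have yx : y @ \oo --> x.
  apply/cvgrPdist_lt => r r0; have [k hk] := natSinv_lt r0.
  exists k => // n /= kn; rewrite (lt_le_trans (hy n).1)// (le_trans _ (ltW hk))//.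
  by rewrite lef_pV2 ?posrE// ler_nat ltnS.
have /cvgrPdist_lt/(_ e e0)[k _ /(_ k (leqnn k))] := h y yx.
by rewrite /= ltNge (hy k).2.
Qed.

(** * The transition operators and the Markov property *)

Section Cb.
Context {R : realType} {d : nat}.
Implicit Types g k : 'rV[R]_d -> R.

(** The class on which the transition operators act; by the Feller property [Qt_Cb] they preserve
    it. *)
Definition Cb g := continuous g /\ exists c, forall x, `|g x| <= c.

Lemma Cb_bmf g : Cb g -> bmf (g : Rd R d -> R).
Proof. by move=> [cg bg]; split => //; exact: (@continuous_measurable_mx R 1 d). Qed.

Lemma Cb_cst (c : R) : Cb (fun=> c).
Proof. by split; [exact: cst_continuous|exists `|c|]. Qed.

Lemma CbD g k : Cb g -> Cb k -> Cb (fun x => g x + k x).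
Proof.
move=> [cg [a ga]] [ck [c kc]]; split; first by move=> x; exact: (cvgD (cg x) (ck x)).
by exists (a + c) => x; rewrite (le_trans (ler_normD _ _))// lerD.
Qed.

Lemma CbM g k : Cb g -> Cb k -> Cb (fun x => g x * k x).
Proof.
move=> [cg [a ga]] [ck [c kc]]; split; first by move=> x; exact: (cvgM (cg x) (ck x)).
by exists (a * c) => x; rewrite normrM ler_pM.
Qed.

End Cb.

Section flow.
Context {dO : measure_display} {Omega : measurableType dO} {R : realType} {d : nat}.
Variables (P : probability Omega R).
Variables (b : 'rV[R]_d -> 'rV[R]_d) (W : R -> Omega -> 'rV[R]_d).
Variable X : 'rV[R]_d -> R -> Omega -> 'rV[R]_d.
Hypothesis BW : std_brownian P W.
Hypothesis solX : sde_solution b W X.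
Variable K : R.
Hypotheses (K0 : 0 <= K) (bK : forall x y, `|b x - b y| <= K * `|x - y|).

Let W0 w : W 0 w = 0. Proof. by case: BW. Qed.

Lemma X0 x w : X x 0 w = x. Proof. exact: (sde_solution0 solX W0). Qed.

(** The mesh divides [h], so that every sampling time [i h] is a node of the scheme. *)
Definition eulerX (h : R) (N i : nat) (w : Omega) (x : 'rV[R]_d) :=
  euler b (h / N.+1%:R) (i * N.+1) (bmnoise W (h / N.+1%:R) w) x.

Lemma eulerX_cvg x w h i : 0 < h ->
  (fun N => eulerX h N i w x) @ \oo --> X x (i%:R * h) w.
Proof. by move=> h0; exact: (euler_cvg_sde solX K0 bK W0). Qed.

Lemma eulerX_lip h N i w x y : 0 < h ->
  `|eulerX h N i w x - eulerX h N i w y| <= expR (K * (i%:R * h)) * `|x - y|.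
Proof.
move=> h0; have hN : 0 <= h / N.+1%:R by rewrite divr_ge0// ltW.
rewrite (le_trans (euler_lip K0 hN bK _ _ _ _))// le_eqVlt; apply/orP; left.
by apply/eqP; congr (expR _ * _); rewrite natrM; field; rewrite gt_eqF.
Qed.

(** Inherited from the Euler schemes, whose Lipschitz constant does not depend on [N]. *)
Lemma X_lip t w x y : 0 <= t -> `|X x t w - X y t w| <= expR (K * t) * `|x - y|.
Proof.
rewrite le_eqVlt => /predU1P[<-|t0]; first by rewrite !X0 mulr0 expR0 mul1r.
have e (z : 'rV[R]_d) := @eulerX_cvg z w t 1 t0.
rewrite mul1r in e.
apply: (cvg_le_cst (cvg_norm (cvgB (e x) (e y)))) => N /=.
by rewrite (le_trans (@eulerX_lip _ _ _ _ _ _ t0))// mul1r.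
Qed.

Lemma measurable_bmnoise delta i : measurable_fun setT ((fun w => bmnoise W delta w i) : Omega -> Rd R d).
Proof.
have [_ _ mW _] := BW; apply: (@measurable_mx R 1 d) => k j; rewrite (ord1 k).
rewrite [X in measurable_fun _ X](_ : _ = fun w =>
  W (i.+1%:R * delta) w ord0 j - W (i%:R * delta) w ord0 j).
  exact: measurable_funB.
by apply/funext => w; rewrite !mxE.
Qed.

Lemma measurable_eulerX d' (T : measurableType d') h N i (u : T -> Omega)
    (x : T -> 'rV[R]_d) : 0 < h ->
  measurable_fun setT u -> measurable_fun setT (x : T -> Rd R d) ->
  measurable_fun setT ((fun t => eulerX h N i (u t) (x t)) : T -> Rd R d).
Proof.
move=> h0 mu mx; apply: (@measurable_euler _ _ _ _ K) => //.
by move=> k; exact: (measurableT_comp (measurable_bmnoise _ k) mu).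
Qed.

Lemma cvg_measurable_rV d' (T : measurableType d') (f : nat -> T -> 'rV[R]_d) (g : T -> 'rV[R]_d) :
  (forall n, measurable_fun setT (f n : T -> Rd R d)) ->
  (forall t, f ^~ t @ \oo --> g t) -> measurable_fun setT (g : T -> Rd R d).
Proof.
move=> mf fg; apply: (@measurable_mx R 1 d) => i j.
apply: (measurable_fun_cvg (h := fun n t => f n t i j)).
  by move=> n; exact: (measurableT_comp (@measurable_coord R 1 d i j) (mf n)).
move=> t _; apply: (@cvg_comp _ _ _ (fun n => f n t) (fun y : 'rV[R]_d => y i j)); first exact: fg.
exact: coord_continuous.
Qed.

(** Joint measurability in the noise and the starting point, as Fubini requires, passes to the limit
    from the Euler schemes. *)
Lemma measurable_X d' (T : measurableType d') t (u : T -> Omega) (x : T -> 'rV[R]_d) : 0 <= t ->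
  measurable_fun setT u -> measurable_fun setT (x : T -> Rd R d) ->
  measurable_fun setT ((fun s => X (x s) t (u s)) : T -> Rd R d).
Proof.
rewrite le_eqVlt => /predU1P[<-|t0] mu mx.
  by rewrite [X in measurable_fun _ X](_ : _ = x)//; apply/funext => s; rewrite X0.
apply: (@cvg_measurable_rV _ _ (fun N s => eulerX t N 1 (u s) (x s))).
  by move=> N; exact: measurable_eulerX.
by move=> s; have := @eulerX_cvg (x s) (u s) t 1 t0; rewrite mul1r.
Qed.

Lemma bmf_X d' (T : measurableType d') t g (u : T -> Omega) (x : T -> 'rV[R]_d) : 0 <= t ->
  Cb g -> measurable_fun setT u -> measurable_fun setT (x : T -> Rd R d) ->
  bmf (fun s => g (X (x s) t (u s))).
Proof.
move=> t0 /Cb_bmf bg mu mx.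
by apply: (bmf_comp (g := (fun s => X (x s) t (u s)) : T -> Rd R d)) bg; exact: measurable_X.
Qed.

Lemma bmf_X1 t g x : 0 <= t -> Cb g -> bmf (fun w => g (X x t w)).
Proof. by move=> t0 cg; apply: (bmf_X (u := id) (x := fun=> x)). Qed.

Definition Qt t g x := Ex P (fun w => g (X x t w)).

(** Feller property: the flow is Lipschitz in the starting point, and bounded convergence does the
    rest. *)
Lemma Qt_Cb t g : 0 <= t -> Cb g -> Cb (Qt t g).
Proof.
move=> t0 cg; have [gc [c gb]] := cg; split; last first.
  exists c => x; rewrite (le_trans (Ex_norm_le _ (bmf_X1 x t0 cg)))//.
  by apply: Ex_le_cst => //; apply: bmf_norm; exact: bmf_X1.
move=> x; apply: seq_continuous => y yx.
apply: (Ex_dct P (F := fun n w => g (X (y n) t w)) (c := c) _ _ _).2 => //.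
  by move=> n; case: (bmf_X1 (y n) t0 cg).
move=> w; apply: (@cvg_comp _ _ _ (fun n => X (y n) t w) g); last exact: gc.
apply/(@cvgrPdist_le _ _ _ (nbhs \oo)) => e e0.
have C0 := expR_gt0 (K * t).
move/cvgrPdist_le : yx => /(_ (e / expR (K * t))); rewrite divr_gt0// => /(_ isT).
apply: filterS => n h; rewrite (le_trans (X_lip _ _ _ t0))//.
by rewrite mulrC -ler_pdivlMr.
Qed.

Lemma iter_Qt_Cb t n g : 0 <= t -> Cb g -> Cb (iter n (Qt t) g).
Proof. by move=> t0 cg; elim: n => //= n IH; exact: Qt_Cb. Qed.

End flow.

Section rowN.
Context {R : realType} {d : nat}.

(** Rows are indexed by all natural numbers because [euler] reads its noise from a sequence; the
    value 0 outside the matrix is a placeholder. *)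
Definition rowN n (M : 'M[R]_(n, d)) (i : nat) : 'rV[R]_d :=
  if insub i is Some k then row k M else 0.

Lemma rowNE n (M : 'M[R]_(n, d)) i (hi : (i < n)%N) : rowN M i = row (Ordinal hi) M.
Proof. by rewrite /rowN insubT. Qed.

Lemma rowN_col_mxl n1 n2 (M1 : 'M[R]_(n1, d)) (M2 : 'M[R]_(n2, d)) i :
  (i < n1)%N -> rowN (col_mx M1 M2) i = rowN M1 i.
Proof.
move=> hi; have hi' : (i < n1 + n2)%N by rewrite ltn_addr.
rewrite (rowNE _ hi) (rowNE _ hi'); apply/rowP => j; rewrite !mxE.
case: splitP => [k /= ik|k /= ik]; [by congr (M1 _ j); exact: val_inj|].
by have := hi; rewrite {1}ik ltnNge leq_addr.
Qed.

Lemma rowN_col_mxr n1 n2 (M1 : 'M[R]_(n1, d)) (M2 : 'M[R]_(n2, d)) i :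
  (i < n2)%N -> rowN (col_mx M1 M2) (n1 + i) = rowN M2 i.
Proof.
move=> hi; have hi' : (n1 + i < n1 + n2)%N by rewrite ltn_add2l.
rewrite (rowNE _ hi) (rowNE _ hi'); apply/rowP => j; rewrite !mxE.
case: splitP => [k /= ik|k /= /addnI ik]; last by congr (M2 _ j); exact: val_inj.
by have := ltn_ord k; rewrite -ik ltnNge leq_addr.
Qed.

Lemma measurable_rowN n i : measurable_fun setT ((fun M : Mx R n d => rowN M i) : _ -> Rd R d).
Proof.
rewrite /rowN; case: insubP => [k _ _|_]; last exact: measurable_cst.
apply: (@measurable_mx R 1 d) => l j.
rewrite [X in measurable_fun _ X](_ : _ = fun M : Mx R n d => (M : 'M[R]_(n, d)) k j).
  exact: measurable_coord.
by apply/funext => M; rewrite mxE.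
Qed.

End rowN.

Section markov.
Context {dO : measure_display} {Omega : measurableType dO} {R : realType} {d : nat}.
Variables (P : probability Omega R).
Variables (b : 'rV[R]_d -> 'rV[R]_d) (W : R -> Omega -> 'rV[R]_d).
Variable X : 'rV[R]_d -> R -> Omega -> 'rV[R]_d.
Hypothesis BW : std_brownian P W.
Hypothesis solX : sde_solution b W X.
Variable K : R.
Hypotheses (K0 : 0 <= K) (bK : forall x y, `|b x - b y| <= K * `|x - y|).

Lemma rowN_bminc delta n w i : (i < n)%N ->
  rowN (bminc W delta n w : 'M[R]_(n, d)) i = bmnoise W delta w i.
Proof. by move=> hi; rewrite rowNE; apply/rowP => j; rewrite !mxE. Qed.

Lemma cvg_prod_seq (I : Type) (s : seq I) (u : I -> nat -> R) (l : I -> R) :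
  (forall i, u i @ \oo --> l i) ->
  (fun n => \prod_(i <- s) u i n) @ \oo --> \prod_(i <- s) l i.
Proof.
move=> ul; elim: s => [|i s IH].
  rewrite big_nil; under eq_fun do rewrite big_nil; exact: cvg_cst.
by rewrite big_cons; under eq_fun do rewrite big_cons; exact: cvgM.
Qed.

Lemma prod_bound (I : Type) (s : seq I) (u c : I -> R) :
  (forall i, `|u i| <= c i) -> `|\prod_(i <- s) u i| <= \prod_(i <- s) c i.
Proof.
move=> h; elim/big_rec2 : _ => [|i y1 y2 _ IH]; first by rewrite normr1.
by rewrite normrM ler_pM.
Qed.

Section one_step.
Variables (h : R) (h0 : 0 < h) (m : nat) (f : nat -> 'rV[R]_d -> R) (k : 'rV[R]_d -> R).
Variable x : 'rV[R]_d.
Hypotheses (cf : forall i, Cb (f i)) (ck : Cb k).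

Let dl N := h / N.+1%:R.
Let dl0 N : 0 < dl N. Proof. by rewrite divr_gt0. Qed.

Let FN N (M : Mx R (m * N.+1 + N.+1) d) : R :=
  (\prod_(i < m.+1) f i (euler b (dl N) (i * N.+1) (rowN M) x)) *
  k (euler b (dl N) (m * N.+1 + N.+1) (rowN M) x).

Let bmf_euler N n (g : 'rV[R]_d -> R) (cg : Cb g) l :
  bmf (fun M : Mx R l d => g (euler b (dl N) n (rowN M) x)).
Proof.
apply: (bmf_comp (g := (fun M : Mx R l d => euler b (dl N) n (rowN M) x) : _ -> Rd R d)); last exact: Cb_bmf.
apply: (@measurable_euler _ _ _ _ K) => //.
by move=> i; exact: measurable_rowN.
Qed.

Let bmf_FN N : bmf (@FN N).
Proof. by apply: bmfM; [apply: bmf_prod => i|]; exact: bmf_euler. Qed.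

Let cfb := choice (fun i => (cf i).2).
Let ckb := ck.2.

(** For the Euler schemes this is [Ex_freeze], an identity in law between finitely many increments,
    and both sides pass to the limit. *)
Lemma markov1 :
  Ex P (fun w => (\prod_(i < m.+1) f i (X x (i%:R * h) w)) * k (X x (m.+1%:R * h) w)) =
  Ex P (fun w => (\prod_(i < m.+1) f i (X x (i%:R * h) w)) * Qt P X h k (X x (m%:R * h) w)).
Proof.
have [cf_ cfP] := cfb; have [c_ ckP] := ckb.
pose c := (\prod_(i < m.+1) cf_ i) * c_.
pose A N w := (\prod_(i < m.+1) f i (eulerX b W h N i w x)) * k (eulerX b W h N m.+1 w x).
(* The last period is driven by the second, independent noise. *)
pose B N (p : Omega * Omega) := (\prod_(i < m.+1) f i (eulerX b W h N i p.1 x)) *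
  k (eulerX b W h N 1 p.2 (eulerX b W h N m p.1 x)).
have Ac N w : `|A N w| <= c by rewrite /A normrM ler_pM// prod_bound.
have Bc N p : `|B N p| <= c by rewrite /B normrM ler_pM// prod_bound.
have bmf_g d' (T : measurableType d') (u : T -> Omega) (y : T -> 'rV[R]_d) N i g : Cb g ->
    measurable_fun setT u -> measurable_fun setT (y : T -> Rd R d) ->
    bmf (fun t => g (eulerX b W h N i (u t) (y t))).
  move=> cg mu my; apply: (bmf_comp (g := (fun t => eulerX b W h N i (u t) (y t)) : _ -> Rd R d)).
    exact: (measurable_eulerX BW K0 bK).
  exact: Cb_bmf.
have bA N : bmf (A N).
  by apply: bmfM; [apply: bmf_prod => i|]; apply: (bmf_g _ _ id (fun=> x)).
have bB N : bmf (B N).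
  apply: bmfM; first by apply: bmf_prod => i; apply: (bmf_g _ _ fst (fun=> x)).
  apply: bmf_g => //.
  by apply: (measurable_eulerX BW K0 bK).
have cvgf g i y w : Cb g -> (fun N => g (eulerX b W h N i w y)) @ \oo --> g (X y (i%:R * h) w).
  move=> [cg _]; apply: (@cvg_comp _ _ _ (fun N => eulerX b W h N i w y) g); last exact: cg.
  exact: (eulerX_cvg BW solX K0 bK).
have AL w : A ^~ w @ \oo -->
    (\prod_(i < m.+1) f i (X x (i%:R * h) w)) * k (X x (m.+1%:R * h) w).
  by apply: cvgM; [apply: cvg_prod_seq => i|]; exact: cvgf.
have [_ cvgA] := Ex_dct P (fun N => (bA N).1) Ac AL.
pose G (p : Omega * Omega) := (\prod_(i < m.+1) f i (X x (i%:R * h) p.1)) *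
  k (X (X x (m%:R * h) p.1) h p.2).
have BG p : B ^~ p @ \oo --> G p.
  apply: cvgM; first by apply: cvg_prod_seq => i; exact: cvgf.
  apply: (@cvg_comp _ _ _ (fun N => eulerX b W h N 1 p.2 (eulerX b W h N m p.1 x)) k); last exact: ck.1.
  (* The starting point of the last period also moves with [N]; the Lipschitz bound, uniform in [N],
     absorbs this. *)
  rewrite -(subr0 (X _ h p.2)).
  rewrite (_ : (fun N => _) = (fun N => eulerX b W h N 1 p.2 (X x (m%:R * h) p.1) -
     (eulerX b W h N 1 p.2 (X x (m%:R * h) p.1) -
      eulerX b W h N 1 p.2 (eulerX b W h N m p.1 x)))); last first.
    by apply/funext => N; rewrite subKr.
  apply: cvgB.
    by have := @eulerX_cvg _ _ _ _ _ _ _ _ BW solX K K0 bK (X x (m%:R * h) p.1) p.2 h 1 h0; rewrite mul1r.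
  apply: norm_cvg0; apply: (@squeeze_cvgr _ _ _ _ (fun=> 0)
     (fun N => expR (K * (1%:R * h)) * `|X x (m%:R * h) p.1 - eulerX b W h N m p.1 x|)).
  - apply: nearW => N; rewrite normr_ge0 andTb.
    exact: (eulerX_lip W K0 bK).
  - exact: cvg_cst.
  - rewrite -(mulr0 (expR (K * (1%:R * h)))); apply: cvgMr.
    rewrite -(@normr0 _ 'rV[R]_d) -(subrr (X x (m%:R * h) p.1)).
    apply: cvg_norm; apply: cvgB; first exact: cvg_cst.
    exact: (eulerX_cvg BW solX K0 bK).
have [bG cvgB] := Ex_dct (P \x P)%E (fun N => (bB N).1) Bc BG.
(* Both are the functional [FN] of the increments, evaluated on one noise and on the concatenation
   of two. *)
have AB N : Ex P (A N) = Ex (P \x P)%E (B N).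
  have -> : A N = FN (N := N) \o bminc W (dl N) (m * N.+1 + N.+1).
    apply/funext => w; rewrite /A /FN /=; congr (_ * k _).
      apply: eq_bigr => i _; congr (f i _); apply: eq_euler => j hj.
      rewrite rowN_bminc// ltn_addr// (leq_trans hj)// leq_mul2r.
      by rewrite -ltnS ltn_ord orbT.
    rewrite /eulerX mulSnr; apply: eq_euler => j hj.
    by rewrite rowN_bminc.
  rewrite (Ex_freeze BW (dl0 N) (bmf_FN N)); congr Rintegral.
  apply/funext => p; rewrite /FN /B; congr (_ * k _).
    apply: eq_bigr => i _; congr (f i _); apply: eq_euler => j hj.
    have jm : (j < m * N.+1)%N.
      by rewrite (leq_trans hj)// leq_mul2r -ltnS ltn_ord orbT.
    by rewrite rowN_col_mxl// rowN_bminc.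
  rewrite eulerD /eulerX mul1n.
  rewrite (@eq_euler _ _ _ _ (m * N.+1) _ (bmnoise W (h / N.+1%:R) p.1)); last first.
    by move=> j hj; rewrite rowN_col_mxl// rowN_bminc.
  by apply: eq_euler => j hj; rewrite rowN_col_mxr// rowN_bminc.
rewrite -(cvg_lim _ cvgA)//.
rewrite (_ : (fun n => Ex P (A n)) = (fun n => Ex (P \x P)%E (B n))); last first.
  by apply/funext => N; exact: AB.
rewrite (cvg_lim _ cvgB)// Ex_fubini1//; congr Rintegral.
apply/funext => w; rewrite /G /Qt /= ExZ//.
by apply: (bmf_X1 BW solX K0 bK) => //; exact: ltW.
Qed.

End one_step.

(** The one-step property is iterated with factors 1 inserted at the times after [m]. *)
Lemma markov_property h m q (f : nat -> 'rV[R]_d -> R) k x : 0 < h -> (forall i, Cb (f i)) -> Cb k ->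
  Ex P (fun w => (\prod_(i < m.+1) f i (X x (i%:R * h) w)) * k (X x ((m + q)%:R * h) w)) =
  Ex P (fun w => (\prod_(i < m.+1) f i (X x (i%:R * h) w)) *
    iter q (Qt P X h) k (X x (m%:R * h) w)).
Proof.
move=> h0 cf; elim: q k => [|q IH] k ck /=; first by rewrite addn0.
pose f' i := if (i <= m)%N then f i else fun=> 1.
have cf' i : Cb (f' i) by rewrite /f'; case: ifP => // _; exact: Cb_cst.
have prod_f' w : \prod_(i < (m + q).+1) f' i (X x (i%:R * h) w) =
    \prod_(i < m.+1) f i (X x (i%:R * h) w).
  elim: q {IH} => [|q IHq].
    by rewrite addn0; apply: eq_bigr => i _; rewrite /f' -ltnS ltn_ord.
  rewrite addnS big_ord_recr /= IHq /f' -addnS -[leqRHS]addn0 leq_add2l ltn0.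
  by rewrite mulr1.
have := @markov1 h h0 (m + q) f' k x cf' ck.
under eq_fun do rewrite prod_f'.
under [in X in _ = X -> _]eq_fun do rewrite prod_f'.
rewrite addnS => ->; rewrite IH; last by apply: (Qt_Cb BW solX K0 bK) => //; exact: ltW.
by rewrite -iterS iterSr.
Qed.

(** Semigroup property: the Markov property from time 0 with constant factors. *)
Lemma Qt_iter h q k x : 0 < h -> Cb k -> Qt P X (q%:R * h) k x = iter q (Qt P X h) k x.
Proof.
move=> h0 ck; have := @markov_property h 0 q (fun _ _ => 1) k x h0 (fun=> Cb_cst _) ck.
under eq_fun do rewrite big1// mul1r add0n.
under [in X in _ = X -> _]eq_fun do rewrite big1// mul1r mul0r (X0 BW solX).
by rewrite Ex_cst.
Qed.

End markov.

(** * Density bounds for small steps *)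

Section clamp.
Context {R : realType}.

(** Truncation of [t] to [[0, 1]], written with absolute values so that continuity is immediate. *)
Definition clamp (t : R) := (`|t| - `|t - 1| + 1) / 2.

Lemma clamp_eq1 t : 1 <= t -> clamp t = 1.
Proof. by move=> t1; rewrite /clamp !ger0_norm; lra. Qed.

Lemma clamp_eq0 t : t <= 0 -> clamp t = 0.
Proof. by move=> t0; rewrite /clamp !ler0_norm; lra. Qed.

Lemma clamp_itv t : 0 <= clamp t <= 1.
Proof.
rewrite /clamp; have [t0|t0] := leP t 0; first by rewrite !ler0_norm; lra.
have [t1|t1] := leP t 1; first by rewrite ger0_norm ?(ltW t0)// ler0_norm; lra.
by rewrite !ger0_norm; lra.
Qed.

Lemma continuous_clamp : continuous clamp.
Proof.
move=> t; apply: cvgM; last exact: cvg_cst.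
apply: cvgD; last exact: cvg_cst.
apply: cvgB; first exact: norm_continuous.
apply: cvg_norm; apply: cvgB; [exact: cvg_id|exact: cvg_cst].
Qed.

Variable d : nat.

Definition cutoff (z : 'rV[R]_d) (r : R) (y : 'rV[R]_d) := clamp (2 - `|y - z| / r).

Lemma Cb_clamp (g : 'rV[R]_d -> R) : continuous g -> Cb (fun y => clamp (g y)).
Proof.
move=> cg; split; last first.
  by exists 1 => y; have /andP[h0 h1] := clamp_itv (g y); rewrite ger0_norm.
by move=> y; exact: (cvg_comp _ _ (cg y) (@continuous_clamp (g y))).
Qed.

Lemma Cb_cutoff z r : Cb (cutoff z r).
Proof.
apply: Cb_clamp => y.
have h : (fun y : 'rV[R]_d => y - z) @ y --> y - z.
  exact: (cvgB (@cvg_id _ (nbhs y)) (cvg_cst _)).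
exact: (cvgB (cvg_cst _) (cvgM (cvg_norm h) (cvg_cst _))).
Qed.

Lemma cutoff_itv z r y : 0 <= cutoff z r y <= 1.
Proof. exact: clamp_itv. Qed.

Lemma cutoff_eq1 z r y : 0 < r -> `|y - z| <= r -> cutoff z r y = 1.
Proof.
move=> r0 yz; apply: clamp_eq1.
by rewrite lerBrDr -lerBrDl (_ : 2 - 1 = 1) ?ler_pdivrMr ?mul1r//; ring.
Qed.

Lemma cutoff_neq0 z r y : 0 < r -> cutoff z r y != 0 -> `|y - z| < r *+ 2.
Proof.
move=> r0; apply: contraNT; rewrite -leNgt => h; apply/eqP/clamp_eq0.
by rewrite subr_le0 ler_pdivlMr// mulr_natl.
Qed.

End clamp.

Section near_isometry.
Context {R : realType} {d : nat}.
Variable S : 'rV[R]_d -> 'rV[R]_d.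
Hypothesis HS : forall a a', `|S a - S a' - (a - a')| <= 2^-1 * `|a - a'|.

(** The map [S] minus the identity has Lipschitz constant 1/2, so the triangle inequality gives this
    bound and the next. *)
Lemma near_isometry_ge a a' : 2^-1 * `|a - a'| <= `|S a - S a'|.
Proof.
have := HS a a'; have := ler_normD (S a - S a') (- (S a - S a' - (a - a'))).
rewrite normrN opprB [X in `|X| <= _]addrC subrK; lra.
Qed.

Lemma near_isometry_le a a' : `|S a - S a'| <= 3 / 2 * `|a - a'|.
Proof.
have := HS a a'; have := ler_normD (S a - S a' - (a - a')) (a - a').
rewrite subrK; lra.
Qed.

(* The fixed-point iteration [a |-> a + (z - S a)] halves the residual. *)
Lemma near_isometry_approx z e : 0 < e ->
  exists2 a, `|a| <= 2 * `|z - S 0| & `|S a - z| <= e.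
Proof.
move=> e0; pose st a := a + (z - S a); pose a_ k := iter k st 0.
have res k : `|z - S (a_ k)| <= 2^-1 ^+ k * `|z - S 0|.
  elim: k => [|k IH]; first by rewrite mul1r.
  rewrite /a_ iterS -/(a_ k) /st distrC.
  have := HS (a_ k + (z - S (a_ k))) (a_ k).
  rewrite (addrC (a_ k)) addrK opprB addrA subrK => h.
  by rewrite (le_trans h)// exprS -mulrA ler_wpM2l// invr_ge0.
(* The step number [j] has length at most [2^-1 ^+ j] times the initial residual; this is the
   geometric sum. *)
have bd k : `|a_ k| <= (2 - 2 * 2^-1 ^+ k) * `|z - S 0|.
  elim: k => [|k IH]; first by rewrite /a_ /= normr0 expr0 mulr1 subrr mul0r.
  rewrite /a_ iterS -/(a_ k) /st (le_trans (ler_normD _ _))//.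
  have := res k; move: IH; rewrite exprS; lra.
have [->|zS] := eqVneq z (S 0).
  by exists 0; rewrite ?subrr ?normr0 ?mulr0// ltW.
have zS0 : 0 < `|z - S 0| by rewrite normr_gt0 subr_eq0.
have [k hk] : exists k, 2^-1 ^+ k < e / `|z - S 0|.
  have h : (fun n => (2^-1 : R) ^+ n) @ \oo --> 0.
    by apply: cvg_expr; rewrite ger0_norm ?invr_ge0// invf_lt1// ltr1n.
  move/cvgrPdist_lt : h => /(_ (e / `|z - S 0|)); rewrite divr_gt0// => /(_ isT).
  move=> [k _ /(_ k (leqnn k))] /=; rewrite sub0r normrN ger0_norm; first by exists k.
  by rewrite exprn_ge0// invr_ge0.
exists (a_ k).
  rewrite (le_trans (bd k))// ler_wpM2r// gerBl mulr_ge0// exprn_ge0// invr_ge0//.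
rewrite distrC (le_trans (res k))// -ler_pdivlMr//; exact: ltW.
Qed.

End near_isometry.

(** * Symmetric grids of shifts *)

Section grid.
Context {R : realType} {d : nat}.

(** The grid of mesh [A / n] in the cube [[- A, A] ^ d], symmetric about 0. *)
Definition grid_pt (A : R) (n : nat) (v : {ffun 'I_d -> 'I_n.*2.+1}) : 'rV[R]_d :=
  \row_j (A * ((v j)%:R - n%:R) / n%:R).

Arguments grid_pt : clear implicits.

Lemma card_grid n : #|{ffun 'I_d -> 'I_n.*2.+1}| = (n.*2.+1 ^ d)%N.
Proof. by rewrite card_ffun !card_ord. Qed.

Lemma grid_pt_norm A n v j : 0 <= A -> `|grid_pt A n v ord0 j| <= A.
Proof.
move=> A0; rewrite mxE; have [n0|n0] := eqVneq n 0%N.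
  by rewrite (_ : n%:R = 0 :> R) ?n0// invr0 mulr0 normr0.
have n0' : 0 < n%:R :> R by rewrite ltr0n lt0n.
rewrite normrM normrM (ger0_norm A0) (gtr0_norm (x := _^-1)) ?invr_gt0//.
rewrite -mulrA ler_piMr// ler_pdivrMr// mul1r ler_norml.
rewrite lerBlDr -natrD addnn ler_nat -ltnS ltn_ord andbT.
by rewrite lerBrDl addrN ler0n.
Qed.

Lemma grid_pt_norm_le A n v : 0 <= A -> `|grid_pt A n v| <= A.
Proof.
move=> A0; apply: mx_norm_le => // i j; rewrite (ord1 i); exact: grid_pt_norm.
Qed.

Lemma grid_approx A n (a : 'rV[R]_d) : 0 < A -> (0 < n)%N -> `|a| <= A ->
  exists v, `|grid_pt A n v - a| <= A / n%:R.
Proof.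
move=> A0 n0 aA; have n0' : 0 < n%:R :> R by rewrite ltr0n.
have /choice[v hv] (j : 'I_d) : exists k : 'I_n.*2.+1,
    `|A * (k%:R - n%:R) / n%:R - a ord0 j| <= A / n%:R.
  have aj : `|a ord0 j| <= A := le_trans (coord_le_norm _ _ _) aA.
  move: aj; rewrite ler_norml => /andP[aj1 aj2].
  (* Position of the coordinate in units of the mesh, counted from [- A]; its integer part is the
     index. *)
  pose t := (a ord0 j + A) * n%:R / A.
  have t0 : 0 <= t by rewrite /t divr_ge0 ?(ltW A0)// mulr_ge0//; lra.
  have tn : t <= n.*2%:R.
    rewrite /t ler_pdivrMr// -addnn natrD.
    have h2 : a ord0 j + A <= 2 * A by lra.
    by have := ler_wpM2r (ltW n0') h2; rewrite (_ : 2 * A * n%:R = (n%:R + n%:R) * A)//; ring.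
  have /andP[k1 k2] := Num.Theory.truncn_itv t0.
  have kn : (Num.truncn t < n.*2.+1)%N.
    by rewrite ltnS -(ler_nat R) (le_trans k1).
  exists (Ordinal kn) => /=; set k := Num.truncn t in k1 k2 *.
  have -> : A * (k%:R - n%:R) / n%:R - a ord0 j = A / n%:R * (k%:R - t).
    by rewrite /t; field; rewrite gt_eqF//= gt_eqF.
  rewrite normrM gtr0_norm ?divr_gt0// ler_piMr//; first by rewrite divr_ge0// ltW.
  rewrite ler_norml; move: k1 k2; rewrite -natr1; lra.
exists (finfun v); apply: mx_norm_le; first by rewrite divr_ge0// ltW.
by move=> i j; rewrite (ord1 i) !mxE ffunE; exact: hv.
Qed.

(** Reversing every index maps a grid point to its opposite. *)
Lemma grid_sum0 A n (y : 'rV[R]_d) :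
  \sum_(v : {ffun 'I_d -> 'I_n.*2.+1}) \sum_j grid_pt A n v ord0 j * y ord0 j = 0.
Proof.
pose rv (v : {ffun 'I_d -> 'I_n.*2.+1}) := [ffun j => rev_ord (v j)].
have rvK : involutive rv by move=> v; apply/ffunP => j; rewrite !ffunE rev_ordK.
have rvN v j : grid_pt A n (rv v) ord0 j = - grid_pt A n v ord0 j.
  rewrite !mxE ffunE /= subSS natrB; last by rewrite -ltnS ltn_ord.
  have -> : n.*2%:R = n%:R + n%:R :> R by rewrite -addnn natrD.
  by ring.
set s := LHS; suff : s = - s by move=> h; lra.
rewrite {1}/s (reindex_inj (inv_inj rvK)) /= -sumrN; apply: eq_bigr => v _.
by rewrite -sumrN; apply: eq_bigr => j _; rewrite rvN mulNr.
Qed.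

(* Residues mod 5 separate the grid points whose mutual distance is at most
   four grid steps. *)
Lemma card_grid_le A n (Q : pred {ffun 'I_d -> 'I_n.*2.+1}) : 0 < A -> (0 < n)%N ->
  (forall v v', Q v -> Q v' -> `|grid_pt A n v - grid_pt A n v'| <= 4 * A / n%:R) ->
  (#|Q| <= 5 ^ d)%N.
Proof.
move=> A0 n0 hQ; have n0' : 0 < n%:R :> R by rewrite ltr0n.
pose m5 (v : {ffun 'I_d -> 'I_n.*2.+1}) : {ffun 'I_d -> 'I_5} := [ffun j => inord (v j %% 5)].
rewrite -[X in (_ <= X ^ _)%N](card_ord 5) -[X in (_ <= _ ^ X)%N](card_ord d) -card_ffun.
rewrite -(card_in_imset (f := m5) (D := Q)) ?max_card// => v v' Qv Qv' e.
apply/ffunP => j; apply/val_inj => /=.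
have ej : (v j = v' j %[mod 5])%N.
  have := congr1 (fun f : {ffun 'I_d -> 'I_5} => val (f j)) e.
  by rewrite !ffunE /= !inordK ?ltn_mod.
have hd : `|(v j)%:R - (v' j)%:R| <= 4 :> R.
  have := le_trans (coord_le_norm (grid_pt A n v - grid_pt A n v') ord0 j) (hQ v v' Qv Qv').
  rewrite !mxE (_ : _ - _ = A / n%:R * ((v j)%:R - (v' j)%:R)); last first.
    by field; rewrite gt_eqF.
  rewrite normrM gtr0_norm ?divr_gt0// (_ : 4 * A / n%:R = A / n%:R * 4); last by ring.
  by rewrite ler_pM2l// divr_gt0.
have d1 (p q : nat) : (p = q %[mod 5])%N -> `|p%:R - q%:R| <= 4 :> R -> (p <= q)%N -> p = q.
  move=> /eqP; rewrite eq_sym => pq5 h pq; rewrite eqn_mod_dvd// in pq5.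
  have {}h : (q - p <= 4)%N by rewrite -(ler_nat R) natrB// -(ger0_norm (x := _ - _)) ?subr_ge0 ?ler_nat// distrC.
  move: pq5; case: (posnP (q - p)) => [/eqP|qp0 /dvdn_leq]; last first.
    by move=> /(_ qp0) /leq_ltn_trans/(_ (leq_ltn_trans h (ltnSn 4))); rewrite ltnn.
  by rewrite subn_eq0 => qp _; apply/eqP; rewrite eqn_leq pq.
have [h|h] := leqP (v j) (v' j); first exact: d1.
by apply/esym/d1 => //; [rewrite distrC|exact: ltnW].
Qed.

End grid.

Arguments grid_pt {R d} A n v.

(** * The Cameron-Martin formula for the Euler scheme *)

Section small_step.
Context {dO : measure_display} {Omega : measurableType dO} {R : realType} {d : nat}.
Variables (P : probability Omega R).
Variables (b : 'rV[R]_d -> 'rV[R]_d) (W : R -> Omega -> 'rV[R]_d).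
Variable X : 'rV[R]_d -> R -> Omega -> 'rV[R]_d.
Hypothesis BW : std_brownian P W.
Hypothesis solX : sde_solution b W X.
Variable K : R.
Hypotheses (K0 : 0 <= K) (bK : forall x y, `|b x - b y| <= K * `|x - y|).
Variable h : R.
Hypotheses (h0 : 0 < h) (hsmall : K * h * expR (K * h) <= 2^-1).

Let dl N := h / N.+1%:R.
Let dl0 N : 0 < dl N. Proof. by rewrite divr_gt0. Qed.
Let Ndl N : N.+1%:R * dl N = h.
Proof. by rewrite /dl; field; rewrite gt_eqF. Qed.

Definition shifted_euler N (x a : 'rV[R]_d) (w : Omega) :=
  euler b (h / N.+1%:R) N.+1 (fun i => bmnoise W (h / N.+1%:R) w i + N.+1%:R^-1 *: a) x.

Lemma shifted_euler0 N x w : shifted_euler N x 0 w = eulerX b W h N 1 w x.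
Proof.
rewrite /eulerX mul1n; apply: eq_euler => i _.
by rewrite scaler0 addr0.
Qed.

(** The smallness of [h] is used here: the factor in [euler_shift] becomes 1/2. *)
Lemma shifted_euler_near_isometry N x w a a' :
  `|shifted_euler N x a w - shifted_euler N x a' w - (a - a')| <= 2^-1 * `|a - a'|.
Proof.
have := euler_shift K0 (ltW (dl0 N)) bK N (bmnoise W (dl N) w) x a a'.
rewrite Ndl => e; apply: (le_trans e); exact: ler_wpM2r.
Qed.

Lemma measurable_shifted_euler N x a :
  measurable_fun setT (shifted_euler N x a : Omega -> Rd R d).
Proof.
apply: (@measurable_euler _ _ _ _ K) => // i.
apply: (@measurable_mx R 1 d) => k j.
rewrite [X in measurable_fun _ X](_ : _ = fun w =>
   bmnoise W (h / N.+1%:R) w i k j + (N.+1%:R^-1 *: a) k j).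
  apply: measurable_funD => //.
  exact: (measurableT_comp (@measurable_coord R 1 d k j) (measurable_bmnoise BW _ _)).
by apply/funext => w; rewrite [LHS]mxE.
Qed.

(* Density of the law of [W h + a] with respect to the law of [W h]. *)
Definition cmw (a y : 'rV[R]_d) : R :=
  expR (\sum_j (a ord0 j * y ord0 j / h - a ord0 j ^+ 2 / (2 * h))).

Lemma cmw_ge0 a y : 0 <= cmw a y. Proof. exact: expR_ge0. Qed.

Let expR_sum (I : Type) (s : seq I) (u : I -> R) :
  \prod_(i <- s) expR (u i) = expR (\sum_(i <- s) u i).
Proof. by apply/esym/big_morph; [exact: expRD|exact: expR0]. Qed.

Let sum_bmnoise delta n w : \sum_(i < n) bmnoise W delta w i = W (n%:R * delta) w.
Proof.
elim: n => [|n IH]; first by rewrite big_ord0 mul0r; case: BW => ->.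
by rewrite big_ord_recr /= IH /bmnoise addrC subrK.
Qed.

Lemma measurable_W t : measurable_fun setT (W t : Omega -> Rd R d).
Proof.
have [_ _ mW _] := BW; apply: (@measurable_mx R 1 d) => i j; rewrite (ord1 i).
exact: mW.
Qed.

Lemma measurable_cmw a : measurable_fun setT (cmw a : Rd R d -> R).
Proof.
apply: measurableT_comp => //.
have := @measurable_sum _ (Rd R d) R setT 'I_d (index_enum _)
  (fun j (y : Rd R d) => a ord0 j * (y : 'rV[R]_d) ord0 j / h - a ord0 j ^+ 2 / (2 * h)).
apply => j; apply: measurable_funB => //; apply: measurable_funM => //.
by apply: measurable_funM => //; exact: (@measurable_coord R 1 d).
Qed.

(** The weights of the entries multiply to a function of [W h] alone, whatever [N]. The factor [chi]
    serves to confine the noise to a bounded set in the lower bound. *)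
Lemma cm_euler N x a (phi chi : Rd R d -> R) :
  measurable_fun setT phi -> measurable_fun setT chi ->
  (forall y, 0 <= phi y) -> (forall y, 0 <= chi y) ->
  (\int[P]_w (phi (shifted_euler N x a w) * chi (W h w + a)%R)%:E =
   \int[P]_w (phi (eulerX b W h N 1 w x) * (chi (W h w) * cmw a (W h w)))%:E)%E.
Proof.
move=> mphi mchi phi0 chi0.
pose F (M : Mx R N.+1 d) := (phi (euler b (dl N) N.+1 (rowN M) x) *
   chi (\sum_(i < N.+1) rowN M i)%R)%:E.
have mF : measurable_fun setT F.
  apply/measurable_EFinP; apply: measurable_funM.
    apply: (measurableT_comp mphi); apply: (@measurable_euler _ _ _ _ K) => // i.
    exact: measurable_rowN.
  apply: (measurableT_comp mchi); apply: (@measurable_mx R 1 d) => k j.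
  rewrite [X in measurable_fun _ X](_ : _ = fun M : Mx R N.+1 d =>
    \sum_(i < N.+1) rowN M i k j).
    apply: measurable_sum => i.
    exact: (measurableT_comp (@measurable_coord R 1 d k j) (measurable_rowN _)).
  by apply/funext => M; rewrite summxE.
have F0 M : (0 <= F M)%E by rewrite lee_fin mulr_ge0.
pose Sm : 'M[R]_(N.+1, d) := \matrix_(i, j) (N.+1%:R^-1 * a ord0 j).
have sdl0 : Num.sqrt (dl N) != 0 by rewrite gt_eqF// sqrtr_gt0.
have := cameron_martin sdl0 (measurable_bminc BW (dl N) (n := N.+1))
  (fun A => @bminc_law _ _ _ _ P W BW (dl N) N.+1 A (dl0 N)) Sm mF F0.
have rowS w i : (i < N.+1)%N ->
    rowN ((bminc W (dl N) N.+1 w : 'M[R]_(N.+1, d)) + Sm) i =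
    bmnoise W (dl N) w i + N.+1%:R^-1 *: a.
  by move=> hi; rewrite rowNE; apply/rowP => j; rewrite !mxE.
have N0 : N.+1%:R != 0 :> R by rewrite gt_eqF.
move=> cm; transitivity (\int[P]_w F ((bminc W (dl N) N.+1 w : 'M[R]_(N.+1, d)) + Sm)%R)%E.
  apply: eq_integral => w _; rewrite /F; congr (phi _ * chi _)%:E.
    by apply: eq_euler => i hi; rewrite rowS.
  under eq_bigr do rewrite rowS//.
  rewrite big_split /= sum_bmnoise Ndl sumr_const card_ord -scaler_nat scalerA.
  by rewrite divff// scale1r.
rewrite cm; apply: eq_integral => w _; rewrite /F -EFinM -mulrA; congr (_ * _)%:E.
  rewrite /eulerX mul1n; congr phi; apply: eq_euler => i hi.
  by rewrite rowN_bminc.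
congr (_ * _).
  congr chi; rewrite -[in RHS](Ndl N) -sum_bmnoise; apply: eq_bigr => i _.
  by rewrite rowN_bminc.
rewrite /cmw /gtilt expR_sum; congr expR.
rewrite -(pair_bigA _ (fun i j => Sm i j * (bminc W (dl N) N.+1 w : 'M[R]_(N.+1, d)) i j / Num.sqrt (dl N) ^+ 2
   - Sm i j ^+ 2 / (2 * Num.sqrt (dl N) ^+ 2))) /= exchange_big /=.
apply: eq_bigr => j _; rewrite sqr_sqrtr ?(ltW (dl0 N))//.
(* Each increment has variance [h / (N + 1)] and is shifted by [a / (N + 1)]: the factors [N + 1]
   cancel in the linear terms, and the quadratic ones sum to [a ^ 2 / (2 h)]. *)
transitivity (\sum_(i < N.+1) (a ord0 j / h * (bmnoise W (dl N) w i) ord0 j -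
   N.+1%:R^-1 * (a ord0 j ^+ 2 / (2 * h)))).
  apply: eq_bigr => i _; rewrite !mxE /dl.
  move: (N.+1%:R : R) N0 => nn nn0; field.
  by rewrite nn0 gt_eqF.
rewrite sumrB sumr_const card_ord -mulr_sumr -[X in _ - X]mulr_natl mulrA divff// mul1r.
congr (_ - _); rewrite mulrAC; congr (_ * _).
by rewrite -[in RHS](Ndl N) -sum_bmnoise summxE.
Qed.

Section grid_sums.
Variables (N : nat) (x : 'rV[R]_d) (I : finType) (a : I -> 'rV[R]_d).
Variables (phi chi : Rd R d -> R).
Hypotheses (bphi : bmf phi) (bchi : bmf chi).
Hypotheses (phi0 : forall y, 0 <= phi y) (chi0 : forall y, 0 <= chi y).

Lemma bmf_eulerX1 : bmf (fun w => phi (eulerX b W h N 1 w x)).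
Proof.
apply: (bmf_comp (g := (fun w => eulerX b W h N 1 w x) : Omega -> Rd R d)) bphi.
by apply: (measurable_eulerX BW K0 bK _ _ h0 (u := id)).
Qed.

Lemma bmf_shifted v : bmf (fun w => phi (shifted_euler N x (a v) w) * chi (W h w + a v)).
Proof.
apply: bmfM.
  by apply: (bmf_comp (g := shifted_euler N x (a v) : Omega -> Rd R d)) bphi; exact: measurable_shifted_euler.
apply: (bmf_comp (g := (fun w => W h w + a v) : Omega -> Rd R d)) bchi.
apply: (@measurable_mx R 1 d) => k j.
rewrite [X in measurable_fun _ X](_ : _ = fun w => W h w k j + a v k j).
  apply: measurable_funD => //.
  exact: (measurableT_comp (@measurable_coord R 1 d k j) (measurable_W _)).
by apply/funext => w; rewrite [LHS]mxE.
Qed.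

(** Extended integrals are used because the weights [cmw] are unbounded, hence outside [bmf]. *)
Let sumE : (\sum_v Ex P (fun w => phi (shifted_euler N x (a v) w) * chi (W h w + a v)%R))%:E =
  (\int[P]_w (phi (eulerX b W h N 1 w x) *
     (chi (W h w) * \sum_v cmw (a v) (W h w))%R)%:E)%E.
Proof.
transitivity (\sum_v \int[P]_w (phi (eulerX b W h N 1 w x) *
     (chi (W h w) * cmw (a v) (W h w)))%:E)%E.
  rewrite -sumEFin; apply: eq_bigr => v _.
  rewrite (EFin_Ex P (bmf_shifted v)) cm_euler//; [by case: bphi|by case: bchi].
rewrite -ge0_integral_sum//.
- by apply: eq_integral => w _; rewrite sumEFin !mulr_sumr.
- move=> v; apply/measurable_EFinP; apply: measurable_funM; first by case: bmf_eulerX1.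
  apply: measurable_funM; first exact: (measurableT_comp bchi.1 (measurable_W h)).
  exact: (measurableT_comp (measurable_cmw (a v)) (measurable_W h)).
- by move=> v w _; rewrite lee_fin !mulr_ge0// cmw_ge0.
Qed.

Let msum : measurable_fun setT (fun w => phi (eulerX b W h N 1 w x) *
     (chi (W h w) * \sum_v cmw (a v) (W h w))).
Proof.
apply: measurable_funM; first by case: bmf_eulerX1.
apply: measurable_funM; first exact: (measurableT_comp bchi.1 (measurable_W h)).
apply: measurable_sum => v.
exact: (measurableT_comp (measurable_cmw (a v)) (measurable_W h)).
Qed.

(** A lower bound on the total weight turns a count of the shifted endpoints into an upper bound for
    the unshifted expectation; [cm_sum_le] goes the other way. *)
Lemma cm_sum_ge c : 0 <= c -> (forall y, c <= chi y * \sum_v cmw (a v) y) ->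
  c * Ex P (fun w => phi (eulerX b W h N 1 w x)) <=
  \sum_v Ex P (fun w => phi (shifted_euler N x (a v) w) * chi (W h w + a v)).
Proof.
move=> c0 hc; rewrite -lee_fin sumE -ExZ; last exact: bmf_eulerX1.
have bc : bmf (fun w => c * phi (eulerX b W h N 1 w x)).
  by apply: bmfM; [exact: bmf_cst|exact: bmf_eulerX1].
rewrite EFin_Ex//; apply: ge0_le_integral => //.
- by move=> w _; rewrite lee_fin mulr_ge0.
- by apply/measurable_EFinP; case: bc.
- exact/measurable_EFinP.
- by move=> w _; rewrite lee_fin mulrC ler_wpM2l.
Qed.

Lemma cm_sum_le c : 0 <= c -> (forall y, chi y * \sum_v cmw (a v) y <= c) ->
  \sum_v Ex P (fun w => phi (shifted_euler N x (a v) w) * chi (W h w + a v)) <=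
  c * Ex P (fun w => phi (eulerX b W h N 1 w x)).
Proof.
move=> c0 hc; rewrite -lee_fin sumE -ExZ; last exact: bmf_eulerX1.
have bc : bmf (fun w => c * phi (eulerX b W h N 1 w x)).
  by apply: bmfM; [exact: bmf_cst|exact: bmf_eulerX1].
rewrite EFin_Ex//; apply: ge0_le_integral => //.
- move=> w _; rewrite lee_fin mulr_ge0// mulr_ge0// sumr_ge0// => v _.
  exact: cmw_ge0.
- exact/measurable_EFinP.
- by apply/measurable_EFinP; case: bc.
- by move=> w _; rewrite lee_fin mulrC ler_wpM2r.
Qed.

End grid_sums.

End small_step.

Lemma bmf_le {d0} {T : measurableType d0} {R : realType} (V : T -> R) (A : R) :
  measurable_fun setT V -> bmf (fun w => (V w <= A)%R%:R : R).
Proof.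
move=> mV; split; last first.
  by exists 1 => w; case: (V w <= A); rewrite /= ?normr1// normr0.
rewrite [X in measurable_fun _ X](_ : _ = \1_[set w | V w <= A]).
  apply: measurable_indic; rewrite -[X in measurable X]setTI.
  exact: (measurable_fun_ler mV (measurable_cst _)).
by apply/funext => w; rewrite indicE; congr ((nat_of_bool _)%:R); apply/idP/idP; rewrite inE.
Qed.

(** The indicators of [V <= n + 1] tend to 1 at every point. *)
Lemma tight {d0} {T : measurableType d0} {R : realType} (P : probability T R) (V : T -> R) e :
  measurable_fun setT V -> 0 < e ->
  exists2 A : R, 0 < A & Ex P (fun w => (V w <= A)%R%:R) >= 1 - e.
Proof.
move=> mV e0.
have mF n : measurable_fun setT (fun w => (V w <= n.+1%:R)%R%:R : R) := (bmf_le n.+1%:R mV).1.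
have := Ex_dct P (F := fun n w => (V w <= n.+1%:R)%R%:R) (f := fun=> 1) (c := 1) mF.
move=> [| |_].
- by move=> n w; case: (V w <= _); rewrite /= ?normr1// normr0 ler01.
- move=> w; apply/cvgrPdist_lt => r r0; have /andP[_ k2] := truncn_itv (normr_ge0 (V w)).
  exists (Num.truncn `|V w|) => // n /= hn.
  rewrite (_ : V w <= n.+1%:R) ?subrr ?normr0//.
  rewrite (le_trans (ler_norm _))// (le_trans (ltW k2))//.
  by rewrite ler_nat ltnS.
rewrite Ex_cst => /cvgrPdist_lt/(_ e e0)[n _ /(_ n (leqnn n))] /= hn.
by exists n.+1%:R => //; have := ler_norm (1 - Ex P (fun w => (V w <= n.+1%:R)%R%:R)); lra.
Qed.

Lemma measurable_mx_norm {R : realType} {d} {d0} {T : measurableType d0} (f : T -> 'rV[R]_d) :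
  measurable_fun setT (f : T -> Rd R d) -> measurable_fun setT (fun t => `|f t|).
Proof.
move=> mf; have h : measurable_fun setT (fun y : Rd R d => `|(y : 'rV[R]_d)|).
  by apply: (@continuous_measurable_mx R 1 d); exact: norm_continuous.
exact: (measurableT_comp h mf).
Qed.

(** * Bounds of order [r ^ d] for one short step *)

Section small_step_bounds.
Context {dO : measure_display} {Omega : measurableType dO} {R : realType} {d : nat}.
Variables (P : probability Omega R).
Variables (b : 'rV[R]_d -> 'rV[R]_d) (W : R -> Omega -> 'rV[R]_d).
Variable X : 'rV[R]_d -> R -> Omega -> 'rV[R]_d.
Hypothesis BW : std_brownian P W.
Hypothesis solX : sde_solution b W X.
Variable K : R.
Hypotheses (K0 : 0 <= K) (bK : forall x y, `|b x - b y| <= K * `|x - y|).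
Variable h : R.
Hypotheses (h0 : 0 < h) (hsmall : K * h * expR (K * h) <= 2^-1).

Let SE N x a w := shifted_euler b W h N x a w.

Let Qt_cvg phi x : Cb phi ->
  (fun N => Ex P (fun w => phi (eulerX b W h N 1 w x))) @ \oo --> Qt P X h phi x.
Proof.
move=> cphi; have [phic [c phib]] := cphi.
apply: (Ex_dct P (F := fun N w => phi (eulerX b W h N 1 w x)) (c := c) _ _ _).2 => //.
  by move=> N; case: (bmf_eulerX1 BW K0 bK h0 N x (Cb_bmf cphi)).
move=> w; apply: (@cvg_comp _ _ _ (fun N => eulerX b W h N 1 w x) phi); last exact: phic.
by have := @eulerX_cvg _ _ _ _ _ _ _ _ BW solX K K0 bK x w h 1 h0; rewrite mul1r.
Qed.

Let cmw_grid_ge n (y : 'rV[R]_d) :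
  expR (- (d%:R / (2 * h))) * (n.*2.+1 ^ d)%:R <= \sum_v cmw h (grid_pt 1 n v) y.
Proof.
have h2 : 0 < 2 * h by rewrite mulr_gt0.
pose s v := \sum_j grid_pt 1 n v ord0 j * y ord0 j.
(* The coordinates of the shift have squares at most 1, and [exp t >= 1 + t] bounds the linear part
   from below. *)
have one v : expR (- (d%:R / (2 * h))) * (1 + h^-1 * s v) <= cmw h (grid_pt 1 n v) y.
  rewrite /cmw sumrB (_ : \sum_i _ = h^-1 * s v); last first.
    by rewrite /s mulr_sumr; apply: eq_bigr => j _; rewrite mulrC.
  rewrite [in leRHS]addrC expRD; apply: (@le_trans _ _ (expR (- (d%:R / (2 * h))) * expR (h^-1 * s v))).
    by apply: ler_wpM2l; [exact: expR_ge0|exact: expR_ge1Dx].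
  rewrite ler_wpM2r ?expR_ge0// ler_expR lerN2.
  rewrite (_ : d%:R / (2 * h) = \sum_(j < d) 1 / (2 * h)).
    apply: ler_sum => j _; rewrite ler_pM2r ?invr_gt0//.
    have := @grid_pt_norm R d 1 n v j ler01; rewrite ler_norml => /andP[? ?].
    nra.
  by rewrite sumr_const card_ord -[RHS]mulr_natl mul1r.
apply: le_trans (ler_sum _ (fun v _ => one v)).
rewrite -mulr_sumr big_split /= -mulr_sumr grid_sum0 mulr0 addr0.
by rewrite sumr_const card_grid.
Qed.

(* Sum the Cameron-Martin identity over a symmetric grid of shifts of mesh about
   [r].  The weights add up to at least a constant times the size of the grid
   (convexity of [exp], the linear terms cancel by symmetry), while each path
   sends at most [5 ^ d] of the shifted endpoints into the ball. *)
Lemma Qt_upper phi x z r : Cb phi -> (forall y, 0 <= phi y <= 1) ->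
  (forall y, phi y != 0 -> `|y - z| <= r) -> 0 < r <= 1 ->
  Qt P X h phi x <= expR (d%:R / (2 * h)) * 5 ^+ d * r ^+ d.
Proof.
move=> cphi phi01 supp /andP[r0 r1].
have phi0 y : 0 <= phi y by case/andP: (phi01 y).
apply: (cvg_le_cst (@Qt_cvg phi x cphi)) => N.
have rV1 : 1 <= r^-1 by rewrite invf_ge1.
(* The mesh [1 / n] is at least [r], while [(2 n + 1) r >= 1]. *)
pose n := Num.truncn r^-1.
have /andP[n1 n2] : n%:R <= r^-1 < n.+1%:R by apply: truncn_itv; rewrite invr_ge0 ltW.
have n0 : (0 < n)%N by rewrite truncn_gt0.
have nR0 : 0 < n%:R :> R by rewrite ltr0n.
have rn : r * n%:R <= 1 by rewrite -ler_pdivlMl// mulr1.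
pose E := Ex P (fun w => phi (eulerX b W h N 1 w x)).
have E0 : 0 <= E by exact: Ex_ge0.
have bsh v : bmf (fun w => phi (SE N x (grid_pt 1 n v) w) * 1).
  exact: (bmf_shifted BW K0 bK h N x (grid_pt 1 n) (Cb_bmf cphi) (bmf_cst _ 1)).
have key : expR (- (d%:R / (2 * h))) * (n.*2.+1 ^ d)%:R * E <= 5 ^+ d.
  apply: le_trans (cm_sum_ge BW K0 bK h0 N x (a := grid_pt 1 n) (Cb_bmf cphi) (bmf_cst _ 1) _ _ _ _) _.
  - exact: phi0.
  - by [].
  - by rewrite mulr_ge0// expR_ge0.
  - by move=> y; rewrite mul1r; exact: cmw_grid_ge.
  rewrite -Ex_sum//; apply: Ex_le_cst; first exact: bmf_sum.
  move=> w; pose Q v := phi (SE N x (grid_pt 1 n v) w) != 0.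
  apply: (@le_trans _ _ (#|Q|)%:R).
    rewrite -sum1_card natr_sum [leRHS]big_mkcond /=; apply: ler_sum => v _.
    rewrite mulr1 unfold_in /Q; case: eqP => [->//|_ /=].
    by case/andP: (phi01 (SE N x (grid_pt 1 n v) w)).
  rewrite -natrX ler_nat; apply: (@card_grid_le R d 1 n Q ltr01 n0) => v v' Qv Qv'.
  (* Two endpoints in the ball differ by at most [2 r], so their shifts differ by at most
     [4 r <= 4 / n]. *)
  have h3 : 2^-1 * `|grid_pt 1 n v - grid_pt 1 n v'| <=
      `|SE N x (grid_pt 1 n v) w - SE N x (grid_pt 1 n v') w|.
    exact: (near_isometry_ge (shifted_euler_near_isometry W K0 bK h0 hsmall N x w)).
  have h1 := supp _ Qv; have h2 := supp _ Qv'.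
  have h4 := ler_normD (SE N x (grid_pt 1 n v) w - z) (- (SE N x (grid_pt 1 n v') w - z)).
  rewrite normrN opprB addrA subrK in h4.
  have h5 : `|grid_pt 1 n v - grid_pt 1 n v'| <= 4 * r by lra.
  by rewrite (le_trans h5)// mulr1 ler_pdivlMr//; lra.
have c0 : 0 < expR (- (d%:R / (2 * h))) * (n.*2.+1 ^ d)%:R.
  by rewrite mulr_gt0 ?expR_gt0// ltr0n expn_gt0.
rewrite -/E -(ler_pM2l c0) (le_trans key)//.
rewrite expRN natrX (_ : _ * _ = 5 ^+ d * (n.*2.+1%:R * r) ^+ d); last first.
  by rewrite exprMn; field; rewrite gt_eqF// expR_gt0.
rewrite ler_peMr ?exprn_ge0// exprn_ege1//.
rewrite -ler_pdivrMr// mul1r (le_trans (ltW n2))// ler_nat ltnS -addnn leq_addr//.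
Qed.

(* Conversely, each path with bounded noise sends at least one of the shifted
   endpoints into the ball, and there the weights are bounded. *)
Lemma Qt_lower (D0 Z0 : R) : 0 <= D0 -> 0 <= Z0 -> exists2 c : R, 0 < c &
  forall x z r phi, `|x| <= D0 -> `|z| <= Z0 -> 0 < r <= 1 -> Cb phi ->
    (forall y, 0 <= phi y) -> (forall y, `|y - z| <= r -> 1 <= phi y) ->
    c * r ^+ d <= Qt P X h phi x.
Proof.
move=> D00 Z00.
have mX0 : measurable_fun setT (X 0 h : Omega -> Rd R d).
  by apply: (measurable_X BW solX K0 bK (u := id) (x := fun=> 0)) => //; exact: ltW.
have mWh := measurable_W BW h.
(* With probability at least 1/2, the solution from 0 and the noise are both bounded by [A]. *)
have [|A A0 hA] := @tight _ _ _ P (fun w => `|X 0 h w| + `|W h w|) (2^-1) _ ltac:(by rewrite invr_gt0).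
  by apply: measurable_funD; exact: measurable_mx_norm.
(* Here [B1] bounds the endpoint from [x], [A3] the shift that brings it to [z], [M0] the shifted
   noise, and [G] the weights where the noise is at most [M0]. *)
pose B1 := 2 * A + expR (K * h) * D0.
have B10 : 0 <= B1 by rewrite addr_ge0 ?mulr_ge0 ?expR_ge0 ?(ltW A0).
pose A3 := 2 * (Z0 + B1) + 1.
have A30 : 0 < A3 by rewrite /A3; lra.
pose M0 := A + A3.
pose G := expR (d%:R * (A3 * M0 / h)).
have G0 : 0 < G := expR_gt0 _.
exists ((2 * G)^-1 / (4 * A3 + 3) ^+ d).
  by rewrite divr_gt0 ?invr_gt0 ?mulr_gt0// exprn_gt0//; lra.
move=> x z r phi xD zZ /andP[r0 r1] cphi phi0 phi1.
(* The mesh [A3 / n] is at most [r / 2]: rounding the shift to the grid moves the endpoint by at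
   most [3 r / 4], and the approximate solution is within [r / 4] of [z]. *)
pose n := (Num.truncn (2 * A3 / r)).+1.
have /andP[n1 n2] : (Num.truncn (2 * A3 / r))%:R <= 2 * A3 / r < n%:R.
  by apply: truncn_itv; rewrite divr_ge0 ?mulr_ge0 ?ltW.
have nR0 : 0 < n%:R :> R by rewrite ltr0n.
have A3n : A3 / n%:R <= r / 2.
  by rewrite ler_pdivrMr//; move: n2; rewrite ltr_pdivrMr//; nra.
have cntr : (n.*2.+1)%:R * r <= 4 * A3 + 3.
  have : (Num.truncn (2 * A3 / r))%:R * r <= 2 * A3 by rewrite -ler_pdivlMr.
  by rewrite /n -addnn -!natr1 natrD -natr1; nra.
pose chi (y : Rd R d) : R := (`|(y : 'rV[R]_d)| <= M0)%R%:R.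
have chi0 y : 0 <= chi y by exact: ler0n.
have bchi : bmf chi.
  apply: (@bmf_le _ (Rd R d) R (fun y => `|(y : 'rV[R]_d)|)).
  exact: (@measurable_mx_norm _ _ _ (Rd R d) id).
pose cA := (n.*2.+1 ^ d)%:R * G.
have cA0 : 0 <= cA by rewrite mulr_ge0// ltW.
have cm N := @cm_sum_le _ _ _ _ P b W BW K K0 bK h h0 N x _ (grid_pt A3 n)
  phi chi (Cb_bmf cphi) bchi phi0 chi0 cA cA0.
have {}cm N : \sum_v Ex P (fun w => phi (SE N x (grid_pt A3 n v) w) * chi (W h w + grid_pt A3 n v)) <=
    cA * Ex P (fun w => phi (eulerX b W h N 1 w x)).
  apply: cm => y; rewrite /chi; case: (leP `|y| M0) => yM; last by rewrite mul0r.
  rewrite mul1r /cA -[X in X%:R]card_grid -sumr_const mulr_suml; apply: ler_sum => v _.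
  rewrite mul1r /cmw /G ler_expR.
  rewrite (_ : d%:R * _ = \sum_(j < d) A3 * M0 / h); last by rewrite sumr_const card_ord mulr_natl.
  apply: ler_sum => j _; rewrite lerBlDr (@le_trans _ _ (A3 * M0 / h))//; last first.
    by rewrite lerDl divr_ge0 ?sqr_ge0// mulr_ge0// ltW.
  rewrite ler_pM2r ?invr_gt0// (le_trans (ler_norm _))// normrM ler_pM//.
    exact/grid_pt_norm/ltW.
  exact: le_trans (coord_le_norm _ _ _) yM.
(* The event of bounded noise, made continuous in the endpoint of the scheme so as to pass to the
   limit; the cutoff of radius [A] lives on radius [2 A]. *)
pose psi N w : R := cutoff 0 A (eulerX b W h N 1 w 0) * (`|W h w| <= A)%R%:R.
have bpsi N : bmf (psi N).
  apply: bmfM; first exact: (bmf_eulerX1 BW K0 bK h0 N 0 (Cb_bmf (Cb_cutoff 0 A))).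
  by apply: bmf_le; exact: measurable_mx_norm.
have bsh N v : bmf (fun w => phi (SE N x (grid_pt A3 n v) w) * chi (W h w + grid_pt A3 n v)).
  exact: (bmf_shifted BW K0 bK h N x (grid_pt A3 n) (Cb_bmf cphi) bchi).
have low N : Ex P (psi N) <= cA * Ex P (fun w => phi (eulerX b W h N 1 w x)).
  apply: le_trans (cm N); rewrite -Ex_sum//.
  apply: Ex_le => //; first exact: bmf_sum.
  move=> w; rewrite /psi; have /andP[b0 b1] := cutoff_itv 0 A (eulerX b W h N 1 w 0).
  have s0 : 0 <= \sum_v phi (SE N x (grid_pt A3 n v) w) * chi (W h w + grid_pt A3 n v).
    by apply: sumr_ge0 => v _; rewrite mulr_ge0.
  case: (leP `|W h w| A) => WA; last by rewrite mulr0.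
  have [->|bn0] := eqVneq (cutoff 0 A (eulerX b W h N 1 w 0)) 0; first by rewrite mul0r.
  rewrite mulr1 (le_trans b1)//.
  have e0A : `|eulerX b W h N 1 w 0| <= 2 * A.
    by have := cutoff_neq0 A0 bn0; rewrite subr0 => /ltW; rewrite mulr_natl.
  have exB : `|eulerX b W h N 1 w x| <= B1.
    rewrite -(subrK (eulerX b W h N 1 w 0) (eulerX b W h N 1 w x)).
    rewrite (le_trans (ler_normD _ _))// addrC /B1 lerD//.
    have := eulerX_lip W K0 bK N 1 w x 0 h0; rewrite mul1r subr0 => hh.
    by rewrite (le_trans hh)// ler_wpM2l// expR_ge0.
  have iso := shifted_euler_near_isometry W K0 bK h0 hsmall N x w.
  have [|a aA Sa] := near_isometry_approx iso z (e := r / 4).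
    by rewrite divr_gt0.
  have {}aA : `|a| <= A3.
    rewrite (le_trans aA)// shifted_euler0 (le_trans _ (_ : 2 * (Z0 + B1) <= A3))//.
      by rewrite ler_wpM2l// (le_trans (ler_normB _ _))// lerD.
    by rewrite /A3 lerDl.
  have [v hv] := grid_approx A30 (ltn0Sn _ : (0 < n)%N) aA.
  rewrite (bigD1 v)//= -[leLHS]addr0 lerD//; last first.
    by apply: sumr_ge0 => v' _; rewrite mulr_ge0.
  rewrite /chi (_ : _ <= M0); last first.
    by rewrite (le_trans (ler_normD _ _))// lerD//; exact/grid_pt_norm_le/ltW.
  rewrite mulr1; apply: phi1.
  rewrite -(subrK (SE N x a w) (SE N x (grid_pt A3 n v) w)) -addrA.
  rewrite (le_trans (ler_normD _ _))//.
  have := near_isometry_le iso (grid_pt A3 n v) a; rewrite -/(SE _ _ _ _).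
  rewrite /SE; move: Sa hv A3n; lra.
have [bpsi_ psi_cvg] : bmf (fun w => cutoff 0 A (X 0 h w) * (`|W h w| <= A)%R%:R) /\
  (fun N => Ex P (psi N)) @ \oo -->
    Ex P (fun w => cutoff 0 A (X 0 h w) * (`|W h w| <= A)%R%:R).
  apply: (Ex_dct P (F := psi) (c := 1)).
  - by move=> N; case: (bpsi N).
  - move=> N w; rewrite /psi; have /andP[b0 b1] := cutoff_itv 0 A (eulerX b W h N 1 w 0).
    by case: (_ <= A); rewrite /= ?mulr1 ?mulr0 ?normr0// ger0_norm.
  - move=> w; rewrite /psi; apply: cvgM; last exact: cvg_cst.
    apply: (@cvg_comp _ _ _ (fun N => eulerX b W h N 1 w 0) (cutoff 0 A)); last exact: (Cb_cutoff 0 A).1.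
    by have := @eulerX_cvg _ _ _ _ _ _ _ _ BW solX K K0 bK 0 w h 1 h0; rewrite mul1r.
have half : 2^-1 <= Ex P (fun w => cutoff 0 A (X 0 h w) * (`|W h w| <= A)%R%:R).
  have := hA; rewrite (_ : 1 - 2^-1 = 2^-1); last by lra.
  move=> h1; apply: (le_trans h1); apply: Ex_le => //.
    by apply: bmf_le; apply: measurable_funD; exact: measurable_mx_norm.
  move=> w; have /andP[b0 b1] := cutoff_itv 0 A (X 0 h w).
  have n1' := normr_ge0 (X 0 h w); have n2' := normr_ge0 (W h w).
  case: (leP (`|X 0 h w| + `|W h w|) A) => VA; last by rewrite mulr_ge0.
  by rewrite cutoff_eq1 ?subr0//; [rewrite (_ : _ <= A) ?mulr1//; lra|lra].
have lim : 2^-1 <= cA * Qt P X h phi x.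
  rewrite (le_trans half)// -subr_le0.
  apply: (cvg_le_cst (cvgB psi_cvg (cvgM (cvg_cst cA) (@Qt_cvg phi x cphi)))) => N /=.
  by rewrite subr_le0; exact: low.
have Q0 : 0 <= Qt P X h phi x by exact: Ex_ge0.
have cr : (n.*2.+1 ^ d)%:R * r ^+ d <= (4 * A3 + 3) ^+ d.
  by rewrite natrX -exprMn lerXn2r ?nnegrE//; [rewrite mulr_ge0// ltW|lra].
have p0 : 0 < (4 * A3 + 3) ^+ d by rewrite exprn_gt0//; lra.
rewrite mulrAC ler_pdivrMr// invfM.
rewrite [leRHS]mulrC; apply: le_trans (ler_wpM2r Q0 cr).
rewrite -[leRHS]mulrA [leRHS]mulrCA mulrC; apply: ler_wpM2l; first by rewrite exprn_ge0// ltW.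
by rewrite ler_pdivrMr// mulrAC.
Qed.

End small_step_bounds.

Lemma grid_pt_separated {R : realType} {d : nat} n (v v' : {ffun 'I_d -> 'I_n.*2.+1}) :
  (0 < n)%N -> `|grid_pt 1 n v - grid_pt 1 n v'| < n%:R^-1 :> R -> v = v'.
Proof.
move=> n0 hv; have nR0 : 0 < n%:R :> R by rewrite ltr0n.
apply/ffunP => j; apply/val_inj/eqP => /=.
have hd : `|(v j)%:R - (v' j)%:R| < 1 :> R.
  have := le_lt_trans (coord_le_norm (grid_pt 1 n v - grid_pt 1 n v') ord0 j) hv.
  rewrite !mxE (_ : _ - _ = n%:R^-1 * ((v j)%:R - (v' j)%:R)); last by ring.
  by rewrite normrM gtr0_norm ?invr_gt0// gtr_pMr// invr_gt0.
have := hd; rewrite ltr_norml => /andP[h1 h2].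
have {}h1 : (v' j < (v j).+1)%N by rewrite -(ltr_nat R) -natr1; lra.
have {}h2 : (v j < (v' j).+1)%N by rewrite -(ltr_nat R) -natr1; lra.
by rewrite eqn_leq -ltnS h2 -ltnS h1.
Qed.

(** * Mixing *)

Section mixing.
Context {dO : measure_display} {Omega : measurableType dO} {R : realType} {d : nat}.
Variables (P : probability Omega R).
Variables (b : 'rV[R]_d -> 'rV[R]_d) (W : R -> Omega -> 'rV[R]_d).
Variable X : 'rV[R]_d -> R -> Omega -> 'rV[R]_d.
Hypothesis BW : std_brownian P W.
Hypothesis solX : sde_solution b W X.
Variable K : R.
Hypotheses (K0 : 0 <= K) (bK : forall x y, `|b x - b y| <= K * `|x - y|).
Variable mu : probability (Rd R d) R.
Hypothesis inv : invariant_measure P X mu.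

Lemma bmf_X2 t g : 0 <= t -> Cb g ->
  bmf (fun p : Omega * Rd R d => g (X p.2 t p.1)).
Proof.
by move=> t0 cg; apply: (bmf_X BW solX K0 bK t0 cg measurable_fst measurable_snd).
Qed.

Lemma Ex_stationary t g : 0 <= t -> bmf (g : Rd R d -> R) ->
  Ex (P \x mu)%E (fun p => g (X p.2 t p.1)) = Ex mu g.
Proof.
move=> t0 bg; apply/esym.
apply: (@Ex_pushforward _ _ _ _ _ (P \x mu)%E (fun p : Omega * Rd R d => X p.2 t p.1 : Rd R d)) => //.
- exact: (measurable_X BW solX K0 bK t0 measurable_fst measurable_snd).
- by case: bg.
- move=> A mA; apply: (etrans (esym (inv t0 mA))); congr ((P \x mu)%E _).
  by apply/seteqP; split => p /=; rewrite inE.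
Qed.

Lemma Ex_Qt t g : 0 <= t -> Cb g -> Ex mu (Qt P X t g) = Ex mu g.
Proof.
move=> t0 cg; rewrite -(@Ex_stationary t g t0 (Cb_bmf cg)).
by rewrite Ex_fubini2//; exact: bmf_X2.
Qed.

Variable h : R.
Hypotheses (h0 : 0 < h) (hsmall : K * h * expR (K * h) <= 2^-1).

Local Notation Q := (Qt P X h).

(** Variance of [g] under the transition law from [x]. *)
Let QV (g : 'rV[R]_d -> R) x := Q (fun y => g y ^+ 2) x - Q g x ^+ 2.

Let CbX2 (g : 'rV[R]_d -> R) : Cb g -> Cb (fun y => g y ^+ 2).
Proof. by move=> cg; exact: (CbM cg cg). Qed.

Let QVE g x : Cb g -> QV g x = Ex P (fun w => (g (X x h w) - Q g x) ^+ 2).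
Proof.
move=> cg; have h0' := ltW h0; have bg := bmf_X1 BW solX K0 bK x h0' cg.
have bg2 := bmf_X1 BW solX K0 bK x h0' (CbX2 cg).
rewrite [in RHS](_ : (fun w => _) = (fun w => g (X x h w) ^+ 2 - (2 * Q g x * g (X x h w) - Q g x ^+ 2))); last first.
  by apply/funext => w; ring.
have b1 : bmf (fun w => 2 * Q g x * g (X x h w)) by apply: bmfM => //; exact: bmf_cst.
rewrite ExB//; last by apply: bmfB => //; exact: bmf_cst.
rewrite ExB//; last exact: bmf_cst.
rewrite ExZ// Ex_cst /QV /Qt; ring.
Qed.

Let QV_ge0 g x : Cb g -> 0 <= QV g x.
Proof. by move=> cg; rewrite QVE//; apply: Ex_ge0 => w; exact: sqr_ge0. Qed.

(* On the unit ball the laws of [X x h] and [X y h] have a common part of mass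
   bounded below, so that distinct means of [g] force a positive variance.  The
   common part is charged by disjoint small balls, on which [g] hardly varies. *)
Let overlap D : 0 <= D -> exists2 C : R, 0 <= C & forall g x y, Cb g ->
  (forall z, 0 <= g z <= 1) -> `|x| <= D -> `|y| <= D ->
  (Q g x - Q g y) ^+ 2 <= C * (QV g x + QV g y).
Proof.
move=> D0; have [c c0 hc] := Qt_lower BW solX K0 bK h0 hsmall D0 ler01.
(* Lower bound for the common mass: [(2 n + 1) ^ d] cutoffs of radius [1 / (5 n)], each of mass at
   least [c / (5 n) ^ d]. *)
pose c1 := c / 5 ^+ d.
have c10 : 0 < c1 by rewrite divr_gt0// exprn_gt0.
exists (2 / c1); first by rewrite divr_ge0// ltW.
move=> g x y cg g01 xD yD; have h0' := ltW h0.
have Q01 z : 0 <= Q g z <= 1.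
  rewrite Ex_ge0//=; last by move=> w; case/andP: (g01 (X z h w)).
  apply: Ex_le_cst; first exact: (bmf_X1 BW solX K0 bK).
  by move=> w; case/andP: (g01 (X z h w)).
suff main e : 0 < e -> c1 * ((Q g x - Q g y) ^+ 2 / 2 - e) <= QV g x + QV g y.
  rewrite mulrAC ler_pdivlMr//.
  apply/ler_addgt0Pr => e e0.
  have := main (e / (2 * c1)); rewrite divr_gt0 ?mulr_gt0// => /(_ isT).
  rewrite mulrBr (_ : c1 * (e / (2 * c1)) = e / 2); last by field; rewrite gt_eqF.
  lra.
move=> e0.
have e80 : 0 < e / 4 by rewrite divr_gt0.
have cB : compact (closed_ball_ (fun z : 'rV[R]_d => `|z|) 0 2).
  apply: bounded_closed_compact.
    exists 2; split; [exact: num_real|move=> M M2 z /=].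
    by rewrite /closed_ball_ /= sub0r normrN => hz; rewrite (le_trans hz)// ltW.
  exact: closed_closed_ball_.
have [r r0 hr] := heine_cantor cB (continuous_subspaceT cg.1) e80.
have [n' hn'] := natSinv_lt r0.
pose n := n'.+1; have nR0 : 0 < n%:R :> R by rewrite ltr0n.
have nV1 : n%:R^-1 <= 1 :> R by rewrite invf_le1// ler1n.
have nV0 : 0 < n%:R^-1 :> R by rewrite invr_gt0.
(* The cutoffs live on radius [2 rho], less than half the spacing [1 / n] of their centers, so their
   supports are disjoint. *)
pose rho : R := n%:R^-1 / 5.
have rho0 : 0 < rho by rewrite divr_gt0.
have rho1 : 0 < rho <= 1 by rewrite rho0 /=; rewrite /rho; lra.
pose z v := grid_pt 1 n v : 'rV[R]_d.
have z1 v : `|z v| <= 1 by exact: grid_pt_norm_le.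
pose ph v := cutoff (z v) rho.
have ph_near v y' : ph v y' != 0 -> `|y' - z v| < 2 * n%:R^-1 / 5.
  by move=> /(cutoff_neq0 rho0); rewrite /rho -[_ *+ 2]mulr_natl mulrA.
have ph_sum y' : \sum_v ph v y' <= 1.
  have [[v hv]|hv] := pselect (exists v, ph v y' != 0).
    rewrite (bigD1 v)//= big1 ?addr0; first by case/andP: (cutoff_itv (z v) rho y').
    move=> v' vv'; apply/eqP; apply: contraNT vv' => hv'; apply/eqP.
    apply: (grid_pt_separated (R := R)) => //.
    have e1 := ph_near _ _ hv; have e2 := ph_near _ _ hv'.
    have := ler_normD (- (y' - z v')) (y' - z v).
    by rewrite normrN opprB addrA subrK -/(z v) -/(z v'); lra.
  rewrite big1 ?ler01// => v _; apply/eqP/negPn/negP => ?; apply: hv; by exists v.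
have one x' : `|x'| <= D ->
    \sum_v c * rho ^+ d * ((g (z v) - Q g x') ^+ 2 - e / 2) <= QV g x'.
  move=> xD'; have /andP[m0 m1] := Q01 x'; set m := Q g x' in m0 m1 *.
  rewrite QVE// -/m.
  have bph v := bmf_X1 BW solX K0 bK x' h0' (Cb_cutoff (z v) rho).
  have bg := bmf_X1 BW solX K0 bK x' h0' cg.
  have bgm : bmf (fun w => (g (X x' h w) - m) ^+ 2).
    by apply: bmfX; apply: bmfB => //; exact: bmf_cst.
  (* Truncated at 0, since a lower bound on the masses can only be multiplied by nonnegative
     numbers. *)
  pose q v := Num.max 0 ((g (z v) - m) ^+ 2 - e / 2).
  have q0 v : 0 <= q v by rewrite le_max lexx.
  apply: (@le_trans _ _ (Ex P (fun w => \sum_v q v * ph v (X x' h w)))).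
    rewrite Ex_sum; last by move=> v; apply: bmfM; [exact: bmf_cst|exact: bph].
    apply: ler_sum => v _; rewrite ExZ; last exact: bph.
    rewrite mulrC (@le_trans _ _ (q v * (c * rho ^+ d)))//.
      by rewrite ler_wpM2r ?mulr_ge0 ?exprn_ge0 ?(ltW c0) ?(ltW rho0)// le_max lexx orbT.
    rewrite ler_wpM2l//; apply: (hc x' (z v) rho (ph v)) => //.
    - exact: Cb_cutoff.
    - by move=> y'; case/andP: (cutoff_itv (z v) rho y').
    - by move=> y' hy'; rewrite /ph cutoff_eq1.
  apply: Ex_le => //.
    by apply: bmf_sum => v; apply: bmfM; [exact: bmf_cst|exact: bph].
  move=> w; set y' := X x' h w.
  apply: (@le_trans _ _ (\sum_v (g y' - m) ^+ 2 * ph v y')); last first.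
    by rewrite -mulr_sumr ler_piMr ?sqr_ge0.
  apply: ler_sum => v _; have /andP[p0 p1] := cutoff_itv (z v) rho y'.
  have [->|pn0] := eqVneq (ph v y') 0; first by rewrite !mulr0.
  rewrite ler_wpM2r//.
  have yz := ph_near _ _ pn0.
  have gyz : `|g y' - g (z v)| < e / 4.
    apply: hr.
    - rewrite /closed_ball_ /= sub0r normrN -(subrK (z v) y').
      by rewrite (le_trans (ler_normD _ _))//; have := z1 v; lra.
    - by rewrite /closed_ball_ /= sub0r normrN (le_trans (z1 v))// ler1n.
    - by rewrite -ball_normE /= (lt_trans yz)// (lt_trans _ hn')// -/n; lra.
  rewrite ge_max sqr_ge0 /=.
  have /andP[a0 a1] := g01 y'; have /andP[b0 b1] := g01 (z v).
  (* Values in [[0, 1]] within [e / 4] of each other have squared distances to [m] within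
     [e / 2]. *)
  move: gyz; rewrite ltr_norml => /andP[k1 k2]; nra.
have := lerD (one x xD) (one y yD); rewrite -big_split /= => sxy.
have sum_ge : \sum_(v : {ffun 'I_d -> 'I_n.*2.+1}) c * rho ^+ d * ((Q g x - Q g y) ^+ 2 / 2 - e) <=
    QV g x + QV g y.
  apply: le_trans sxy; apply: ler_sum => v _.
  rewrite -mulrDr; apply: ler_wpM2l.
    by rewrite mulr_ge0 ?exprn_ge0 ?(ltW c0) ?(ltW rho0).
  (* With [s] and [t] the distances of [g (z v)] to the two means,
     [(s - t) ^ 2 / 2 <= s ^ 2 + t ^ 2]. *)
  by have := sqr_ge0 (g (z v) - Q g x + (g (z v) - Q g y)); nra.
rewrite sumr_const card_grid in sum_ge.
have [neg|pos] := leP ((Q g x - Q g y) ^+ 2 / 2 - e) 0.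
  apply: (@le_trans _ _ 0); first by rewrite pmulr_rle0.
  by apply: addr_ge0; exact: QV_ge0.
apply: le_trans sum_ge; rewrite -[leRHS]mulr_natl mulrA ler_pM2r//.
rewrite mulrCA /c1; apply: ler_wpM2l; first exact: ltW.
rewrite natrX -exprMn -exprVn lerXn2r ?nnegrE ?mulr_ge0 ?invr_ge0 ?(ltW rho0)//.
rewrite /rho mulrA ler_peMl ?invr_ge0// ler_pdivlMr// mul1r ler_nat.
by rewrite -addnn leqW// leq_addr.
Qed.

(* The numbers [a k = Ex mu (gk k ^ 2)] decrease in [[0, 1]], so one of the first
   [N] decrements [Ex mu (QV (gk k))] is at most [1 / N]; by [overlap], [gk k.+1]
   is then nearly constant up to a set of small measure. *)
Lemma mixing e : 0 < e -> exists N : nat, forall g, Cb g -> (forall y, 0 <= g y <= 1) ->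
  Ex mu (fun x => (iter N Q g x - Ex mu g) ^+ 2) <= e.
Proof.
move=> e0; have h0' := ltW h0.
have [|D D0 hD] := @tight _ _ _ mu (fun x : Rd R d => `|(x : 'rV[R]_d)|) (e / 4) _ ltac:(by rewrite divr_gt0).
  exact: (@measurable_mx_norm _ _ _ (Rd R d) id).
pose I (x : Rd R d) : R := (`|(x : 'rV[R]_d)| <= D)%R%:R.
have bI : bmf I.
  apply: (@bmf_le _ (Rd R d) R (fun y => `|(y : 'rV[R]_d)|)).
  exact: (@measurable_mx_norm _ _ _ (Rd R d) id).
have I01 x : 0 <= I x <= 1 by rewrite /I; case: (_ <= D); rewrite /= ?lexx ?ler01.
have [C C0 hC] := overlap (ltW D0).
pose N := (Num.truncn (4 * C / e)).+1.
have N0 : 0 < N%:R :> R by rewrite ltr0n.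
have CN : C / N%:R <= e / 4.
  have t0 : 0 <= 4 * C / e by rewrite divr_ge0 ?mulr_ge0 ?(ltW e0).
  have /andP[_ hN] := truncn_itv t0.
  rewrite -/N ltr_pdivrMr// in hN.
  by rewrite ler_pdivrMr//; nra.
exists N => g cg g01; set m := Ex mu g.
pose gk k := iter k Q g.
have cgk k : Cb (gk k) by exact: (iter_Qt_Cb BW solX K0 bK).
have gk01 k x : 0 <= gk k x <= 1.
  elim: k x => [|k IH] x //=; rewrite Ex_ge0 //=; last by move=> w; case/andP: (IH (X x h w)).
  apply: Ex_le_cst; first exact: (bmf_X1 BW solX K0 bK).
  by move=> w; case/andP: (IH (X x h w)).
have mgk k : Ex mu (gk k) = m.
  by elim: k => //= k IH; rewrite Ex_Qt.
pose a k := Ex mu (fun x => gk k x ^+ 2).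
have bgk k : bmf (gk k : Rd R d -> R) := Cb_bmf (cgk k).
have bQV k : bmf (QV (gk k) : Rd R d -> R).
  apply: bmfB; first by apply: Cb_bmf; apply: (Qt_Cb BW solX K0 bK) => //; exact: CbX2.
  by apply: bmfX; exact: (bgk k.+1).
have aQV k : a k - a k.+1 = Ex mu (QV (gk k)).
  rewrite /QV ExB//; [|by apply: Cb_bmf; apply: (Qt_Cb BW solX K0 bK) => //; exact: CbX2|by apply: bmfX; exact: (bgk k.+1)].
  by rewrite Ex_Qt//; exact: CbX2.
have [k kN hk] : exists2 k, (k < N)%N & a k - a k.+1 <= N%:R^-1.
  apply/not_notP => hno.
  have : N%:R * N%:R^-1 < \sum_(k < N) (a k - a k.+1).
    rewrite mulr_natl -[X in _ *+ X]card_ord -sumr_const.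
    apply: ltr_sum; first by apply/hasP; exists ord0; rewrite // mem_index_enum.
    by move=> i _; rewrite ltNge; apply/negP => hi; apply: hno; exists i.
  rewrite divff ?gt_eqF//.
  have -> : \sum_(k < N) (a k - a k.+1) = a 0%N - a N.
    rewrite -[RHS]opprB -(telescope_sumr a (leq0n N)) big_mkord -sumrN.
    by apply: eq_bigr => i _; rewrite opprB.
  rewrite ltNge (@le_trans _ _ (a 0%N))//; first by rewrite gerBl Ex_ge0// => x; exact: sqr_ge0.
  apply: Ex_le_cst; first exact: bmfX.
  by move=> x; have /andP[? ?] := g01 x; rewrite exprn_ile1.
have bgm j c : bmf (fun x : Rd R d => (gk j x - c) ^+ 2).
  by apply: bmfX; apply: bmfB => //; exact: bmf_cst.
(* By Jensen the variance does not increase with [j], so a bound found at some index up to [N] holds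
   at [N]. *)
have varD j : Ex mu (fun x => (gk j.+1 x - m) ^+ 2) <= Ex mu (fun x => (gk j x - m) ^+ 2).
  have cgm : Cb (fun x => (gk j x - m) ^+ 2).
    by apply: CbX2; apply: CbD => //; exact: Cb_cst.
  rewrite -(Ex_Qt h0' cgm); apply: Ex_le => //; first exact/Cb_bmf/(Qt_Cb BW solX K0 bK).
  move=> x; have bx := bmf_X1 BW solX K0 bK x h0' (cgk j).
  have := Ex_sqr_le P (bmfB bx (bmf_cst _ m)).
  by rewrite ExB//; [rewrite Ex_cst|exact: bmf_cst].
(* Off the ball of radius [D] the trivial bound 1 is paid by [1 - I]. *)
have pw x y : (gk k.+1 x - gk k.+1 y) ^+ 2 <= C * (QV (gk k) x + QV (gk k) y) + (1 - I x) + (1 - I y).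
  have /andP[x0 x1] := gk01 k.+1 x; have /andP[y0 y1] := gk01 k.+1 y.
  have Vx := QV_ge0 x (cgk k); have Vy := QV_ge0 y (cgk k).
  have CV : 0 <= C * (QV (gk k) x + QV (gk k) y) by rewrite mulr_ge0// addr_ge0.
  have s1 : (gk k.+1 x - gk k.+1 y) ^+ 2 <= 1 by nra.
  have I1 z : `|z| <= D -> I z = 1 by rewrite /I => ->.
  have I0 z : D < `|z| -> I z = 0 by rewrite /I ltNge => /negbTE ->.
  have /andP[_ Ix1] := I01 x; have /andP[_ Iy1] := I01 y.
  have [xD|/I0 ->] := leP `|x| D; last by lra.
  have [yD|/I0 ->] := leP `|y| D; last by lra.
  by rewrite !I1// !subrr !addr0; exact: (hC (gk k) x y (cgk k) (gk01 k) xD yD).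
have IE : Ex mu (fun x => 1 - I x) <= e / 4.
  have hD' : 1 - e / 4 <= Ex mu I := hD.
  by rewrite ExB//; [rewrite Ex_cst; lra|exact: bmf_cst].
have VE : C * Ex mu (QV (gk k)) <= e / 4.
  by rewrite -aQV (le_trans _ CN)// ler_wpM2l.
have bCV : bmf (fun x : Rd R d => C * QV (gk k) x) by apply: bmfM => //; exact: bmf_cst.
have b1I : bmf (fun x : Rd R d => 1 - I x) by apply: bmfB => //; exact: bmf_cst.
(* The mean square deviation is least around the mean, so [m] may be replaced by the value at [y].
   The terms of [pw] in [x] integrate to at most [e / 2], and those in [y] will do the same. *)
have var1 y : Ex mu (fun x => (gk k.+1 x - m) ^+ 2) <= C * QV (gk k) y + (1 - I y) + e / 2.
  have vy : Ex mu (fun x => (gk k.+1 x - m) ^+ 2) <= Ex mu (fun x => (gk k.+1 x - gk k.+1 y) ^+ 2).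
    set c := gk k.+1 y.
    rewrite -subr_ge0 -ExB//.
    rewrite (_ : (fun x => _) = (fun x => (m - c) * (2 * gk k.+1 x) - (m - c) * (m + c))); last first.
      by apply/funext => x; ring.
    have b2 : bmf (fun x : Rd R d => 2 * gk k.+1 x) by apply: bmfM => //; exact: bmf_cst.
    rewrite ExB; [|by apply: bmfM => //; exact: bmf_cst|exact: bmf_cst].
    rewrite ExZ// ExZ// mgk Ex_cst.
    by have := sqr_ge0 (m - c); rewrite expr2; lra.
  apply: (le_trans vy).
  apply: (@le_trans _ _ (Ex mu (fun x => (C * QV (gk k) x + (1 - I x)) + (C * QV (gk k) y + (1 - I y))))).
    apply: Ex_le => //; first by apply: bmfD; [exact: bmfD|exact: bmf_cst].
    by move=> x; have := pw x y; lra.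
  rewrite ExD; [|exact: bmfD|exact: bmf_cst].
  by rewrite ExD// ExZ// Ex_cst; lra.
have var_le : Ex mu (fun x => (gk k.+1 x - m) ^+ 2) <= e.
  rewrite -[leLHS](Ex_cst mu).
  apply: (@le_trans _ _ (Ex mu (fun y => (C * QV (gk k) y + (1 - I y)) + e / 2))).
    apply: Ex_le => //; [exact: bmf_cst|by apply: bmfD; [exact: bmfD|exact: bmf_cst]].
  rewrite ExD; [|exact: bmfD|exact: bmf_cst].
  by rewrite ExD// ExZ// Ex_cst; lra.
apply: le_trans var_le; rewrite -/(gk N) -(subnKC kN).
elim: (N - k.+1)%N => [|j IH]; first by rewrite addn0.
by rewrite addnS; exact: le_trans (varD _) IH.
Qed.

End mixing.

(** * Steps of arbitrary length *)

Section any_step.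
Context {dO : measure_display} {Omega : measurableType dO} {R : realType} {d : nat}.
Variables (P : probability Omega R).
Variables (b : 'rV[R]_d -> 'rV[R]_d) (W : R -> Omega -> 'rV[R]_d).
Variable X : 'rV[R]_d -> R -> Omega -> 'rV[R]_d.
Hypothesis BW : std_brownian P W.
Hypothesis solX : sde_solution b W X.
Variable K : R.
Hypotheses (K0 : 0 <= K) (bK : forall x y, `|b x - b y| <= K * `|x - y|).
Variable mu : probability (Rd R d) R.
Hypothesis inv : invariant_measure P X mu.
Variable h : R.
Hypothesis h0 : 0 < h.

Local Notation Q := (Qt P X).

Lemma small_step_exists : exists q : nat,
  [/\ 0 < h / q.+1%:R & K * (h / q.+1%:R) * expR (K * (h / q.+1%:R)) <= 2^-1].
Proof.
pose C := 2 * (K * h * expR (K * h)).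
have C0 : 0 <= C by rewrite mulr_ge0// mulr_ge0 ?expR_ge0// mulr_ge0// ltW.
have /andP[_ k2] := truncn_itv C0.
exists (Num.truncn C); set q := (Num.truncn C).+1 in k2 *.
have q0 : 0 < q%:R :> R by rewrite ltr0n.
split; first by rewrite divr_gt0.
apply: (@le_trans _ _ (K * h * expR (K * h) / q%:R)).
  rewrite (_ : K * (h / q%:R) = K * h / q%:R); last by ring.
  rewrite mulrAC; apply: ler_wpM2r; first by rewrite invr_ge0 ltW.
  apply: ler_wpM2l; first by rewrite mulr_ge0// ltW.
  rewrite ler_expR ler_piMr ?invf_le1 ?ler1n//.
  by rewrite mulr_ge0// ltW.
by rewrite ler_pdivrMr//; move: k2; rewrite /C; lra.
Qed.

Lemma iter_Qt_itv t (t0 : 0 <= t) n g k x : Cb g -> (forall y, 0 <= g y <= k) ->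
  0 <= iter n (Q t) g x <= k.
Proof.
move=> cg g0; elim: n x => //= n IH x; rewrite Ex_ge0/=; last by move=> w; case/andP: (IH (X x t w)).
apply: Ex_le_cst; last by move=> w; case/andP: (IH (X x t w)).
by apply: (bmf_X1 BW solX K0 bK) => //; exact: (iter_Qt_Cb BW solX K0 bK).
Qed.

Lemma Ex_iter_Qt t n g : 0 <= t -> Cb g -> Ex mu (iter n (Q t) g) = Ex mu g.
Proof.
move=> t0 cg; elim: n => //= n IH; rewrite -IH.
by apply: (Ex_Qt BW solX K0 bK inv) => //; exact: (iter_Qt_Cb BW solX K0 bK).
Qed.

(** The bound holds after one short step, and the remaining steps are averages, which preserve
    it. *)
Lemma Qt_upper_any : exists2 C : R, 0 < C & forall phi x z r, Cb phi ->
  (forall y, 0 <= phi y <= 1) -> (forall y, phi y != 0 -> `|y - z| <= r) ->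
  0 < r <= 1 -> Q h phi x <= C * r ^+ d.
Proof.
have [q [hq hsm]] := small_step_exists; set h' := h / q.+1%:R in hq hsm.
exists (expR (d%:R / (2 * h')) * 5 ^+ d); first by rewrite mulr_gt0 ?expR_gt0// exprn_gt0.
move=> phi x z r cphi phi01 supp r01.
have -> : h = q.+1%:R * h' by rewrite /h'; field; rewrite addrC natr1 gt_eqF.
rewrite (Qt_iter BW solX K0 bK _ _ hq cphi) iterSr.
have c1 : Cb (Q h' phi) by apply: (Qt_Cb BW solX K0 bK) => //; exact: ltW.
have := @iter_Qt_itv h' (ltW hq) q (Q h' phi) (expR (d%:R / (2 * h')) * 5 ^+ d * r ^+ d) x c1.
case/(_ _)/andP => // y; rewrite (Qt_upper BW solX K0 bK hq hsm _ cphi phi01 supp r01) andbT.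
by apply: Ex_ge0 => w; case/andP: (phi01 (X y h' w)).
Qed.

(** By invariance [phi] may be replaced by its image under a short step, and [mu] gives mass at
    least 1/2 to some ball of starting points. *)
Lemma mu_lower z : exists2 c : R, 0 < c & forall phi r, Cb phi ->
  (forall y, 0 <= phi y) -> (forall y, `|y - z| <= r -> 1 <= phi y) ->
  0 < r <= 1 -> c * r ^+ d <= Ex mu phi.
Proof.
have [q [hq hsm]] := small_step_exists; set h' := h / q.+1%:R in hq hsm.
have [|D D0 hD] := @tight _ _ _ mu (fun x : Rd R d => `|(x : 'rV[R]_d)|) (2^-1) _ ltac:(by rewrite invr_gt0).
  exact: (@measurable_mx_norm _ _ _ (Rd R d) id).
have [c c0 hc] := Qt_lower BW solX K0 bK hq hsm (ltW D0) (normr_ge0 z).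
exists (c / 2); first by rewrite divr_gt0.
move=> phi r cphi phi0 phi1 r01; have hq' := ltW hq.
rewrite -(Ex_Qt BW solX K0 bK inv hq' cphi).
pose I (x : Rd R d) : R := (`|(x : 'rV[R]_d)| <= D)%R%:R.
have bI : bmf I.
  apply: (@bmf_le _ (Rd R d) R (fun y => `|(y : 'rV[R]_d)|)).
  exact: (@measurable_mx_norm _ _ _ (Rd R d) id).
have r0 : 0 < r by case/andP: r01.
have crd : 0 <= c * r ^+ d by rewrite mulr_ge0 ?exprn_ge0 ?(ltW c0) ?(ltW r0).
apply: (@le_trans _ _ (Ex mu (fun x => c * r ^+ d * I x))).
  rewrite ExZ// mulrAC ler_wpM2l//.
  by have hD' : 1 - 2^-1 <= Ex mu I := hD; lra.
apply: Ex_le; first by apply: bmfM => //; exact: bmf_cst.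
  by apply: Cb_bmf; exact: (Qt_Cb BW solX K0 bK).
move=> x; rewrite /I; case: (leP `|x| D) => xD.
  by rewrite mulr1; apply: hc.
by rewrite mulr0; apply: Ex_ge0.
Qed.

Lemma iter_Qt_scale t n g c : 0 <= t -> Cb g ->
  iter n (Q t) (fun y => c * g y) = (fun x => c * iter n (Q t) g x).
Proof.
move=> t0 cg; elim: n => //= n ->; apply/funext => x; rewrite /Qt ExZ//.
by apply: (bmf_X1 BW solX K0 bK) => //; exact: (iter_Qt_Cb BW solX K0 bK).
Qed.

(** Rescaling makes the error proportional to the bound [k]. The mean square estimate is taken at
    accuracy [e ^ 2], and Cauchy-Schwarz converts it to a mean. *)
Lemma mixing_any e : 0 < e -> exists N : nat, forall g k, Cb g -> 0 < k ->
  (forall y, 0 <= g y <= k) ->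
  Ex mu (fun x => `|iter N (Q h) g x - Ex mu g|) <= k * e.
Proof.
move=> e0; have [q [hq hsm]] := small_step_exists; set h' := h / q.+1%:R in hq hsm.
have hE : h = q.+1%:R * h' by rewrite /h'; field; rewrite addrC natr1 gt_eqF.
have [N hN] := mixing BW solX K0 bK inv hq hsm (exprn_gt0 2 e0).
have hq' := ltW hq; have h0' := ltW h0.
exists N => g k cg k0 g0k.
have iterE n : iter n (Q h) g = iter (n * q.+1) (Q h') g.
  elim: n => //= n ->; apply/funext => x.
  rewrite {1}hE (Qt_iter BW solX K0 bK) //; last exact: (iter_Qt_Cb BW solX K0 bK).
  by rewrite -iterD.
(* The [N] steps of length [h] are [N (q + 1)] steps of length [h']: [N q] of them are absorbed into
   the function and [N] are left for mixing. *)
pose g1 := iter (N * q) (Q h') g.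
have cg1 : Cb g1 by exact: (iter_Qt_Cb BW solX K0 bK).
pose g2 y := k^-1 * g1 y.
have cg2 : Cb g2 by apply: CbM => //; exact: Cb_cst.
have g201 y : 0 <= g2 y <= 1.
  have /andP[a0 a1] := iter_Qt_itv hq' (N * q) y cg g0k.
  by rewrite /g2 mulr_ge0 ?invr_ge0 ?(ltW k0)//= mulrC ler_pdivrMr// mul1r.
have mg2 : Ex mu g2 = k^-1 * Ex mu g.
  by rewrite ExZ; [rewrite Ex_iter_Qt|exact: Cb_bmf].
have E2 : iter N (Q h) g = fun x => k * iter N (Q h') g2 x.
  rewrite iterE mulnS iterD -/g1 -iter_Qt_scale//; congr iter.
  by apply/funext => y; rewrite /g2 mulrA divff ?mul1r// gt_eqF.
have E3 : (fun x : Rd R d => `|iter N (Q h) g x - Ex mu g|) =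
    (fun x => k * `|iter N (Q h') g2 x - Ex mu g2|).
  apply/funext => x; rewrite E2 mg2 -{2}(gtr0_norm k0) -normrM; congr `|_|.
  by rewrite mulrBr mulrA divff ?mul1r// gt_eqF.
have bdev : bmf (fun x : Rd R d => `|iter N (Q h') g2 x - Ex mu g2|).
  apply: bmf_norm; apply: bmfB; last exact: bmf_cst.
  by apply: Cb_bmf; exact: (iter_Qt_Cb BW solX K0 bK).
rewrite E3 ExZ// ler_pM2l//.
rewrite -(@ler_pXn2r _ 2) ?nnegrE//; [|by apply: Ex_ge0|exact: ltW].
apply: (le_trans (Ex_sqr_le mu bdev)); apply: le_trans (hN g2 cg2 g201).
by under [X in Rintegral _ _ X <= _]eq_fun do rewrite real_normK ?num_real//.
Qed.

End any_step.

(** * Avoiding a small set *)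

Lemma combine_errors {R : realType} (U V al am m c k : R) :
  0 <= U - V <= c -> `|U - al * m| <= k -> 0 <= (al - am) * m <= c ->
  V - am * m <= c + k + c /\ - (c + k + c) <= V - am * m.
Proof.
by move=> /andP[? ?]; rewrite ler_norml mulrBl => /andP[? ?] /andP[? ?]; split; lra.
Qed.

Section avoidance_recursion.
Context {dO : measure_display} {Omega : measurableType dO} {R : realType} {d : nat}.
Variables (P : probability Omega R).
Variables (b : 'rV[R]_d -> 'rV[R]_d) (W : R -> Omega -> 'rV[R]_d).
Variable X : 'rV[R]_d -> R -> Omega -> 'rV[R]_d.
Hypothesis BW : std_brownian P W.
Hypothesis solX : sde_solution b W X.
Variable K : R.
Hypotheses (K0 : 0 <= K) (bK : forall x y, `|b x - b y| <= K * `|x - y|).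
Variable mu : probability (Rd R d) R.
Hypothesis inv : invariant_measure P X mu.
Variable h : R.
Hypothesis h0 : 0 < h.

Local Notation Q := (Qt P X h).
Local Notation E f := (Ex (P \x mu)%E f).

Definition skel (i : nat) (p : Omega * Rd R d) : 'rV[R]_d := X p.2 (i%:R * h) p.1.

Let ih0 i : 0 <= i%:R * h. Proof. by rewrite mulr_ge0// ltW. Qed.

Lemma bmf_skel i g : Cb g -> bmf (fun p => g (skel i p)).
Proof. by move=> cg; exact: (bmf_X2 BW solX K0 bK (ih0 i) cg). Qed.

Lemma Ex_skel i g : bmf (g : Rd R d -> R) -> E (fun p => g (skel i p)) = Ex mu g.
Proof. exact: (Ex_stationary BW solX K0 bK inv (ih0 i)). Qed.

Lemma markov_skel m q (f : nat -> 'rV[R]_d -> R) k : (forall i, Cb (f i)) -> Cb k ->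
  E (fun p => (\prod_(i < m.+1) f i (skel i p)) * k (skel (m + q) p)) =
  E (fun p => (\prod_(i < m.+1) f i (skel i p)) * iter q Q k (skel m p)).
Proof.
move=> cf ck.
have bp : bmf (fun p => \prod_(i < m.+1) f i (skel i p)).
  by apply: bmf_prod => i; exact: bmf_skel.
rewrite Ex_fubini2; last by apply: bmfM => //; exact: bmf_skel.
rewrite Ex_fubini2; last first.
  by apply: bmfM => //; apply: bmf_skel; apply: (iter_Qt_Cb BW solX K0 bK) => //; exact: ltW.
by congr Rintegral; apply/funext => x; exact: (markov_property BW solX K0 bK m q x h0 cf ck).
Qed.

Variables (phi : 'rV[R]_d -> R) (kappa theta e : R) (p : nat).
Hypotheses (cphi : Cb phi) (phi01 : forall y, 0 <= phi y <= 1).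
Hypotheses (kappa0 : 0 < kappa) (Qkappa : forall x, Q phi x <= kappa).
Hypothesis theta01 : 0 <= theta <= 1.
Hypothesis mix : Ex mu (fun x => `|iter p Q (Q phi) x - Ex mu (Q phi)|) <= kappa * e.

Let f y := 1 - theta * phi y.
Let H m w := \prod_(i < m) f (skel i w).
Let a m := E (H m).
Let mphi := Ex mu phi.

Let cf : Cb f.
Proof.
rewrite /f; apply: CbD; first exact: Cb_cst.
rewrite [X in Cb X](_ : _ = fun y => (- theta) * phi y); last by apply/funext => y; rewrite mulNr.
by apply: CbM => //; exact: Cb_cst.
Qed.

Let f01 y : 0 <= f y <= 1.
Proof. by have /andP[? ?] := phi01 y; case/andP: theta01 => ? ?; rewrite /f; nra. Qed.

Let bH m : bmf (H m).
Proof. by apply: bmf_prod => i; exact: bmf_skel. Qed.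

Let H01 m w : 0 <= H m w <= 1.
Proof.
rewrite /H; apply/andP; split; first by apply: prodr_ge0 => i _; case/andP: (f01 (skel i w)).
by apply: prodr_ile1 => i _; exact: f01.
Qed.

Let phi0 y : 0 <= phi y. Proof. by case/andP: (phi01 y). Qed.

Let h0' : 0 <= h := ltW h0.

Let cQphi : Cb (Q phi). Proof. exact: (Qt_Cb BW solX K0 bK). Qed.

Let Qphi_itv y : 0 <= Q phi y <= kappa.
Proof. by rewrite Qkappa andbT; apply: Ex_ge0. Qed.

Let mphi0 : 0 <= mphi. Proof. exact: Ex_ge0. Qed.

Let mphi_le : mphi <= kappa.
Proof.
rewrite /mphi -(Ex_Qt BW solX K0 bK inv h0' cphi); apply: Ex_le_cst => //.
exact: Cb_bmf.
Qed.

(** The last step before time [m] is a [Q phi], at most [kappa] from every state; a return thus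
    costs a factor [kappa] even after a single step. *)
Let corr i m : (i < m)%N -> E (fun w => phi (skel i w) * phi (skel m w)) <= kappa * mphi.
Proof.
move=> im; pose g j := if j == i then phi else fun=> 1.
have cg j : Cb (g j) by rewrite /g; case: ifP => // _; exact: Cb_cst.
have prodg w : \prod_(j < i.+1) g j (skel j w) = phi (skel i w).
  rewrite big_ord_recr /= /g eqxx big1 ?mul1r// => j _.
  by rewrite lt_eqF//; exact: ltn_ord.
have := @markov_skel i (m - i) g phi cg cphi.
rewrite subnKC ?(ltnW im)//.
under eq_fun do rewrite prodg.
move=> ->; under eq_fun do rewrite prodg.
have -> : (m - i = (m - i).-1.+1)%N by rewrite prednK// subn_gt0.
rewrite iterSr /mphi -(Ex_skel i (Cb_bmf cphi)) -ExZ; last exact: bmf_skel.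
have ck := iter_Qt_Cb BW solX K0 bK (m - i).-1 h0' cQphi.
apply: Ex_le.
- by apply: bmfM; exact: bmf_skel.
- by apply: bmfM; [exact: bmf_cst|exact: bmf_skel].
move=> w; rewrite mulrC ler_wpM2r//.
by case/andP: (iter_Qt_itv BW solX K0 bK h0' (m - i).-1 (skel i w) cQphi Qphi_itv).
Qed.

(** One more factor [1 - theta phi] lowers the product by at most [phi], since all quantities lie in
    [[0, 1]]. *)
Let H_diff l n w : 0 <= H l w - H (l + n) w <= \sum_(i < n) phi (skel (l + i) w).
Proof.
elim: n => [|n IH]; first by rewrite addn0 subrr big_ord0 lexx.
rewrite big_ord_recr /= addnS.
have HS : H (l + n).+1 w = H (l + n) w * f (skel (l + n) w).
  by rewrite /H big_ord_recr.
have /andP[a0 a1] := H01 (l + n) w; have /andP[f0 f1] := f01 (skel (l + n) w).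
have /andP[p0 p1] := phi01 (skel (l + n) w); case/andP: theta01 => t0 t1.
rewrite HS; move: IH => /andP[i1 i2].
have k1 : H (l + n) w * f (skel (l + n) w) <= H (l + n) w by rewrite ler_piMr.
have k2 : H (l + n) w - H (l + n) w * f (skel (l + n) w) <= phi (skel (l + n) w).
  rewrite /f (_ : _ - _ = H (l + n) w * theta * phi (skel (l + n) w)); last by ring.
  by rewrite ler_piMl// mulr_ile1.
lra.
Qed.

(* Dropping the last [p] factors of [H m] leaves time for the chain to mix, and
   costs at most [p] joint visits of probability [kappa ^ 2] each. *)
Let visit m : E (fun w => H m w * phi (skel m w)) - a m * mphi <=
    p%:R * kappa ^+ 2 + kappa * e + p%:R * kappa ^+ 2 /\
  - (p%:R * kappa ^+ 2 + kappa * e + p%:R * kappa ^+ 2) <=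
    E (fun w => H m w * phi (skel m w)) - a m * mphi.
Proof.
(* Truncated subtraction: for [m <= p] the product up to [l = 0] is empty, and stationarity alone
   decouples. *)
pose l := (m - p)%N; pose n := (m - l)%N.
have lm : (l <= m)%N by rewrite leq_subr.
have mE : m = (l + n)%N by rewrite /n subnKC.
have np : n%:R <= p%:R :> R by rewrite ler_nat /n /l leq_subLR addnC -leq_subLR.
have bHp j : bmf (fun w => H j w * phi (skel m w)) by apply: bmfM => //; exact: bmf_skel.
have step1 : 0 <= E (fun w => H l w * phi (skel m w)) - E (fun w => H m w * phi (skel m w)) <=
    p%:R * kappa ^+ 2.
  rewrite -ExB//; apply/andP; split.
    apply: Ex_ge0 => w; rewrite -mulrBl mulr_ge0// mE.
    by case/andP: (H_diff l n w).
  apply: (@le_trans _ _ (E (fun w => \sum_(i < n) phi (skel (l + i) w) * phi (skel m w)))).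
    apply: Ex_le; first exact: bmfB.
      by apply: bmf_sum => i; apply: bmfM; exact: bmf_skel.
    move=> w; rewrite -mulrBl -mulr_suml ler_wpM2r// {1}mE.
    by case/andP: (H_diff l n w).
  rewrite Ex_sum; last by move=> i; apply: bmfM; exact: bmf_skel.
  apply: (@le_trans _ _ (\sum_(i < n) kappa ^+ 2)).
    apply: ler_sum => i _; apply: (le_trans (corr _)).
      by rewrite mE ltn_add2l.
    by rewrite expr2 ler_wpM2l// ltW.
  rewrite sumr_const card_ord -[leLHS]mulr_natl ler_wpM2r// exprn_ge0// ltW//.
have step2 : `|E (fun w => H l w * phi (skel m w)) - a l * mphi| <= kappa * e.
  have e0 : 0 <= kappa * e by apply: le_trans mix; apply: Ex_ge0.
  have [l0|l1] := posnP l.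
    have HE : H l = fun=> 1 by apply/funext => w; rewrite /H l0 big_ord0.
    rewrite /a HE Ex_cst mul1r; under eq_fun do rewrite mul1r.
    by rewrite Ex_skel ?subrr ?normr0//; exact: Cb_bmf.
  have lE : l = l.-1.+1 by rewrite prednK.
  (* The last factor of [H l] is read at time [l - 1], so [p + 1] steps lead to [m]: one gives
     [Q phi], the other [p] are for mixing. *)
  have mp : m = (l.-1 + p.+1)%N by rewrite addnS -addSn -lE /l subnK// ltnW// -subn_gt0.
  have -> : E (fun w => H l w * phi (skel m w)) = E (fun w => H l w * iter p Q (Q phi) (skel l.-1 w)).
    have := @markov_skel l.-1 p.+1 (fun=> f) phi (fun=> cf) cphi.
    by rewrite -mp iterSr /H -lE.
  have ck := iter_Qt_Cb BW solX K0 bK p h0' cQphi.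
  have bk : bmf (fun w => iter p Q (Q phi) (skel l.-1 w)) by exact: bmf_skel.
  rewrite mulrC -ExZ// -ExB//; [|exact: bmfM|by apply: bmfM => //; exact: bmf_cst].
  have bd : bmf (fun w => iter p Q (Q phi) (skel l.-1 w) - mphi) by apply: bmfB => //; exact: bmf_cst.
  rewrite (_ : (fun w => _) = (fun w => H l w * (iter p Q (Q phi) (skel l.-1 w) - mphi))); last first.
    by apply/funext => w; rewrite mulrBr (mulrC mphi).
  apply: (le_trans (Ex_norm_le _ (bmfM (bH l) bd))).
  apply: le_trans mix; rewrite (Ex_Qt BW solX K0 bK inv h0' cphi) -/mphi.
  rewrite -(@Ex_skel l.-1 (fun x => `|iter p Q (Q phi) x - mphi|)); last first.
    by apply: bmf_norm; apply: bmfB; [exact: Cb_bmf|exact: bmf_cst].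
  apply: Ex_le; [by apply: bmf_norm; exact: bmfM|exact: bmf_norm|].
  move=> w; have /andP[a0 a1] := H01 l w.
  by rewrite normrM (ger0_norm a0) ler_piMl.
have step3 : 0 <= a l - a m <= p%:R * kappa.
  rewrite /a -ExB//; apply/andP; split.
    by apply: Ex_ge0 => w; rewrite mE; case/andP: (H_diff l n w).
  apply: (@le_trans _ _ (E (fun w => \sum_(i < n) phi (skel (l + i) w)))).
    apply: Ex_le; [exact: bmfB|by apply: bmf_sum => i; exact: bmf_skel|].
    by move=> w; rewrite {1}mE; case/andP: (H_diff l n w).
  rewrite Ex_sum; last by move=> i; exact: bmf_skel.
  apply: (@le_trans _ _ (\sum_(i < n) kappa)).
    by apply: ler_sum => i _; rewrite Ex_skel//; exact: Cb_bmf.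
  rewrite sumr_const card_ord -[leLHS]mulr_natl ler_wpM2r// ltW//.
have step4 : 0 <= (a l - a m) * mphi <= p%:R * kappa ^+ 2.
  case/andP: step3 => s1 s2; rewrite mulr_ge0//= expr2 mulrA ler_pM//.
exact: (combine_errors step1 step2 step4).
Qed.

(** The sequence [a] follows a geometric recursion up to the error of [visit]; the ratio lies in
    [[0, 1]], so the errors only add up. *)
Lemma avoidance_close M :
  `|a M - (1 - theta * mphi) ^+ M| <= M%:R * (2 * p%:R * kappa ^+ 2 + kappa * e).
Proof.
have m1 : mphi <= 1 by apply: Ex_le_cst; [exact: Cb_bmf|move=> y; case/andP: (phi01 y)].
case/andP: theta01 => t0 t1.
have c01 : 0 <= 1 - theta * mphi <= 1 by rewrite subr_ge0 mulr_ile1//= gerBl mulr_ge0.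
elim: M => [|m IH].
  rewrite /a (_ : H 0 = fun=> 1) ?Ex_cst ?expr0 ?subrr ?normr0 ?mul0r//.
  by apply/funext => w; rewrite /H big_ord0.
have aS : a m.+1 = a m - theta * E (fun w => H m w * phi (skel m w)).
  have bp : bmf (fun w => H m w * phi (skel m w)) by apply: bmfM => //; exact: bmf_skel.
  rewrite /a -ExZ// -ExB//; last by apply: bmfM => //; exact: bmf_cst.
  by congr Rintegral; apply/funext => w; rewrite /H big_ord_recr /= /f; ring.
have [v1 v2] := visit m.
set V := E (fun w => H m w * phi (skel m w)) in aS v1 v2.
rewrite aS exprS (_ : _ - _ = (1 - theta * mphi) * (a m - (1 - theta * mphi) ^+ m)
   - theta * (V - a m * mphi)); last by ring.
rewrite (le_trans (ler_normB _ _))// -[m.+1%:R]natr1 [leRHS]mulrDl mul1r lerD//.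
  rewrite normrM (ger0_norm (proj1 (andP c01))) (le_trans _ IH)// ler_piMl//.
  by case/andP: c01.
rewrite normrM (ger0_norm t0) (@le_trans _ _ `|V - a m * mphi|)//.
  by rewrite ler_piMl.
by rewrite ler_norml; apply/andP; split; lra.
Qed.

End avoidance_recursion.

(** * Convergence to the Poisson distribution *)

Section poisson_limits.
Context {R : realType}.

(** Beyond degree [k] the tail is [x ^ k.+1] times a series dominated by that of [exp x], as
    [(k + 1 + n)! >= n!]. *)
Lemma expR_taylor (x : R) k : 0 <= x ->
  x ^+ k / k`!%:R <= expR x - \sum_(j < k) x ^+ j / j`!%:R <= x ^+ k / k`!%:R + x ^+ k.+1 * expR x.
Proof.
move=> x0; pose s n := \sum_(j < n) x ^+ j / j`!%:R.
have t0 j : 0 <= x ^+ j / j`!%:R by rewrite divr_ge0// exprn_ge0.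
have cvgs : s @ \oo --> expR x.
  have := is_cvg_series_exp_coeff x; rewrite /expR.
  rewrite (_ : series (exp_coeff x) = s)//.
  by apply/funext => n; rewrite seriesEord.
have sSn m : s m.+1 = s m + x ^+ m / m`!%:R by rewrite /s big_ord_recr.
have s_le m n : s m <= s (m + n)%N.
  elim: n => [|n IH]; first by rewrite addn0.
  by rewrite addnS sSn (le_trans IH)// lerDl.
have s_exp n : s n <= expR x.
  have h : (fun m => s (m + n)%N) @ \oo --> expR x by rewrite (cvg_shiftn n s).
  by apply: (cvg_ge_cst h) => m; rewrite addnC.
have -> : \sum_(j < k) x ^+ j / j`!%:R = s k by [].
have sS := sSn k.
apply/andP; split; first by have := s_exp k.+1; lra.
rewrite lerBlDl addrA -sS.
apply: (cvg_le_cst cvgs) => n.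
apply: (le_trans (s_le n k.+1)); rewrite addnC.
apply: (@le_trans _ _ (s k.+1 + x ^+ k.+1 * s n)); last first.
  by rewrite lerD2l ler_wpM2l ?exprn_ge0.
elim: n => [|n IH]; first by rewrite addn0 /s [X in _ * X]big_ord0 mulr0 addr0.
rewrite addnS (sSn (k.+1 + n)%N) (sSn n) mulrDr addrA lerD//.
rewrite mulrA -exprD ler_wpM2l ?exprn_ge0// lef_pV2 ?posrE ?ltr0n ?fact_gt0//.
by rewrite ler_nat; apply: leq_fact; rewrite leq_addl.
Qed.

Lemma cvg_sum_seq (I : Type) (s : seq I) (u : I -> nat -> R) (l : I -> R) :
  (forall i, u i @ \oo --> l i) ->
  (fun n => \sum_(i <- s) u i n) @ \oo --> \sum_(i <- s) l i.
Proof.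
move=> ul; elim: s => [|i s IH].
  rewrite big_nil; under eq_fun do rewrite big_nil; exact: cvg_cst.
by rewrite big_cons; under eq_fun do rewrite big_cons; exact: cvgD.
Qed.

(* By induction on [k]: divide by [s ^ k], let [n] tend to infinity, then [s] to 0. *)
Lemma cvg_pgf_coeff (p : nat -> nat -> R) (G : nat -> R -> R) (tau : R) : 0 <= tau ->
  (forall n k s, 0 <= s <= 1 ->
    p n k * s ^+ k <= G n s - \sum_(j < k) p n j * s ^+ j <= p n k * s ^+ k + s ^+ k.+1) ->
  (forall s, 0 <= s <= 1 -> (G ^~ s) @ \oo --> expR (- (tau * (1 - s)))) ->
  forall k, (p ^~ k) @ \oo --> expR (- tau) * tau ^+ k / k`!%:R.
Proof.
move=> tau0 hp hG; pose q k := expR (- tau) * tau ^+ k / k`!%:R.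
elim/ltn_ind => k IH; rewrite -/(q k).
have hq s : 0 <= s <= 1 ->
    q k * s ^+ k <= expR (- (tau * (1 - s))) - \sum_(j < k) q j * s ^+ j <=
    q k * s ^+ k + tau ^+ k.+1 * s ^+ k.+1.
  move=> /andP[s0 s1].
  have e1 : expR (- (tau * (1 - s))) = expR (- tau) * expR (tau * s).
    by rewrite -expRD; congr expR; ring.
  have qE j : q j * s ^+ j = expR (- tau) * ((tau * s) ^+ j / j`!%:R).
    by rewrite /q exprMn; ring.
  under eq_bigr do rewrite qE.
  rewrite e1 qE -mulr_sumr -mulrBr.
  have /andP[l u] := expR_taylor k (mulr_ge0 tau0 s0).
  rewrite ler_wpM2l ?expR_ge0//=.
  apply: le_trans (ler_wpM2l (expR_ge0 _) u) _.
  rewrite mulrDr lerD2l exprMn mulrCA ler_piMr ?mulr_ge0 ?exprn_ge0//.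
  by rewrite -expRD -expR0 ler_expR; nra.
apply/cvgrPdist_le => e e0.
pose C := 1 + tau ^+ k.+1.
have C1 : 1 <= C by rewrite lerDl exprn_ge0.
(* After division by [s ^ k] the two remainders leave [s C], which this choice makes at most
   [e / 2]. *)
pose s := Num.min 1 (e / (2 * C)).
have C0 : 0 < C by lra.
have s0 : 0 < s by rewrite lt_min ltr01 divr_gt0// mulr_gt0.
have s1 : s <= 1 by rewrite ge_min lexx.
have sC : s * C <= e / 2.
  have : s <= e / (2 * C) by rewrite ge_min lexx orbT.
  rewrite ler_pdivlMr ?mulr_gt0//; lra.
have s01 : 0 <= s <= 1 by rewrite (ltW s0).
have cvgR : (fun n => G n s - \sum_(j < k) p n j * s ^+ j) @ \oo -->
    expR (- (tau * (1 - s))) - \sum_(j < k) q j * s ^+ j.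
  apply: cvgB; first exact: hG.
  apply: cvg_sum_seq => j; apply: cvgM; [exact: IH|exact: cvg_cst].
have sk0 : 0 < s ^+ k by rewrite exprn_gt0.
move/cvgrPdist_le : cvgR => /(_ (s ^+ k * (e / 2))).
rewrite mulr_gt0 ?divr_gt0// => /(_ isT); apply: filterS => n.
set Rn := G n s - _; set Ri := expR _ - _ => hR.
have /andP[p1 p2] := hp n k s s01; have /andP[q1 q2] := hq s s01.
rewrite -/Rn in p1 p2; rewrite -/Ri in q1 q2.
rewrite -(ler_pM2l sk0) -{1}(gtr0_norm sk0) -normrM.
move: hR; rewrite !ler_norml => /andP[r1 r2].
have sS : s ^+ k.+1 * C <= s ^+ k * (e / 2).
  by rewrite exprS mulrAC mulrC ler_wpM2l// ltW.
rewrite /C mulrDr mulr1 in sS.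
have sS0 : 0 <= s ^+ k.+1 by rewrite exprn_ge0// ltW.
have tS0 : 0 <= s ^+ k.+1 * tau ^+ k.+1 by rewrite mulr_ge0// exprn_ge0.
apply/andP; split; lra.
Qed.

(** Squeezed by [exp (- x / (1 - x)) <= 1 - x <= exp (- x)]. *)
Lemma cvg_pow_expR (x : nat -> R) (M : nat -> nat) (l : R) :
  (\forall n \near \oo, 0 <= x n) -> x @ \oo --> 0 ->
  (fun n => (M n)%:R * x n) @ \oo --> l ->
  (fun n => (1 - x n) ^+ M n) @ \oo --> expR (- l).
Proof.
move=> x0 cx cMx.
have x1 : \forall n \near \oo, x n < 1.
  by move/cvgrPdist_lt : cx => /(_ 1 ltr01); apply: filterS => n; rewrite sub0r normrN => /(le_lt_trans (ler_norm _)).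
apply: (@squeeze_cvgr _ _ _ _ (fun n => expR ((M n)%:R * - (x n / (1 - x n))))
  (fun n => expR ((M n)%:R * - x n))).
- near=> n.
  have n0 : 0 <= x n by near: n.
  have n1 : x n < 1 by near: n.
  have y0 : 0 < 1 - x n by lra.
  rewrite !expRM_natl !lerXn2r ?nnegrE ?expR_ge0 ?(ltW y0)//=.
    by have := expR_ge1Dx (- x n); lra.
  rewrite expRN -[leRHS]invrK lef_pV2 ?posrE ?invr_gt0 ?expR_gt0//.
  apply: le_trans (expR_ge1Dx _); rewrite le_eqVlt; apply/orP; left; apply/eqP.
  by field; rewrite gt_eqF.
- have h1 : (fun n => (1 - x n)^-1) @ \oo --> (1 - 0 : R)^-1.
    by apply: cvgV; [rewrite subr0 oner_neq0|apply: cvgB => //; exact: cvg_cst].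
  have h2 : (fun n => (M n)%:R * - (x n / (1 - x n))) @ \oo --> - l.
    under eq_fun do rewrite mulrN mulrA.
    by have := cvgN (cvgM cMx h1); rewrite subr0 invr1 mulr1; apply.
  exact: (cvg_comp _ _ h2 (@continuous_expR R (- l))).
- have h2 : (fun n => (M n)%:R * - x n) @ \oo --> - l.
    by under eq_fun do rewrite mulrN; exact: cvgN.
  exact: (cvg_comp _ _ h2 (@continuous_expR R (- l))).
Unshelve. all: by end_near. Qed.

End poisson_limits.

Lemma continuous_enorm {R : realType} {d : nat} (x0 : 'rV[R]_d) :
  continuous (fun y : 'rV[R]_d => enorm (y - x0)).
Proof.
move=> x; apply: seq_continuous => y yx.
have h : (fun n => dotRd (y n - x0) (y n - x0)) @ \oo --> dotRd (x - x0) (x - x0).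
  apply: cvg_sum_seq => j.
  have yj : (fun n => (y n - x0) ord0 j) @ \oo --> (x - x0) ord0 j.
    apply: (@cvg_comp _ _ _ (fun n => y n - x0) (fun z : 'rV[R]_d => z ord0 j)).
      exact: (cvgB yx (cvg_cst x0)).
    exact: coord_continuous.
  exact: cvgM.
exact: (cvg_comp _ _ h (@sqrt_continuous R _)).
Qed.

(** * Visits to a Euclidean ball *)

Section ball.
Context {dO : measure_display} {Omega : measurableType dO} {R : realType} {d : nat}.
Variables (P : probability Omega R).
Variables (b : 'rV[R]_d -> 'rV[R]_d) (W : R -> Omega -> 'rV[R]_d).
Variable X : 'rV[R]_d -> R -> Omega -> 'rV[R]_d.
Hypothesis BW : std_brownian P W.
Hypothesis solX : sde_solution b W X.
Variable K : R.
Hypotheses (K0 : 0 <= K) (bK : forall x y, `|b x - b y| <= K * `|x - y|).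
Variable mu : probability (Rd R d) R.
Hypothesis inv : invariant_measure P X mu.
Variable h : R.
Hypothesis h0 : 0 < h.
Variable x0 : 'rV[R]_d.

Local Notation Q := (Qt P X h).
Local Notation E f := (Ex (P \x mu)%E f).
Local Notation B := (eball x0).
Local Notation mB r := (fine (mu (eball x0 r))).

Lemma measurable_eball r : measurable (B r).
Proof.
rewrite /eball -[X in measurable X]setTI.
apply: (measurable_fun_ltr (f := fun y : Rd R d => enorm ((y : 'rV[R]_d) - x0))) => //.
by apply: (@continuous_measurable_mx R 1 d); exact: continuous_enorm.
Qed.

(** Both [Q phi] and [mu(B)] are compared with [r ^ d]; the lower bound on [mu(B)] also gives its
    positivity. *)
Lemma ball_harnack : exists2 C : R, 0 < C & forall r, 0 < r <= 1 -> 0 < mB r /\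
  forall phi, Cb phi -> (forall y, 0 <= phi y <= 1) ->
    (forall y, phi y != 0 -> B r y) -> forall x, Q phi x <= C * mB r.
Proof.
have [C1 C10 hC1] := Qt_upper_any BW solX K0 bK h0.
have [c c0 hc] := mu_lower BW solX K0 bK inv h0 x0.
(* The sup-norm ball of radius [2 r / s] lies in the Euclidean ball of radius [r], so the cutoff at
   [r / s] is below the indicator. *)
pose s : R := 2 * (Num.sqrt d%:R + 1).
have sd0 : 0 <= Num.sqrt d%:R :> R := sqrtr_ge0 _.
have s0 : 0 < s by rewrite /s; lra.
exists (C1 * s ^+ d / c); first by rewrite divr_gt0// mulr_gt0// exprn_gt0.
move=> r /andP[r0 r1].
have rs0 : 0 < r / s by rewrite divr_gt0.
have rs1 : r / s <= 1 by rewrite ler_pdivrMr// /s; lra.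
have low : c * (r / s) ^+ d <= mB r.
  rewrite -(Ex_indic mu (measurable_eball r)).
  have hrs : 0 < r / s <= 1 by rewrite rs0.
  apply: le_trans (hc (cutoff x0 (r / s)) (r / s) (Cb_cutoff _ _) _ _ hrs) _.
  - by move=> y; case/andP: (cutoff_itv x0 (r / s) y).
  - by move=> y hy; rewrite cutoff_eq1.
  apply: Ex_le; [apply: Cb_bmf; exact: Cb_cutoff|apply: bmf_indic; exact: measurable_eball|].
  move=> y; have /andP[p0 p1] := cutoff_itv x0 (r / s) y.
  have [->|n0] := eqVneq (cutoff x0 (r / s) y) 0; first by rewrite indicE ler0n.
  rewrite indicE mem_set//=; rewrite /eball /=.
  rewrite (le_lt_trans (enorm_le_norm _))//.
  have := cutoff_neq0 rs0 n0; rewrite -[_ *+ 2]mulr_natl => hy.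
  apply: (@le_lt_trans _ _ (Num.sqrt d%:R * (2 * (r / s)))).
    by rewrite ler_wpM2l// ltW.
  rewrite (_ : _ * _ = Num.sqrt d%:R * 2 * r / s); last by ring.
  by rewrite ltr_pdivrMr// /s; nra.
have mB0 : 0 < mB r by apply: lt_le_trans low; rewrite mulr_gt0// exprn_gt0.
split=> // phi cphi phi01 supp x.
apply: (le_trans (hC1 phi x x0 r cphi phi01 _ _)).
- by move=> y /supp hy; rewrite (le_trans (norm_le_enorm _))// ltW.
- by rewrite r0.
rewrite -mulrA -mulrA ler_wpM2l ?(ltW C10)//.
rewrite (_ : r ^+ d = s ^+ d * (c^-1 * (c * (r / s) ^+ d))).
  rewrite ler_wpM2l ?exprn_ge0 ?(ltW s0)// ler_wpM2l ?invr_ge0 ?(ltW c0)//.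
by rewrite mulKf ?gt_eqF// -exprMn mulrCA divff ?gt_eqF// mulr1.
Qed.

(** Zero off the ball, and equal to 1 at any given point of it once [j] is large, since the ball is
    open. *)
Let tent (r : R) (j : nat) (y : 'rV[R]_d) : R := clamp (j.+1%:R * (r - enorm (y - x0))).

Let Cb_tent r j : Cb (tent r j).
Proof.
apply: Cb_clamp => y.
exact: (cvgM (cvg_cst _) (cvgB (cvg_cst _) (@continuous_enorm _ _ x0 y))).
Qed.

Let tent_supp r j y : tent r j y != 0 -> B r y.
Proof.
apply: contraNP; rewrite /eball /= => /negP; rewrite -leNgt => hy.
by apply/eqP/clamp_eq0; rewrite mulr_ge0_le0// subr_le0.
Qed.

Let tent_cvg r y : (fun j => tent r j y) @ \oo --> (\1_(B r) y : R).
Proof.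
rewrite indicE; have [yB|yB] := ltP (enorm (y - x0)) r; last first.
  rewrite memNset /=; last by rewrite /eball /=; apply/negP; rewrite -leNgt.
  under eq_fun do rewrite /tent clamp_eq0 ?mulr_ge0_le0 ?subr_le0//.
  exact: cvg_cst.
rewrite mem_set//=; apply/cvgrPdist_lt => e e0.
have gap : 0 < r - enorm (y - x0) by rewrite subr_gt0.
have [k hk] := natSinv_lt gap.
exists k => // j /= kj; rewrite /tent clamp_eq1 ?subrr ?normr0//.
rewrite -ler_pdivrMl// mulr1 (le_trans _ (ltW hk))//.
by rewrite lef_pV2 ?posrE// ler_nat ltnS.
Qed.

Let bmf_1B r i : bmf (fun w => \1_(B r) (skel X h i w) : R).
Proof.
apply: (bmf_comp (g := (fun w : Omega * Rd R d => skel X h i w) : _ -> Rd R d)).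
  apply: (measurable_X BW solX K0 bK _ measurable_fst measurable_snd).
  by rewrite mulr_ge0// ltW.
apply: bmf_indic; exact: measurable_eball.
Qed.

(** The bound obtained for the functions [tent r j] does not depend on [j] and passes to the
    limit. *)
Lemma ball_avoidance (C r theta : R) (M p : nat) (e : R) : 0 < C -> 0 < mB r ->
  (forall phi, Cb phi -> (forall y, 0 <= phi y <= 1) ->
    (forall y, phi y != 0 -> B r y) -> forall x, Q phi x <= C * mB r) ->
  (forall g (k : R), Cb g -> 0 < k -> (forall y, 0 <= g y <= k) ->
    Ex mu (fun x => `|iter p Q g x - Ex mu g|) <= k * e) ->
  0 <= theta <= 1 ->
  `|E (fun w => \prod_(i < M) (1 - theta * \1_(B r) (skel X h i w))) - (1 - theta * mB r) ^+ M|
    <= M%:R * (2 * p%:R * (C * mB r) ^+ 2 + C * mB r * e).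
Proof.
move=> C0 mB0 hQ hmix th01; have kap0 : 0 < C * mB r by rewrite mulr_gt0.
have tent01 j y : 0 <= tent r j y <= 1 by exact: clamp_itv.
have bnd j := avoidance_close BW solX K0 bK inv h0 (Cb_tent r j) (tent01 j) kap0
  (hQ _ (Cb_tent r j) (tent01 j) (@tent_supp r j)) th01 (p := p) (e := e) _ M.
pose u j := E (fun w => \prod_(i < M) (1 - theta * tent r j (skel X h i w))) -
  (1 - theta * Ex mu (tent r j)) ^+ M.
have {}bnd j : `|u j| <= M%:R * (2 * p%:R * (C * mB r) ^+ 2 + C * mB r * e).
  apply: bnd => i; apply: hmix => //.
    by apply: (Qt_Cb BW solX K0 bK (ltW h0)).
  move=> y; rewrite (hQ _ (Cb_tent r i) (tent01 i) (@tent_supp r i)) andbT.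
  by apply: Ex_ge0 => w; case/andP: (tent01 i (X y h w)).
have mu_cvg : (fun j => Ex mu (tent r j)) @ \oo --> mB r.
  rewrite -(Ex_indic mu (measurable_eball r)).
  apply: (Ex_dct mu (F := tent r) (c := 1) _ _ _).2.
  - by move=> j; case: (Cb_bmf (Cb_tent r j)).
  - by move=> j y; have /andP[t0 t1] := tent01 j y; rewrite ger0_norm.
  - exact: tent_cvg.
have b1t j : bmf (fun w => \prod_(i < M) (1 - theta * tent r j (skel X h i w))).
  apply: bmf_prod => i; apply: bmfB; first exact: bmf_cst.
  by apply: bmfM; [exact: bmf_cst|exact: (bmf_skel BW solX K0 bK h0)].
have E_cvg : (fun j => E (fun w => \prod_(i < M) (1 - theta * tent r j (skel X h i w)))) @ \oo -->
    E (fun w => \prod_(i < M) (1 - theta * \1_(B r) (skel X h i w))).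
  apply: (Ex_dct (P \x mu)%E (F := fun j w => \prod_(i < M) (1 - theta * tent r j (skel X h i w)))
    (c := \prod_(i < M) 1) _ _ _).2.
  - by move=> j; case: (b1t j).
  - move=> j w; apply: prod_bound => i; have /andP[t0 t1] := tent01 j (skel X h i w).
    by case/andP: th01 => a0 a1; rewrite ger0_norm; nra.
  - move=> w; apply: cvg_prod_seq => i; apply: cvgB; first exact: cvg_cst.
    by apply: cvgM; [exact: cvg_cst|exact: tent_cvg].
have u_cvg : u @ \oo --> E (fun w => \prod_(i < M) (1 - theta * \1_(B r) (skel X h i w))) -
    (1 - theta * mB r) ^+ M.
  apply: cvgB => //.
  have hM : (fun j => 1 - theta * Ex mu (tent r j)) @ \oo --> 1 - theta * mB r.
    by apply: cvgB; [exact: cvg_cst|apply: cvgM => //; exact: cvg_cst].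
  exact: (cvg_comp _ _ hM (@exprn_continuous R M _)).
exact: (cvg_le_cst (cvg_norm u_cvg) bnd).
Qed.

Definition visits r M (w : Omega * Rd R d) : nat := (\sum_(i < M) (skel X h i w \in B r))%N.

(** Stated for every [F], because the induction on [M] replaces [F] by its shift when the last time
    is a visit. *)
Lemma bmf_visits r M (F : nat -> R) : bmf (fun w => F (visits r M w)).
Proof.
elim: M F => [|M IH] F.
  rewrite [X in bmf X](_ : _ = fun=> F 0%N); first exact: bmf_cst.
  by apply/funext => w; rewrite /visits big_ord0.
rewrite [X in bmf X](_ : _ = fun w => \1_(B r) (skel X h M w) * F (visits r M w).+1 +
   (1 - \1_(B r) (skel X h M w)) * F (visits r M w)).
  apply: bmfD; apply: bmfM.
  - exact: bmf_1B.
  - exact: (IH (fun n => F n.+1)).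
  - by apply: bmfB; [exact: bmf_cst|exact: bmf_1B].
  - exact: IH.
apply/funext => w; rewrite /visits big_ord_recr /= indicE.
by case: (_ \in _); rewrite ?addn1 ?addn0 /=; ring.
Qed.

Lemma prod_visits r M (theta : R) w :
  \prod_(i < M) (1 - theta * \1_(B r) (skel X h i w)) = (1 - theta) ^+ visits r M w.
Proof.
rewrite /visits expr_sum; apply: eq_bigr => i _; rewrite indicE.
by case: (_ \in _); rewrite /= ?mulr1 ?mulr0 ?subr0 ?expr1 ?expr0.
Qed.

(** Removing the first [k] terms leaves the event of at least [k] visits, on which more than [k]
    visits contribute at most [s ^ k.+1]. *)
Lemma visits_pgf r M k (s : R) : 0 <= s <= 1 ->
  E (fun w => (visits r M w == k)%:R : R) * s ^+ k <=
  E (fun w => s ^+ visits r M w) - \sum_(j < k) E (fun w => (visits r M w == j)%:R : R) * s ^+ j <=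
  E (fun w => (visits r M w == k)%:R : R) * s ^+ k + s ^+ k.+1.
Proof.
move=> /andP[s0 s1].
have bk j : bmf (fun w => (visits r M w == j)%:R : R) := bmf_visits r M (fun n => (n == j)%:R).
have bs : bmf (fun w => s ^+ visits r M w) := bmf_visits r M (fun n => s ^+ n).
have bks j : bmf (fun w => (visits r M w == j)%:R * s ^+ j) by apply: bmfM => //; exact: bmf_cst.
have EZ j : E (fun w => (visits r M w == j)%:R : R) * s ^+ j = E (fun w => (visits r M w == j)%:R * s ^+ j).
  by rewrite mulrC -ExZ//; congr Rintegral; apply/funext => w; rewrite mulrC.
under eq_bigr do rewrite EZ.
rewrite -Ex_sum// -ExB//; last exact: bmf_sum.
have eq_tail w : s ^+ visits r M w - \sum_(j < k) (visits r M w == j)%:R * s ^+ j =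
    (k <= visits r M w)%:R * s ^+ visits r M w.
  have [kv|vk] := leqP k (visits r M w).
    rewrite big1 ?subr0 ?mul1r// => j _; rewrite gtn_eqF ?mul0r//.
    exact: leq_trans (ltn_ord j) kv.
  rewrite (bigD1 (Ordinal vk))//= eqxx mul1r big1 ?addr0 ?subrr ?mul0r// => j jv.
  by rewrite eq_sym (_ : (j == visits r M w :> nat) = false) ?mul0r//; exact/negbTE.
rewrite EZ; apply/andP; split.
  apply: Ex_le => //; first by apply: bmfB => //; exact: bmf_sum.
  move=> w; rewrite eq_tail; case: eqP => [->|_]; first by rewrite leqnn.
  by rewrite mul0r mulr_ge0// exprn_ge0.
rewrite -[X in _ + X](Ex_cst (P \x mu)%E) -ExD//; last exact: bmf_cst.
apply: Ex_le => //; first by apply: bmfB => //; exact: bmf_sum.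
  by apply: bmfD => //; exact: bmf_cst.
move=> w; rewrite eq_tail; have [vk|vk|->] := ltngtP (visits r M w) k.
- by rewrite !mul0r add0r exprn_ge0.
- by rewrite mul0r add0r mul1r ler_wiXn2l.
- by rewrite lerDl exprn_ge0.
Qed.

End ball.

(** * Passage to the limit along the given radii *)

Section poisson.
Context {dO : measure_display} {Omega : measurableType dO} {R : realType} {d : nat}.
Variables (P : probability Omega R).
Variables (b : 'rV[R]_d -> 'rV[R]_d) (W : R -> Omega -> 'rV[R]_d).
Variable X : 'rV[R]_d -> R -> Omega -> 'rV[R]_d.
Hypothesis BW : std_brownian P W.
Hypothesis solX : sde_solution b W X.
Variable K : R.
Hypotheses (K0 : 0 <= K) (bK : forall x y, `|b x - b y| <= K * `|x - y|).
Variable mu : probability (Rd R d) R.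
Hypothesis inv : invariant_measure P X mu.
Variable h : R.
Hypothesis h0 : 0 < h.
Variable x0 : 'rV[R]_d.
Variables (r : nat -> R) (tau : R).
Hypotheses (r0 : forall n, 0 < r n) (tau0 : 0 < tau).

Local Notation E f := (Ex (P \x mu)%E f).
Local Notation m n := (fine (mu (eball x0 (r n)))).
(** The sum runs up to the integer part of [tau / m n] included, hence the successor. *)
Local Notation M n := (Num.truncn (tau / m n)).+1.
Hypothesis nm : (fun n => n%:R * m n) @ \oo --> tau.

Lemma ball_mass_cvg0 : (fun n => m n) @ \oo --> (0 : R).
Proof.
have h1 : (fun n => n.+1%:R^-1 * (n.+1%:R * m n.+1)) @ \oo --> (0 * tau : R).
  apply: cvgM; first exact: cvg_harmonic.
  by move: nm; rewrite -(cvg_shiftS (fun n => n%:R * m n)).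
rewrite mul0r in h1; rewrite -cvg_shiftS.
by move: h1; under eq_fun do rewrite mulKf//.
Qed.

(** With a radius above 1 the ball would have at least the mass of the unit ball, which is positive,
    whereas the masses tend to 0. *)
Lemma radius_le1 : \forall n \near \oo, r n <= 1.
Proof.
have [C C0 hC] := ball_harnack BW solX K0 bK inv h0 x0.
have r11 : 0 < (1 : R) <= 1 by rewrite ltr01 lexx.
have m1 := (hC 1 r11).1.
move/cvgrPdist_lt : ball_mass_cvg0 => /(_ _ m1); apply: filterS => n.
rewrite sub0r normrN leNgt => hm; apply/negP => r1.
move: hm; apply/negP; rewrite -leNgt; apply: le_trans (ler_norm _).
rewrite -!(Ex_indic mu (measurable_eball x0 _)).
apply: Ex_le; [apply: bmf_indic; exact: measurable_eball|apply: bmf_indic; exact: measurable_eball|].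
move=> y; rewrite !indicE ler_nat; case: (boolP (y \in eball x0 1)) => // yB.
rewrite mem_set//; move: yB; rewrite inE /eball /= => yB; exact: lt_trans r1.
Qed.

Lemma ball_mass_gt0 : \forall n \near \oo, 0 < m n.
Proof.
have [C C0 hC] := ball_harnack BW solX K0 bK inv h0 x0.
by apply: filterS radius_le1 => n rn; case: (hC (r n)) => //; rewrite r0.
Qed.

Lemma horizon_bounds : \forall n \near \oo, tau < (M n)%:R * m n <= tau + m n.
Proof.
apply: filterS ball_mass_gt0 => n m0.
have tm : 0 <= tau / m n by rewrite divr_ge0// ltW.
have /andP[h1 h2] := truncn_itv tm.
rewrite -ltr_pdivrMr// h2/= -natr1 mulrDl mul1r lerD2r.
by rewrite -ler_pdivlMr.
Qed.

Lemma horizon_cvg : (fun n => (M n)%:R * m n) @ \oo --> tau.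
Proof.
apply: (@squeeze_cvgr _ _ _ _ (fun=> tau) (fun n => tau + m n)).
- by apply: filterS horizon_bounds => n /andP[/ltW -> ->].
- exact: cvg_cst.
- by rewrite -[X in _ --> X]addr0; apply: cvgD; [exact: cvg_cst|exact: ball_mass_cvg0].
Qed.

Lemma visits_pgf_cvg s : 0 <= s <= 1 ->
  (fun n => E (fun w => s ^+ visits X h x0 (r n) (M n) w)) @ \oo --> expR (- (tau * (1 - s))).
Proof.
move=> /andP[s0 s1]; set theta := 1 - s.
have th01 : 0 <= theta <= 1 by rewrite /theta; apply/andP; split; lra.
have [C C0 hC] := ball_harnack BW solX K0 bK inv h0 x0.
have pow : (fun n => (1 - theta * m n) ^+ M n) @ \oo --> expR (- (tau * theta)).
  apply: cvg_pow_expR.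
  - by apply: filterS ball_mass_gt0 => n /ltW m0; rewrite mulr_ge0//; case/andP: th01.
  - by rewrite -[X in _ --> X](mulr0 theta); apply: cvgM; [exact: cvg_cst|exact: ball_mass_cvg0].
  - under eq_fun do rewrite mulrCA mulrC.
    by apply: cvgM; [exact: horizon_cvg|exact: cvg_cst].
have close : (fun n => E (fun w => s ^+ visits X h x0 (r n) (M n) w) - (1 - theta * m n) ^+ M n)
    @ \oo --> (0 : R).
  apply/cvgrPdist_le => e e0.
  have D0 : 0 < (tau + 1) * C by rewrite mulr_gt0// addr_gt0.
  (* The accuracy of mixing is fixed first, so that [p] does not depend on [n] and the term in [p]
     vanishes with the mass of the ball. *)
  have [e' e'0 e'E] : exists2 e', 0 < e' & (tau + 1) * (C * e') = e / 2.
    exists (e / 2 / ((tau + 1) * C)); first by rewrite !divr_gt0.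
    by rewrite mulrA mulrC divfK// gt_eqF.
  have [p hp] := mixing_any BW solX K0 bK inv h0 e'0.
  have small : \forall n \near \oo, (tau + 1) * (2 * p%:R * C ^+ 2) * m n <= e / 2.
    have : (fun n => (tau + 1) * (2 * p%:R * C ^+ 2) * m n) @ \oo --> (0 : R).
      rewrite -[X in _ --> X](mulr0 ((tau + 1) * (2 * p%:R * C ^+ 2))).
      by apply: cvgM; [exact: cvg_cst|exact: ball_mass_cvg0].
    move/cvgrPdist_le => /(_ (e / 2)); rewrite divr_gt0// => /(_ isT).
    by apply: filterS => n; rewrite sub0r normrN => /(le_trans (ler_norm _)).
  have m1 : \forall n \near \oo, m n <= 1.
    move/cvgrPdist_le : ball_mass_cvg0 => /(_ 1 ltr01).
    by apply: filterS => n; rewrite sub0r normrN => /(le_trans (ler_norm _)).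
  near=> n.
  have mn0 : 0 < m n by near: n; exact: ball_mass_gt0.
  have rn : 0 < r n <= 1 by rewrite r0; near: n; exact: radius_le1.
  have mn1 : m n <= 1 by near: n.
  have sm : (tau + 1) * (2 * p%:R * C ^+ 2) * m n <= e / 2 by near: n.
  have /andP[_ hM] : tau < (M n)%:R * m n <= tau + m n by near: n; exact: horizon_bounds.
  have := ball_avoidance BW solX K0 bK inv h0 (M n) C0 mn0 (hC _ rn).2 hp th01.
  under [X in Ex _ X]eq_fun do rewrite prod_visits.
  rewrite (_ : 1 - theta = s); last by rewrite /theta; ring.
  rewrite sub0r normrN => /le_trans; apply.
  rewrite (_ : _ * _ = ((M n)%:R * m n) * (2 * p%:R * C ^+ 2 * m n + C * e')); last by ring.
  apply: (@le_trans _ _ ((tau + 1) * (2 * p%:R * C ^+ 2 * m n + C * e'))).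
    rewrite ler_wpM2r//; last by lra.
    by rewrite addr_ge0 ?mulr_ge0 ?exprn_ge0 ?ler0n ?(ltW C0) ?(ltW mn0) ?(ltW e'0).
  by rewrite mulrDr mulrA e'E; lra.
exact: cvg_sub0 close pow.
Unshelve. all: by end_near.
Qed.

Lemma visits_poisson k :
  (fun n => E (fun w => (visits X h x0 (r n) (M n) w == k)%:R)) @ \oo -->
  expR (- tau) * tau ^+ k / k`!%:R.
Proof.
apply: (cvg_pgf_coeff (p := fun n k => E (fun w => (visits X h x0 (r n) (M n) w == k)%:R))
  (G := fun n s => E (fun w => s ^+ visits X h x0 (r n) (M n) w))).
- exact: ltW.
- by move=> n j s s01; apply: (visits_pgf BW solX K0 bK _ h0 _ (r n) _ j s01).
- by move=> s; exact: visits_pgf_cvg.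
Qed.

Lemma measure_visits rho M k :
  (P \x mu)%E [set w | visits X h x0 rho M w = k] =
  (E (fun w => (visits X h x0 rho M w == k)%:R))%:E.
Proof.
have hb := bmf_visits BW solX K0 bK h0 x0 rho M (fun v => (v == k)%:R : R).
rewrite EFin_Ex//.
have mS : measurable [set w | visits X h x0 rho M w = k].
  have := hb.1 measurableT [set 1] (measurable_set1 _); rewrite setTI.
  congr measurable; apply/seteqP; split => w /=.
    by case: eqP => // _ /esym/eqP; rewrite oner_eq0.
  by move=> ->; rewrite eqxx.
rewrite -[A in (P \x mu)%E A]setIT -integral_indic//.
apply: eq_integral => w _; rewrite indicE; congr (_%:R)%:E; congr nat_of_bool.
by apply/idP/eqP => [|vk]; [rewrite inE|rewrite mem_set].
Qed.

End poisson.

Unset Implicit Arguments.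

Theorem theorem6 (R : realType) (d : nat) (dO : measure_display)
  (Omega : measurableType dO) (P : probability Omega R)
  (W : R -> Omega -> 'rV[R]_d) (b : 'rV[R]_d -> 'rV[R]_d)
  (X : 'rV[R]_d -> R -> Omega -> 'rV[R]_d) (mu : probability (Rd R d) R)
  (h tau : R) (x0 : 'rV[R]_d) (u : nat -> R) (k : nat) :
  std_brownian P W ->
  lipschitz_drift b -> dissipative_drift b ->
  sde_solution b W X ->
  invariant_measure P X mu ->
  0 < h -> 0 < tau ->
  (fun n : nat => n%:R * fine (mu (eball x0 (expR (- u n))))) @ \oo --> tau ->
  (fun n : nat =>
     (P \x mu)%E
       [set p : Omega * Rd R d |
          (\sum_(i < (Num.truncn (tau / fine (mu (eball x0 (expR (- u n)))))).+1)
             ((X p.2 (i%:R * h)%R p.1 \in eball x0 (expR (- u n))) : nat))%N = k])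
    @ \oo --> (expR (- tau) * tau ^+ k / k`!%:R)%:E.
Proof.
move=> BW /lipschitz_drift_norm[K K0 bK] _ solX inv h0 tau0 nm.
have r0 n : 0 < expR (- u n) := expR_gt0 _.
under eq_fun do rewrite (measure_visits BW solX K0 bK mu h0 x0).
apply: cvg_EFin; first exact: nearW.
exact: (visits_poisson BW solX K0 bK inv h0 r0 tau0 nm).
Qed.
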